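(* For any $\alpha>1$, $\kappa\in(1/2,1]$, $t>0$, $f\in\mathrm{BL}^\kappa$, $K\in(0,\infty)$ and $E<\frac{\kappa}{3\kappa+4}\left[(1-\alpha^{-1})\wedge\frac12\right]$, we have $$\sup_{|x|\le K}\left|E_x[f(X_t)]-E^n_{\frac{\lfloor nx\rfloor}{n}}[f(X^n_t)]\right|\lesssim\|f\|_{\mathrm{BL}^\kappa}\,n^{-E},\qquad\mathbb P\text{-a.s.}$$
   Context: One-dimensional Bouchaud trap model. $(\tau_x)_{x\in\mathbb Z}$ are i.i.d. random variables on a probability space with probability $\mathbb P$ and expectation $\mathbb E$, with $\mathbb P(\tau_0\ge u)=u^{-\alpha}$ for $u>1$. For a realization of $(\tau_x)$, put $\mu_n=\frac1n\sum_{x\in\mathbb Z}\tau_x\delta_{x/n}$ on $n^{-1}\mathbb Z$ and $\mu=\mathbb E[\tau_0]\,dx$ on $\mathbb R$. $X^n=(X^n_t)$, with law $P^n_a$ and expectation $E^n_a$ when started from $a\in n^{-1}\mathbb Z$, is the Markov process associated with $n^{-1}\mathbb Z$ equipped with the Euclidean metric (as resistance metric) and $\mu_n$, i.e. the continuous-time chain with generator $\Delta_nf(x/n)=\frac{n^2}{\tau_x}\sum_{y:|y-x|=1}(f(y/n)-f(x/n))$. $X=(X_t)$, with expectation $E_a$ when started from $a$, is the process associated with $\mathbb R$ with the Euclidean metric and $\mu$, i.e. the diffusion with generator $\frac1{\mathbb E[\tau_0]}\frac{d^2}{dx^2}$. $\|f\|_{\mathrm{BL}^\kappa}=\sup_{\mathbb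 R}|f|+\sup_{x\ne y}|f(x)-f(y)|/|x-y|^\kappa$, and $\mathrm{BL}^\kappa$ is the set of $f:\mathbb R\to\mathbb R$ with finite norm. The $\mathbb P$-a.s. estimate $\lesssim$ means: there is a $\mathbb P$-a.s. finite random constant $C$, depending on neither $n$ nor $f$ (but possibly on the realization of $(\tau_x)$ and on $\alpha,\kappa,t,K,E$), such that the inequality holds $\mathbb P$-a.s. for all $n\ge1$ with constant $C$. *)

(* Defs.v *)
From HB Require Import structures.
From mathcomp Require Export all_boot all_order all_algebra.
From mathcomp Require Export all_classical all_reals all_analysis measurable_realfun.
Export Order.TTheory GRing.Theory Num.Theory.
Export numFieldNormedType.Exports.

Set Implicit Arguments.
Unset Strict Implicit.
Unset Printing Implicit Defensive.

Global Open Scope classical_set_scope.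
Global Open Scope ring_scope.

Section environment.
Context {d : measure_display} {Omega : measurableType d} {R : realType}.
Variable (P : probability Omega R).

Definition mutually_independent (tau : int -> {RV P >-> R}) :=
  forall (s : seq int) (B : int -> set R),
    uniq s -> (forall x, measurable (B x)) ->
    P (\big[setI/setT]_(x <- s) (tau x @^-1` B x)) =
    (\prod_(x <- s) P (tau x @^-1` B x))%E.

Definition identically_distributed (tau : int -> {RV P >-> R}) :=
  forall (x : int) (B : set R), measurable B ->
    distribution P (tau x) B = distribution P (tau 0) B.

Definition pareto_tail (alpha : R) (Y : {RV P >-> R}) :=
  forall u : R, 1 < u -> P [set w | u <= Y w] = (u `^ (- alpha))%:E.

Definition bouchaud_environment (alpha : R) (tau : int -> {RV P >-> R}) :=
  [/\ mutually_independent tau, identically_distributed tau &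
      pareto_tail alpha (tau 0)].

End environment.

(** The state space is a (closed) subset [S] of the line.  A process is a
    family [X t], for [0 <= t], of functions on a measurable space [W],
    together with a family [Q a] of laws on [W], [Q a] being the law started
    from [a]; [Q a] is irrelevant for [a] outside [S]. *)

Section markov_process.
Context {R : realType} {d : measure_display} {W : measurableType d}.
Variables (S : set R) (Q : R -> probability W R) (X : R -> W -> R).

Definition expect (a t : R) (f : R -> R) : R := \int[Q a]_w f (X t w).

Definition natural_filtration (s : R) : set (set W) :=
  <<s [set A | exists (r : R) B, [/\ 0 <= r <= s, measurable B &
                               A = X r @^-1` B]] >>.

Definition markov_process :=
  [/\ forall t : R, 0 <= t -> measurable_fun setT (X t) /\ forall w, S (X t w),
      forall a, S a -> Q a [set w | X 0 w = a] = 1%E,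
      forall (t : R) B, 0 <= t -> measurable B ->
        measurable_fun S (fun a : R => Q a (X t @^-1` B)) &
      forall (a s t : R) A B, S a -> 0 <= s -> 0 <= t ->
        natural_filtration s A -> measurable B ->
        Q a (A `&` X (s + t) @^-1` B) =
        (\int[Q a]_(w in A) Q (X s w) (X t @^-1` B))%E ].

Definition cadlag_paths := forall w,
  (forall t, 0 <= t -> X s w @[s --> t^'+] --> X t w) /\
  (forall t, 0 < t -> cvg (X s w @[s --> t^'-])).

Definition continuous_paths := forall w,
  {within `[0, +oo[, continuous (fun s => X s w)}.

(* The Banach space C_0(S), carried by functions on the whole line of which
   only the values on S matter. *)
Definition C0 (g : R -> R) :=
  {within S, continuous g} /\
  forall e, 0 < e -> exists M, forall x, S x -> M < `|x| -> `|g x| < e.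

Definition feller :=
  (forall t g, 0 <= t -> C0 g -> C0 (fun a => expect a t g)) /\
  (forall g, C0 g ->
     {uniform S, (fun t : R => fun a => expect a t g) @ 0^'+ --> g}).

(* The graph of the infinitesimal generator of the semigroup on C_0(S). *)
Definition infinitesimal_generator (g h : R -> R) :=
  [/\ C0 g, C0 h &
      {uniform S,
        (fun t : R => fun a => (expect a t g - g a) / t) @ 0^'+ --> h}].

End markov_process.

Section processes.
Context {R : realType} {d : measure_display} {W : measurableType d}.

Definition grid (n : nat) : set R := range (fun k : int => k%:~R / n%:R).

(* The graph, in C_0(n^-1 Z), of the generator with jump rates n^2 / v k from
   k / n to each neighbour; v is the realization of the trapping landscape. *)
Definition btm_operator (n : nat) (v : int -> R) (g h : R -> R) :=
  [/\ C0 (grid n) g, C0 (grid n) h &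
      forall k : int, h (k%:~R / n%:R) =
        n%:R ^+ 2 / v k *
        ((g ((k + 1)%:~R / n%:R) - g (k%:~R / n%:R)) +
         (g ((k - 1)%:~R / n%:R) - g (k%:~R / n%:R)))].

Definition btm_process (n : nat) (v : int -> R)
    (Q : R -> probability W R) (X : R -> W -> R) :=
  [/\ markov_process (grid n) Q X, cadlag_paths X, feller (grid n) Q X &
      forall g h, infinitesimal_generator (grid n) Q X g h <->
                  btm_operator n v g h].

(* The graph of m^-1 d^2/dx^2 in C_0(R), on its natural domain: the C^2
   functions which belong to C_0(R) together with their second derivative. *)
Definition diffusion_operator (m : R) (g h : R -> R) :=
  [/\ C0 setT g, C0 setT h,
      (forall x, derivable g x 1 /\ derivable (derive1 g) x 1) &
      forall x, h x = m^-1 * derive1 (derive1 g) x].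

Definition diffusion_process (m : R)
    (Q : R -> probability W R) (X : R -> W -> R) :=
  [/\ markov_process setT Q X, continuous_paths X, feller setT Q X &
      forall g h, infinitesimal_generator setT Q X g h <->
                  diffusion_operator m g h].

End processes.

(* +oo exactly when f is not in BL^kappa. *)
Definition BLnorm {R : realType} (kappa : R) (f : R -> R) : \bar R :=
  (ereal_sup [set `|f x|%:E | x in [set: R]] +
   ereal_sup [set (`|f xy.1 - f xy.2| / `|xy.1 - xy.2| `^ kappa)%:E
               | xy in [set xy : R * R | xy.1 != xy.2]])%E.

(* Main.v *)
Require Import Defs.
From mathcomp Require Import ring lra zify.

Set Implicit Arguments.
Unset Strict Implicit.
Unset Printing Implicit Defensive.

(** Let [m] be the mean of a trap.  Both processes enter only through their
    semigroups, and these only through their generators: the generator of the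
    chain is bounded because traps are at least 1, and the one of the diffusion
    is [m^-1 d^2/dx^2].  The comparison is made in a fixed landscape, then the
    landscape is shown to be good almost surely.

    In a fixed landscape [v], let [Phi] solve
    [Phi (k + 1) - 2 Phi k + Phi (k - 1) = v k - m].  If [u] is the diffusion
    semigroup applied to a smooth function and [q] its second space derivative,
    then [u + q Phi / (m n ^+ 2)] solves the Kolmogorov equation of the chain up
    to an error governed by [Phi / n ^+ 2], the differences of [Phi] over [n],
    and the third and fourth derivatives of [u] ([corrector_consistency]).  The
    same [Phi] gives a function [barrier], close to [m x ^+ 2] and above [x ^+ 2],
    on which the generator of the chain is exactly 2; so the chain leaves a box of
    width [L] with a probability of order [L ^- 2] ([chain_tail]).  A maximum
    principle for right derivatives in time ([parabolic_maximum_principle])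
    turns these two facts into a bound for the difference of the semigroups
    ([kolmogorov_stability], [smooth_comparison]).

    A function of [BL^kappa] is first cut off at the scale [n ^ (kappa b / 2)] and
    averaged at the scale [n ^ - b], which costs [n ^ - (kappa b)] twice; the
    fourth derivatives created are of order [n ^ (4 b)].  If the sums of [v - m]
    over [1 .. i] are of order [i ^ theta] with [theta = 1 - b (4 + 2 kappa)], the
    corrector costs [n ^ - (kappa b)] as well ([deterministic_rate]).  The choice
    [b (3 kappa + 4) = min (1 - 1 / alpha, 1 / 2)] makes [kappa b] the announced
    limit exponent, and [theta > max (1 / alpha, 1 / 2)].

    It remains to show that almost surely the centred sums of the traps are
    [O (i ^ theta)] for each such [theta].  Choose [p <= 2] with [p < alpha] and
    [1 / p < theta].  The moment of order [p] is finite ([pareto_moment]).  Up to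
    the index [2 ^ J], truncate at [2 ^ (J / p)]; a partial sum of the centred
    truncated variables is a sum of at most [J] dyadic blocks, so its square is at
    most [J] times the sum of the squares of all blocks
    ([partial_sum_block_energy]).  Second moments of blocks and first moments of
    the excesses over the truncation, divided by the target size, are summable in
    [J], and a sum of nonnegative variables with finite expectation is finite
    almost surely ([deviation_rate]).  This sum is the random constant, and it
    depends neither on [n] nor on [f]. *)

(** * Calculus on the line and mollification *)

Definition has_derivative {R : realType} (f f' : R -> R) :=
  forall x : R, is_derive x (1 : R) f (f' x).

Section calculus.
Context {R : realType}.
Implicit Types (f g A F : R -> R).

Lemma has_derivative_within f f' (i : interval R) : has_derivative f f' ->
  {within [set` i], continuous f}.
Proof.
move=> df; apply: derivable_within_continuous => x _.
by have [] := df x.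
Qed.

Lemma has_derivative_continuous f f' : has_derivative f f' -> continuous f.
Proof.
move=> df x; apply/differentiable_continuous; rewrite -derivable1_diffP.
by have [] := df x.
Qed.

Lemma MVT_incr f f' (x h : R) : has_derivative f f' -> 0 <= h ->
  exists2 c, x <= c <= x + h & f (x + h) - f x = f' c * h.
Proof.
move=> df h0.
have [c] := @MVT_segment R f f' x (x + h) ltac:(by rewrite lerDl)
  (fun y _ => df y) (has_derivative_within df).
rewrite in_itv/= => cx e; exists c => //; rewrite e; congr (_ * _); ring.
Qed.

Lemma MVT_lipschitz f f' M (x y : R) : has_derivative f f' ->
  (forall z, `|f' z| <= M) -> `|f y - f x| <= M * `|y - x|.
Proof.
move=> df bf; wlog xy : x y / x <= y => [hw|].
  have [/hw//|/ltW/hw] := leP x y.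
  by rewrite distrC [X in _ * X]distrC.
have [|c _] := @MVT_incr f f' x (y - x) df; first by rewrite subr_ge0.
rewrite subrKC => ->; rewrite normrM; exact: ler_wpM2r.
Qed.

Lemma is_derive_comp_affine f (a c s d : R) :
  is_derive (a + c * s) (1 : R) f d ->
  is_derive s (1 : R) (fun s => f (a + c * s)) (c * d).
Proof.
move=> df.
have da : is_derive s (1 : R) (fun s => a + c * s) c.
  by apply: is_derive_eq; rewrite /GRing.scale/= ?mulr0 ?addr0 ?add0r ?mulr1 mul1r.
have := @is_derive1_comp R f (fun s => a + c * s) s d c df da.
by rewrite mulrC.
Qed.

(** The symmetric sum [f (x + s) + f (x - s)] reduces the claim to two
    applications of the mean value theorem; this loses only a factor 2. *)
Lemma second_difference_close f f' f'' (x h c e : R) :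
  has_derivative f f' -> has_derivative f' f'' -> 0 <= h ->
  (forall y, `|y - x| <= h -> `|f'' y - c| <= e) ->
  `|f (x + h) - 2 * f x + f (x - h) - c * h ^+ 2| <= 2 * e * h ^+ 2.
Proof.
move=> df df' h0 bf.
pose G s := f (x + s) + f (x - s) - c * s ^+ 2.
pose G' s := f' (x + s) - f' (x - s) - 2 * c * s.
have dG : has_derivative G G'.
  move=> s; rewrite /G /G'.
  have d1 := df (x + s); have d2 := df (x - s).
  have i1 : is_derive s (1:R) (fun s => f (x + s)) (f' (x + s)).
    have := @is_derive_comp_affine f x 1 s (f' (x + s)).
    by rewrite !mul1r; under eq_fun do rewrite mul1r; exact.
  have i2 : is_derive s (1:R) (fun s => f (x - s)) (- f' (x - s)).
    have := @is_derive_comp_affine f x (- 1) s (f' (x - s)).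
    by rewrite !mulN1r; under eq_fun do rewrite mulN1r; exact.
  apply: is_derive_eq.
  by rewrite /GRing.scale/=; ring.
have [s /andP[s0 sh]] := MVT_incr 0 dG h0; rewrite add0r in sh *.
rewrite {1 2}/G addr0 subr0 expr0n/= mulr0 subr0 => e1.
rewrite (_ : _ - _ * h ^+ 2 = G' s * h); last first.
  by rewrite -e1; ring.
have s2 : 0 <= 2 * s by rewrite mulr_ge0.
have [y /andP[y0 y1]] := MVT_incr (x - s) df' s2.
rewrite (_ : x - s + 2 * s = x + s) in y1 *; last by ring.
move=> e2; rewrite /G' (_ : _ - _ = (f'' y - c) * (2 * s)); last first.
  by rewrite e2; ring.
have b1 : `|f'' y - c| <= e.
  by apply: bf; rewrite ler_norml; apply/andP; split; lra.
rewrite !normrM (ger0_norm s0) (ger0_norm h0) (@ger0_norm _ 2)//.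
have e0 : 0 <= e by rewrite (le_trans _ b1).
apply: (@le_trans _ _ (e * (2 * h) * h)); last by rewrite expr2; lra.
rewrite ler_wpM2r// ler_pM// ?mulr_ge0// ler_wpM2l//.
Qed.

(** Odd derivatives are obtained from the even ones: over an interval of length
    1 the derivative takes a value of size [2 M0], and it varies by at most [M2]. *)
Lemma landau_kolmogorov f f' f'' M0 M2 (x : R) :
  has_derivative f f' -> has_derivative f' f'' ->
  (forall z, `|f z| <= M0) -> (forall z, `|f'' z| <= M2) ->
  `|f' x| <= 2 * M0 + M2.
Proof.
move=> df df' b0 b2.
have [c /andP[xc cx]] := MVT_incr x df ler01; rewrite mulr1 => e.
have b1 := MVT_lipschitz x c df' b2.
rewrite -[f' x](subrK (f' c)) -[_ - f' c]opprB.
rewrite (le_trans (ler_normD _ _))// normrN addrC lerD//.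
  rewrite -e (le_trans (ler_normB _ _))//.
  by rewrite mulrDl mul1r lerD.
rewrite (le_trans b1)// -[leRHS]mulr1 ler_wpM2l ?(le_trans _ (b2 x))//.
by rewrite ler_norml; apply/andP; split; lra.
Qed.

Lemma antiderivative_bounded F (r : R) : continuous F -> 0 < r ->
  exists A, forall x, - r < x < r -> is_derive x (1 : R) A (F x).
Proof.
move=> cF r0.
exists (fun x => (\int[lebesgue_measure]_(t in [set` `[- r, x]]) (F t))%R).
move=> x /andP[rx xr].
have := @continuous_FTC1_closed R F (- r) x r xr _ rx (cF x).
case => [|d1 <-].
  apply: continuous_compact_integrable; first exact: segment_compact.
  exact: continuous_subspaceT.
by apply: DeriveDef; [exact: d1|rewrite derive1E].
Qed.

Lemma is_derive0_segment f (a b : R) : a <= b ->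
  (forall x, a <= x <= b -> is_derive x (1 : R) f 0) -> f a = f b.
Proof.
move=> ab df.
have [|x xab|c _] := @MVT_segment R f (cst 0) a b ab.
- move=> x; rewrite in_itv/= => /andP[/ltW ax /ltW xb].
  by apply: df; rewrite ax.
- apply: derivable_within_continuous => y; rewrite in_itv/= => yab.
  by have [] := df y yab.
by rewrite mul0r => /eqP; rewrite subr_eq0 => /eqP.
Qed.

(** The integrals from the left end of growing segments, normalised to vanish at
    the origin, agree where they overlap. *)
Lemma antiderivative F : continuous F -> exists A, has_derivative A F.
Proof.
move=> cF.
have /choice[G Gp] : forall r : {posnum R}, exists A, A 0 = 0 /\
    forall x, - r%:num < x < r%:num -> is_derive x (1 : R) A (F x).
  move=> r; have [//|A dA] := @antiderivative_bounded F r%:num cF.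
  exists (A \- cst (A 0)); split => [|x xr]; first by rewrite /= subrr.
  have := dA x xr => ?.
  by apply: is_derive_eq; rewrite subr0.
have uni (r s : {posnum R}) x : `|x| < r%:num -> `|x| < s%:num ->
    G r x = G s x.
  rewrite !ltr_norml => /andP[r1 r2] /andP[s1 s2].
  suff : (G r \- G s) x = (G r \- G s) 0.
    by rewrite /= (Gp r).1 (Gp s).1 subrr => /eqP; rewrite subr_eq0 => /eqP.
  have D y : - r%:num < y < r%:num -> - s%:num < y < s%:num ->
      is_derive y (1 : R) (G r \- G s) 0.
    move=> yr ys; have d1 := (Gp r).2 y yr; have d2 := (Gp s).2 y ys.
    by apply: is_derive_eq; rewrite subrr.
  have [x0|x0] := leP 0 x.
    apply/esym/is_derive0_segment => // y /andP[y0 y1].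
    by apply: D; apply/andP; split; rewrite ?(le_lt_trans y1)// (lt_le_trans _ y0)// oppr_lt0.
  apply/is_derive0_segment => //; first exact: ltW.
  move=> y /andP[y0 y1].
  by apply: D; apply/andP; split; rewrite ?(le_lt_trans y1)// (lt_le_trans _ y0).
have pos (x : R) : 0 < `|x| + 1 by rewrite ltr_wpDl.
exists (fun x => G (PosNum (pos x)) x) => x.
have d : is_derive x (1 : R) (G (PosNum (pos (`|x| + 1)))) (F x).
  apply: (Gp _).2; rewrite -ltr_norml /= (ger0_norm (ltW (pos _))) -addrA ltrDl addr_gt0// ltr01.
apply: near_eq_is_derive d.
have nb : \forall y \near x, ball x 1 y by exact: nbhsx_ballx.
near=> y.
apply: uni => /=.
  have : ball x 1 y by near: y.
  rewrite -ball_normE /= distrC => xy.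
  rewrite (ger0_norm (ltW (pos x))) -[y](subrK x) (le_lt_trans (ler_normD _ _))//.
  lra.
by rewrite ltrDl.
Unshelve. all: by end_near. Qed.

(** One step of the smoothing: the average over [`[x, x + h]] of a continuous
    function has a difference quotient as derivative, hence costs a factor
    [1 / h] per derivative gained. *)
Lemma steklov_average F (h : R) : 0 < h -> continuous F ->
  exists M, has_derivative M (fun x => (F (x + h) - F x) / h) /\
    forall x, exists2 c, x <= c <= x + h & M x = F c.
Proof.
move=> h0 /antiderivative[A dA].
exists (fun x => (A (x + h) - A x) / h); split => x; last first.
  have [c xc e] := MVT_incr x dA (ltW h0); exists c => //.
  by rewrite e mulfK// gt_eqF.
have d1 := dA (x + h); have d2 := dA x.
have i1 : is_derive x (1:R) (fun x => A (x + h)) (F (x + h)).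
  have := @is_derive_comp_affine A h 1 x (F (x + h)).
  by rewrite !mul1r [h + x]addrC; under eq_fun do rewrite mul1r addrC; exact.
rewrite (_ : (fun x => _) = h^-1 \*: ((fun x => A (x + h)) \- A)); last first.
  by apply/funext => y /=; rewrite mulrC.
by apply: is_derive_eq; rewrite [RHS]mulrC.
Qed.

Definition difference_quotient (h : R) f x := (f (x + h) - f x) / h.

Lemma has_derivative_difference_quotient h f f' : has_derivative f f' ->
  has_derivative (difference_quotient h f) (difference_quotient h f').
Proof.
move=> df x; rewrite /difference_quotient.
have d1 := df (x + h); have d2 := df x.
have i1 : is_derive x (1:R) (fun x => f (x + h)) (f' (x + h)).
  have := @is_derive_comp_affine f h 1 x (f' (x + h)).
  by rewrite !mul1r [h + x]addrC; under eq_fun do rewrite mul1r addrC; exact.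
rewrite (_ : (fun x => _) = h^-1 \*: ((fun x => f (x + h)) \- f)); last first.
  by apply/funext => y /=; rewrite mulrC.
by apply: is_derive_eq; rewrite [RHS]mulrC.
Qed.

Lemma C0_continuous f : C0 setT f -> continuous f.
Proof. by move=> [cf _]; apply/continuous_subspace_setT. Qed.

Lemma C0_difference_quotient h f : 0 < h -> C0 setT f ->
  C0 setT (difference_quotient h f).
Proof.
move=> h0 cf; have cf' := C0_continuous cf; split.
  apply: continuous_subspaceT => x; apply: cvgM; last exact: cvg_cst.
  apply: cvgB; last exact: cf'.
  apply: (@continuous_comp _ _ _ (fun x => x + h) f); last exact: cf'.
  by apply: cvgD; [exact: cvg_id|exact: cvg_cst].
move=> e e0.
have [M fM] := cf.2 (e * h / 2) ltac:(by rewrite divr_gt0// mulr_gt0).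
exists (M + h) => x _ Mx.
have f1 : `|f (x + h)| < e * h / 2.
  apply: fM => //; rewrite -(ltrD2r h) (lt_le_trans Mx)//.
  rewrite -{1}[x](addrK h) (le_trans (ler_normB _ _))//.
  by rewrite (ger0_norm (ltW h0)).
have f2 : `|f x| < e * h / 2 by apply: fM => //; rewrite (lt_trans _ Mx)// ltrDl.
rewrite /difference_quotient normrM normfV (gtr0_norm h0) ltr_pdivrMr//.
by rewrite (le_lt_trans (ler_normB _ _))// [ltRHS]splitr ltrD.
Qed.

Lemma C0_average (h : R) f g : C0 setT f -> 0 < h -> continuous g ->
  (forall x, exists2 c, x <= c <= x + h & g x = f c) -> C0 setT g.
Proof.
move=> cf h0 cg gf; split; first exact: continuous_subspaceT.
move=> e /(cf.2)[M fM]; exists (M + h) => x _ Mx.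
have [c /andP[xc cx] ->] := gf x; apply: fM => //.
rewrite -(ltrD2r h) (lt_le_trans Mx)// -{1}[x](subrK c).
rewrite (le_trans (ler_normD _ _))// addrC lerD2l distrC ger0_norm ?subr_ge0//.
by rewrite lerBlDl.
Qed.

(** Four successive averages over intervals of length [h].  Four derivatives
    are needed because the second derivative of the smoothed function has itself
    to be in the domain of the diffusion generator. *)
Lemma C0_mollification F (B h e : R) : 0 < h -> C0 setT F ->
  (forall x, `|F x| <= B) ->
  (forall x y, x <= y <= x + 4 * h -> `|F y - F x| <= e) ->
  exists g : nat -> R -> R, [/\ (forall i, (i < 4)%N -> has_derivative (g i) (g i.+1)),
    (forall i, (i < 5)%N -> C0 setT (g i)),
    (forall i x, (i < 5)%N -> `|g i x| <= (2 / h) ^+ i * B) &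
    (forall x, `|g 0%N x - F x| <= e)].
Proof.
move=> h0 cF bF eF.
have step f : C0 setT f -> exists g, [/\ C0 setT g,
    has_derivative g (difference_quotient h f) &
    forall x, exists2 c, x <= c <= x + h & g x = f c].
  move=> cf; have [g [dg gf]] := steklov_average h0 (C0_continuous cf).
  exists g; split=> //; apply: (C0_average cf h0 _ gf).
  exact: has_derivative_continuous dg.
have [f1 [c1 d1 a1]] := step _ cF.
have [f2 [c2 d2 a2]] := step _ c1.
have [f3 [c3 d3 a3]] := step _ c2.
have [f4 [c4 d4 a4]] := step _ c3.
pose f i := nth f4 [:: f4; f3; f2; f1; F] i.
exists (fun i => iter i (difference_quotient h) (f i)).
have cf i : C0 setT (f i) by case: i => [|[|[|[|[|[]]]]]].
have it j g : C0 setT g -> C0 setT (iter j (difference_quotient h) g).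
  by move=> cg; elim: j => //= j ihj; exact: C0_difference_quotient.
have dit i g g' : has_derivative g g' ->
    has_derivative (iter i (difference_quotient h) g)
                   (iter i (difference_quotient h) g').
  by move=> dg; elim: i => //= i; exact: has_derivative_difference_quotient.
have bit i g : (forall x, `|g x| <= B) ->
    forall x, `|iter i (difference_quotient h) g x| <= (2 / h) ^+ i * B.
  move=> bg; elim: i => [x|i ihi x]; first by rewrite expr0 mul1r.
  rewrite iterS {1}/difference_quotient normrM normfV (gtr0_norm h0).
  rewrite exprS -mulrA mulrAC ler_pM2r ?invr_gt0//.
  by rewrite (le_trans (ler_normB _ _))//; have := ihi x; have := ihi (x + h); lra.
split=> //.
- move=> i i4; rewrite iterSr; apply: dit.
  by move: i i4 => [|[|[|[|i]]]].
- by move=> i _; exact: it.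
- move=> i x _; apply: bit => {}x.
  have b1 y : `|f1 y| <= B by have [c _ ->] := a1 y.
  have b2 y : `|f2 y| <= B by have [c _ ->] := a2 y.
  have b3 y : `|f3 y| <= B by have [c _ ->] := a3 y.
  have b4 y : `|f4 y| <= B by have [c _ ->] := a4 y.
  by case: i => [|[|[|[|[|[]]]]]].
move=> x.
have [w4 /andP[]] := a4 x; have [w3 /andP[]] := a3 w4.
have [w2 /andP[]] := a2 w3; have [w1 /andP[]] := a1 w2.
move=> ? ? e1 ? ? e2 ? ? e3 ? ? e4.
by rewrite [iter 0 _ _ _]e4 e3 e2 e1; apply: eF; apply/andP; split; lra.
Qed.

End calculus.

(** * Semigroup and generator of a Feller process *)

(** The sum is the integer part of [y]: it gives the approximation of a bounded
    function by step functions whose steps are the superlevel sets. *)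
Lemma unit_steps_count (R : realType) (N : nat) (y : R) : 0 <= y <= N%:R ->
  y - 1 <= \sum_(i < N) ((i.+1%:R <= y)%R : nat)%:R <= y.
Proof.
elim: N y => [|N ih] y /andP[y0 yN]; first by rewrite big_ord0; apply/andP; split; lra.
rewrite big_ord_recr /=; have [yN1|yN1] := leP N.+1%:R y.
  have -> : y = N.+1%:R by apply/eqP; rewrite eq_le yN.
  rewrite (eq_bigr (fun=> 1)); last first.
    by move=> i _; rewrite ler_nat ltnS (ltnW (ltn_ord i)).
  rewrite sumr_const card_ord -natr1 (_ : true%:R = 1 :> R)//.
  by apply/andP; split; lra.
rewrite addr0; have [yN2|yN2] := leP y N%:R; first by apply: ih; rewrite y0.
rewrite (eq_bigr (fun=> 1)); last first.
  by move=> i _; rewrite (le_trans _ (ltW yN2))// ler_nat.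
rewrite sumr_const card_ord; apply/andP; split; last exact: ltW.
by rewrite -natr1 in yN1; lra.
Qed.

Section bounded_measurable.
Context {R : realType} {d : measure_display} {T : measurableType d} (S : set T).
Hypothesis mS : measurable S.
Implicit Types g h : T -> R.

Definition bounded_measurable g :=
  measurable_fun S g /\ exists M, forall x, S x -> `|g x| <= M.

Lemma bounded_measurableD g h : bounded_measurable g -> bounded_measurable h ->
  bounded_measurable (g \+ h).
Proof.
move=> [mg [M gM]] [mh [N hN]]; split; first exact: measurable_funD.
exists (M + N) => x Sx; rewrite (le_trans (ler_normD _ _))// lerD ?gM ?hN//.
Qed.

Lemma bounded_measurableN g : bounded_measurable g ->
  bounded_measurable (\- g).
Proof.
move=> [mg [M gM]]; split; first exact: measurableT_comp.
by exists M => x Sx; rewrite normrN gM.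
Qed.

Lemma bounded_measurableB g h : bounded_measurable g -> bounded_measurable h ->
  bounded_measurable (g \- h).
Proof. by move=> bg bh; apply: bounded_measurableD => //; exact: bounded_measurableN. Qed.

Lemma bounded_measurable_cst c : bounded_measurable (cst c).
Proof. by split; [exact: measurable_cst|exists `|c|]. Qed.

Lemma bounded_measurableZ c g : bounded_measurable g ->
  bounded_measurable (c \*o g).
Proof.
move=> [mg [M gM]]; split; first by apply: measurable_funM => //; exact: measurable_cst.
by exists (`|c| * M) => x Sx; rewrite /= normrM ler_wpM2l// gM.
Qed.

Lemma bounded_measurable_indic B : measurable B -> bounded_measurable \1_B.
Proof.
move=> mB; split; first by apply: measurable_funTS; exact: measurable_indic.
exists 1 => x _; rewrite indicE; case: (_ \in _); rewrite ?normr1// normr0//.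
Qed.

(** Step functions on the level sets of a bounded function are uniformly close
    to it; this is what extends an identity from sets to functions. *)
Lemma bounded_measurable_approx (Pr : (T -> R) -> Prop) :
  (forall c, Pr (cst c)) ->
  (forall c B, measurable B -> Pr (c \*o \1_B)) ->
  (forall g h, bounded_measurable g -> bounded_measurable h ->
     Pr g -> Pr h -> Pr (g \+ h)) ->
  forall g e, bounded_measurable g -> 0 < e ->
     exists h, [/\ bounded_measurable h, Pr h &
       forall x, S x -> `|g x - h x| <= e].
Proof.
move=> Pc P1 PD g e bg e0.
have [mg [M gM]] := bg.
have [N MN] : exists N : nat, 2 * M / e <= N%:R.
  exists (Num.bound `|2 * M / e|).
  exact: le_trans (ler_norm _) (ltW (archi_boundP (normr_ge0 _))).
pose B (i : nat) := S `&` g @^-1` `[- M + i.+1%:R * e, +oo[.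
have mB i : measurable (B i) by exact: mg.
pose h n := fun x => - M + e * \sum_(i < n) \1_(B i) x.
have hS n : h n.+1 = h n \+ (e \*o \1_(B n)).
  by apply/funext => x; rewrite /h big_ord_recr/= mulrDr addrA.
have h0 : h 0%N = cst (- M) by apply/funext => x; rewrite /h big_ord0 mulr0 addr0.
have bh n : bounded_measurable (h n).
  elim: n => [|n ih]; first by rewrite h0; exact: bounded_measurable_cst.
  rewrite hS; apply: bounded_measurableD => //; apply: bounded_measurableZ.
  exact: bounded_measurable_indic.
exists (h N); split => //.
  elim: {MN} N => [|n ih]; first by rewrite h0.
  rewrite hS; apply: PD => //; last exact: P1.
  by apply: bounded_measurableZ; exact: bounded_measurable_indic.
move=> x Sx; rewrite /h.
have := gM x Sx; rewrite ler_norml => /andP[g1 g2].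
have /unit_steps_count/andP[s1 s2] : 0 <= (g x + M) / e <= N%:R.
  rewrite divr_ge0 ?(ltW e0)//=; last by lra.
  by rewrite (le_trans _ MN)// ler_pM2r ?invr_gt0//; lra.
rewrite (eq_bigr (fun i : 'I_N => ((i.+1%:R <= (g x + M) / e)%R : nat)%:R)); last first.
  move=> i _; rewrite indicE; congr (_ %:R); congr nat_of_bool.
  apply/idP/idP; rewrite inE /B/= in_itv/= andbT.
    by move=> [_ ?]; rewrite ler_pdivlMr//; lra.
  by rewrite ler_pdivlMr// => ?; split=> //; lra.
move: s1 s2; set s := \sum_(i < N) _ => s1 s2.
have e1 : (g x + M) / e * e = g x + M by rewrite divfK// gt_eqF.
have := ler_wpM2r (ltW e0) s1; have := ler_wpM2r (ltW e0) s2.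
rewrite mulrBl e1 => ? ?.
rewrite ler_norml; apply/andP; split; lra.
Qed.

Lemma bounded_measurableM g h : bounded_measurable g -> bounded_measurable h ->
  bounded_measurable (g \* h).
Proof.
move=> [mg [M gM]] [mh [N hN]]; split; first exact: measurable_funM.
by exists (M * N) => x Sx; rewrite normrM ler_pM ?gM ?hN.
Qed.

End bounded_measurable.

Lemma C0_bounded_measurable {R : realType} (S : set R) (mS : measurable S)
    (g : R -> R) (M : R) : C0 S g -> (forall x, S x -> `|g x| <= M) ->
  bounded_measurable S g.
Proof.
move=> [cg _] gM; split; last by exists M.
exact: subspace_continuous_measurable_fun.
Qed.

Section feller_semigroup.
Context {R : realType} {d : measure_display} {W : measurableType d}.
Variables (S : set R) (Q : R -> probability W R) (X : R -> W -> R).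
Hypothesis mS : measurable S.
Hypothesis mkX : markov_process S Q X.
Implicit Types (g h : R -> R) (a s t : R).

Let P t g := fun a => expect Q X a t g.

Lemma state_integrable t g a : 0 <= t -> bounded_measurable S g ->
  (Q a).-integrable setT (EFin \o (fun w => g (X t w))).
Proof.
move=> t0 [mg [M gM]]; have [/(_ t t0)[mX SX] _ _ _] := mkX.
apply: measurable_bounded_integrable => //.
- by rewrite (le_lt_trans (probability_le1 (Q a) measurableT))// ltry.
- apply: (measurable_comp mS _ mg mX).
  by move=> _ [w _ <-]; exact: SX.
- exists M; split; first exact: num_real.
  move=> N MN w _ /=; rewrite (le_trans (gM _ (SX w)))//; exact: ltW.
Qed.

Lemma expect_cst t a c : expect Q X a t (cst c) = c.
Proof.
by rewrite /expect Rintegral_cst//= probability_setT mulr1.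
Qed.

Lemma expect_le t g h a : 0 <= t -> bounded_measurable S g ->
  bounded_measurable S h -> (forall x, S x -> g x <= h x) ->
  expect Q X a t g <= expect Q X a t h.
Proof.
move=> t0 bg bh gh; have [/(_ t t0)[_ SX] _ _ _] := mkX.
by apply: le_Rintegral => //; [exact: state_integrable..|move=> w _; exact: gh].
Qed.

Lemma expectD t g h a : 0 <= t -> bounded_measurable S g ->
  bounded_measurable S h ->
  expect Q X a t (g \+ h) = expect Q X a t g + expect Q X a t h.
Proof. by move=> t0 bg bh; apply: RintegralD => //; exact: state_integrable. Qed.

Lemma expectB t g h a : 0 <= t -> bounded_measurable S g ->
  bounded_measurable S h ->
  expect Q X a t (g \- h) = expect Q X a t g - expect Q X a t h.
Proof. by move=> t0 bg bh; apply: RintegralB => //; exact: state_integrable. Qed.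

Lemma expectZ t c g a : 0 <= t -> bounded_measurable S g ->
  expect Q X a t (c \*o g) = c * expect Q X a t g.
Proof. by move=> t0 bg; apply: RintegralZl => //; exact: state_integrable. Qed.

Lemma expect_close t g h M a : 0 <= t -> bounded_measurable S g ->
  bounded_measurable S h -> (forall x, S x -> `|g x - h x| <= M) ->
  `|expect Q X a t g - expect Q X a t h| <= M.
Proof.
move=> t0 bg bh gh; rewrite -expectB//.
have bgh := bounded_measurableB bg bh.
have cM c := @bounded_measurable_cst _ _ _ S c.
have b1 : expect Q X a t (cst (- M)) <= expect Q X a t (g \- h).
  by apply: expect_le => // x Sx; have := gh x Sx; rewrite ler_norml => /andP[].
have b2 : expect Q X a t (g \- h) <= expect Q X a t (cst M).
  by apply: expect_le => // x Sx; have := gh x Sx; rewrite ler_norml => /andP[].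
by rewrite ler_norml; rewrite !expect_cst in b1 b2; rewrite b1.
Qed.

Lemma expect_bound t g M a : 0 <= t -> bounded_measurable S g ->
  (forall x, S x -> `|g x| <= M) -> `|expect Q X a t g| <= M.
Proof.
move=> t0 bg gM; rewrite -[expect _ _ _ _ _]subr0 -(expect_cst t a 0).
apply: expect_close => //; first exact: bounded_measurable_cst.
by move=> x Sx; rewrite subr0 gM.
Qed.

Lemma expect_indic t B a : 0 <= t -> measurable B ->
  expect Q X a t \1_B = fine (Q a (X t @^-1` B)).
Proof.
move=> t0 mB; have [/(_ t t0)[mX _] _ _ _] := mkX.
rewrite /expect /Rintegral; congr fine.
rewrite (eq_integral (fun w => (\1_(X t @^-1` B) w)%:E)) ?integral_indic ?setIT//.
by rewrite -[X in measurable X]setTI; exact: mX.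
Qed.

Lemma expect_start g a : S a -> bounded_measurable S g ->
  expect Q X a 0 g = g a.
Proof.
move=> Sa bg; have [/(_ 0 (lexx _))[mX0 _] /(_ a Sa) Qa _ _] := mkX.
rewrite -[RHS](expect_cst 0 a (g a)) /expect /Rintegral; congr fine.
have mA : measurable [set w | X 0 w = a].
  rewrite (_ : [set _ | _] = setT `&` X 0 @^-1` [set a]); first exact: mX0.
  by rewrite setTI; apply/seteqP; split.
apply: ae_eq_integral => //.
- by have /integrableP[] := state_integrable a (lexx 0) bg.
- exact: (@measurable_cst _ _ _ _ _ (g a)%:E).
- have : (Q a).-negligible (~` [set w | X 0 w = a]).
    apply/negligibleP; first exact: measurableC.
    by apply: (etrans (probability_setC (Q a) mA)); rewrite Qa subee.
  by apply: negligibleS; apply: subsetC => w /= ->.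
Qed.

Lemma bounded_measurable_transition t B : 0 <= t -> measurable B ->
  bounded_measurable S (fun a => fine (Q a (X t @^-1` B))).
Proof.
move=> t0 mB; have [/(_ t t0)[mX _] _ /(_ t B t0 mB) mQ _] := mkX; split.
  exact: measurableT_comp mQ.
have mXB : measurable (X t @^-1` B) by rewrite -[X in measurable X]setTI; exact: mX.
exists 1 => a _; rewrite ger0_norm ?fine_ge0// -lee_fin fineK ?fin_num_measure//.
exact: probability_le1.
Qed.

(** For indicators this is the Markov property at the trivial event; both sides
    are additive and contract the supremum norm, so step functions suffice. *)
Lemma expect_semigroup s t g a : S a -> 0 <= s -> 0 <= t ->
  bounded_measurable S g -> bounded_measurable S (P t g) ->
  expect Q X a (s + t) g = expect Q X a s (P t g).
Proof.
move=> Sa s0 t0 bg bPg; have st0 := addr_ge0 s0 t0.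
pose Pr h := bounded_measurable S (P t h) /\
  expect Q X a (s + t) h = expect Q X a s (P t h).
have Pc c : Pr (cst c).
  have E : P t (cst c) = cst c by apply/funext => b; exact: expect_cst.
  by rewrite /Pr E; split; [exact: bounded_measurable_cst|rewrite !expect_cst].
have P1 c B : measurable B -> Pr (c \*o \1_B).
  move=> mB; have bB := bounded_measurable_indic S mB.
  have bT := bounded_measurable_transition t0 mB.
  have E : P t (c \*o \1_B) = c \*o (fun b => fine (Q b (X t @^-1` B))).
    by apply/funext => b; rewrite /P expectZ// expect_indic.
  split; first by rewrite E; exact: bounded_measurableZ.
  rewrite E !expectZ// expect_indic//; congr (_ * _).
  have [/(_ _ s0)[mXs SX] _ _ mk] := mkX.
  have [/(_ _ t0)[mXt _] _ _ _] := mkX.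
  have := @mk a s t setT B Sa s0 t0 _ mB; rewrite setTI => ->; last first.
    exact: (@measurableT _ (g_sigma_algebraType _)).
  rewrite /expect /Rintegral; congr fine; apply: eq_integral => w _.
  rewrite fineK// fin_num_measure//.
  by rewrite -[X in measurable X]setTI; exact: mXt.
have PD h k : bounded_measurable S h -> bounded_measurable S k ->
    Pr h -> Pr k -> Pr (h \+ k).
  move=> bh bk [bh' eh] [bk' ek].
  have E : P t (h \+ k) = P t h \+ P t k.
    by apply/funext => b; rewrite /P expectD.
  split; first by rewrite E; exact: bounded_measurableD.
  by rewrite E !expectD// eh ek.
apply/eqP; rewrite -subr_eq0 -normr_le0; apply/ler_addgt0Pr => e e0; rewrite add0r.
have e2 : 0 < e / 2 by rewrite divr_gt0.
have [h [bh [bPh ePh] gh]] := bounded_measurable_approx mS Pc P1 PD bg e2.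
rewrite -(subrKA (expect Q X a (s + t) h)) [e]splitr.
rewrite (le_trans (ler_normD _ _))// lerD//; first exact: expect_close.
rewrite ePh; apply: expect_close => // b Sb; rewrite distrC.
exact: expect_close.
Qed.

End feller_semigroup.

Section uniform_at_right.
Context {R : realType} (S : set R).

Lemma uniform_cvg_at_rightP (F : R -> R -> R) (h : R -> R) :
  {uniform S, F @ 0^'+ --> h} <->
  forall e, 0 < e -> exists2 r, 0 < r &
    forall s, 0 < s < r -> forall a, S a -> `|F s a - h a| < e.
Proof.
split=> [Fh e e0|Fh A].
  have /Fh : nbhs (h : {uniform` S -> R})
      [set k | forall a, S a -> `|k a - h a| < e].
    apply/uniform_nbhs; exists [set xy | ball xy.1 e xy.2]; split.
      by rewrite -entourage_ballE; exists e.
    by move=> k /= hk a /hk; rewrite -ball_normE /= distrC.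
  move=> [r /= r0 rF]; exists r => // s /andP[s0 sr] a Sa.
  by apply: rF => //=; rewrite /= sub0r normrN gtr0_norm.
move/uniform_nbhs => [E [eE EA]].
move: eE; rewrite -entourage_ballE => -[e /= e0 eE].
have [r r0 rF] := Fh _ e0.
exists r => //= s; rewrite /= sub0r normrN => sr s0; apply: EA => a Sa.
apply: eE => /=; rewrite -ball_normE /= distrC; apply: rF => //.
by rewrite s0 -(gtr0_norm s0).
Qed.

End uniform_at_right.

Section generator_semigroup.
Context {R : realType} {d : measure_display} {W : measurableType d}.
Variables (S : set R) (Q : R -> probability W R) (X : R -> W -> R).
Hypothesis mS : measurable S.
Hypothesis mkX : markov_process S Q X.
Hypothesis felX : feller S Q X.
Implicit Types (g h : R -> R) (a s t : R).

Let P t g := fun a => expect Q X a t g.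

Lemma bounded_measurable_expect g M t : C0 S g ->
  (forall x, S x -> `|g x| <= M) -> 0 <= t -> bounded_measurable S (P t g).
Proof.
move=> cg gM t0; apply: (@C0_bounded_measurable _ _ mS _ M).
  exact: felX.1.
move=> x Sx; apply: (expect_bound mS mkX) => //.
exact: C0_bounded_measurable gM.
Qed.

Lemma C0_expect_semigroup s t g M a : S a -> 0 <= s -> 0 <= t -> C0 S g ->
  (forall x, S x -> `|g x| <= M) ->
  expect Q X a (s + t) g = expect Q X a s (P t g).
Proof.
move=> Sa s0 t0 cg gM; apply: (expect_semigroup mS mkX) => //.
  exact: C0_bounded_measurable gM.
exact: bounded_measurable_expect gM t0.
Qed.

Variables (g h : R -> R) (M N : R).
Hypothesis gh : infinitesimal_generator S Q X g h.
Hypothesis gM : forall x, S x -> `|g x| <= M.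
Hypothesis hN : forall x, S x -> `|h x| <= N.

Let cg : C0 S g. Proof. by case: gh. Qed.
Let ch : C0 S h. Proof. by case: gh. Qed.
Let bg : bounded_measurable S g. Proof. exact: C0_bounded_measurable gM. Qed.
Let bh : bounded_measurable S h. Proof. exact: C0_bounded_measurable hN. Qed.

(** The convergence defining the generator is uniform in the starting point, hence
    it survives the application of the semigroup at time [s]. *)
Lemma generator_right_derivative s e : 0 <= s -> 0 < e ->
  exists2 r, 0 < r & forall t, 0 < t < r -> forall a, S a ->
    `|(expect Q X a (s + t) g - expect Q X a s g) / t - expect Q X a s h| <= e.
Proof.
move=> s0 e0; have [_ _ /uniform_cvg_at_rightP/(_ _ e0)[r r0 rF]] := gh.
exists r => // t tr a Sa; have /andP[t0 _] := tr; have t0' := ltW t0.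
rewrite (C0_expect_semigroup Sa s0 t0' cg gM).
have bPg := bounded_measurable_expect cg gM t0'.
rewrite mulrC -(expectB mS mkX)//.
rewrite -(expectZ mS mkX t^-1 a s0); last exact: bounded_measurableB.
apply: (expect_close mS mkX) => //.
  by apply: bounded_measurableZ; exact: bounded_measurableB.
by move=> x Sx; rewrite /= [_^-1 * _]mulrC ltW// rF.
Qed.

Lemma generator_expect s : 0 <= s ->
  infinitesimal_generator S Q X (P s g) (P s h).
Proof.
move=> s0; split; [exact: felX.1|exact: felX.1|].
apply/uniform_cvg_at_rightP => e e0.
have e2 : 0 < e / 2 by rewrite divr_gt0.
have [r r0 rF] := generator_right_derivative s0 e2.
exists r => // t tr a Sa; have /andP[t0 _] := tr; have t0' := ltW t0.
rewrite -(C0_expect_semigroup Sa t0' s0 cg gM) [t + s]addrC.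
rewrite (le_lt_trans (rF _ tr a Sa))//; lra.
Qed.

(** The function [t |-> sup |P t g - g|] is subadditive, so that its slope at
    the origin controls it everywhere. *)
Lemma generator_lipschitz_start t a : S a -> 0 <= t ->
  `|expect Q X a t g - g a| <= t * N.
Proof.
move=> Sa t0; apply/ler_addgt0Pr => e e0.
have t1 : 0 < t + 1 by rewrite ltr_wpDl.
have e1 : 0 < e / (t + 1) by rewrite divr_gt0.
have [r r0 rF] := generator_right_derivative (lexx 0) e1.
have N0 : 0 <= N by rewrite (le_trans _ (hN Sa)).
have short u b : 0 <= u < r -> S b ->
    `|expect Q X b u g - g b| <= u * (N + e / (t + 1)).
  move=> /andP[]; rewrite le_eqVlt => /predU1P[<- _|u0 ur] Sb.
    by rewrite (expect_start mS mkX)// subrr normr0 mul0r.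
  have := rF u ltac:(by rewrite u0) b Sb.
  rewrite add0r !(expect_start mS mkX)// => b1.
  have hb := hN Sb.
  rewrite mulrC -ler_pdivrMr//.
  rewrite (_ : _ / u = `|(expect Q X b u g - g b) / u|); last first.
    by rewrite normrM normfV (gtr0_norm u0).
  rewrite -[X in `|X|](subrK (h b)) (le_trans (ler_normD _ _))// addrC lerD//.
have [k kr] : exists k : nat, t / k.+1%:R < r.
  exists (Num.bound (t / r)).
  rewrite ltr_pdivrMr// mulrC -ltr_pdivrMr//.
  rewrite (lt_le_trans (archi_boundP _)) ?divr_ge0 ?(ltW r0)//.
  by rewrite ler_nat.
pose u := t / k.+1%:R; have u0 : 0 <= u by rewrite divr_ge0.
have iter j b : S b -> `|expect Q X b (j%:R * u) g - g b| <= j%:R * (u * (N + e / (t + 1))).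
  elim: j b => [|j ih] b Sb.
    by rewrite !mul0r (expect_start mS mkX)// subrr normr0.
  have ju0 : 0 <= j%:R * u by rewrite mulr_ge0.
  rewrite -natr1 2!mulrDl !mul1r (C0_expect_semigroup Sb ju0 u0 cg gM).
  rewrite -(subrKA (expect Q X b (j%:R * u) g)) addrC.
  rewrite (le_trans (ler_normD _ _))// lerD// ?ih//.
  apply: (expect_close mS mkX) => //.
    exact: bounded_measurable_expect gM _.
  by move=> x Sx; apply: short => //; rewrite u0.
have ku : k.+1%:R * u = t by rewrite /u mulrC divfK// pnatr_eq0.
have := iter k.+1 a Sa; rewrite mulrA ku => /le_trans; apply.
rewrite mulrDr lerD2l mulrCA ler_piMr ?(ltW e0)//.
by rewrite ler_pdivrMr// mul1r lerDl.
Qed.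

Lemma generator_lipschitz s t a : S a -> 0 <= s -> 0 <= t ->
  `|expect Q X a t g - expect Q X a s g| <= `|t - s| * N.
Proof.
move=> Sa; wlog st : s t / s <= t => [hw s0 t0|s0 t0].
  have [/hw|/ltW/hw] := leP s t; first exact.
  by rewrite distrC [X in X * _]distrC; exact.
have ts : 0 <= t - s by rewrite subr_ge0.
rewrite -{1}[t](subrKC s) (C0_expect_semigroup Sa s0 ts cg gM) (ger0_norm ts).
apply: (expect_close mS mkX) => //.
  exact: bounded_measurable_expect gM _.
by move=> x Sx; exact: generator_lipschitz_start.
Qed.

End generator_semigroup.

(** * A maximum principle in discrete space and continuous time *)

Section maximum_principle.
Context {R : realType}.
Implicit Types s r t e T C : R.

(** The supremum of the initial segments on which [Pr] holds has the property, by
    the last hypothesis, and would not be maximal below [T]. *)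
Lemma real_induction (T : R) (Pr : R -> Prop) : 0 <= T -> Pr 0 ->
  (forall s, 0 <= s < T -> (forall r, 0 <= r <= s -> Pr r) ->
     exists2 e, 0 < e & forall r, s < r < s + e -> Pr r) ->
  (forall s, 0 < s <= T -> (forall r, 0 <= r < s -> Pr r) -> Pr s) ->
  forall s, 0 <= s <= T -> Pr s.
Proof.
move=> T0 P0 Pright Pleft.
pose A := [set s : R | 0 <= s <= T /\ forall r, 0 <= r <= s -> Pr r].
have A0 : A 0.
  split; first by rewrite lexx.
  by move=> r r0; have -> : r = 0 by apply/eqP; rewrite eq_le andbC.
have hA : has_sup A by split; [exists 0|exists T => s [/andP[]]].
have s0 : 0 <= sup A by exact: (sup_ubound hA.2 A0).
have sT : sup A <= T by apply: ge_sup; [exists 0|move=> s [/andP[]]].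
have Plt r : 0 <= r < sup A -> Pr r.
  move=> /andP[r0 rs]; have [s [_ As] rs'] := sup_gt hA.1 rs.
  by apply: As; rewrite r0 ltW.
have Ple r : 0 <= r <= sup A -> Pr r.
  move=> /andP[r0]; rewrite le_eqVlt => /predU1P[->|rs]; last by apply: Plt; rewrite r0.
  move: s0; rewrite le_eqVlt => /predU1P[<-//|s0]; apply: Pleft => //.
  by rewrite s0.
have [/eqP sE|sneT] := boolP (sup A == T); first by rewrite -sE.
have sltT : sup A < T by rewrite lt_neqAle sneT.
have [e e0 Pe] := Pright (sup A) ltac:(by rewrite s0) Ple.
pose u := Num.min (sup A + e / 2) T.
have us : sup A < u by rewrite lt_min sltT andbT ltrDl divr_gt0.
have ue : u <= sup A + e / 2 by rewrite ge_min lexx.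
have Au : A u.
  split; first by rewrite (le_trans s0 (ltW us))/= ge_min lexx orbT.
  move=> r /andP[r0 ru]; have [rs|sr] := leP r (sup A); first by apply: Ple; rewrite r0.
  by apply: Pe; rewrite sr/=; lra.
by have := sup_ubound hA.2 Au; rewrite leNgt us.
Qed.

Lemma box_uniform (Pr : int -> R -> Prop) (N : nat) :
  (forall k, (`|k| <= N)%N -> exists2 e, 0 < e & forall t, 0 < t < e -> Pr k t) ->
  exists2 e, 0 < e & forall k, (`|k| <= N)%N -> forall t, 0 < t < e -> Pr k t.
Proof.
elim: N => [|N ih] h.
  have [e e0 he] := h 0 isT; exists e => // k k0 t te.
  have -> : k = 0 by lia.
  exact: he.
have [|e1 e10 h1] := ih; first by move=> k kN; apply: h; lia.
have [e2 e20 h2] := h N.+1%:Z ltac:(by lia).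
have [e3 e30 h3] := h (- N.+1%:Z) ltac:(by lia).
exists (Num.min e1 (Num.min e2 e3)); first by rewrite !lt_min e10 e20.
move=> k kN t /andP[t0]; rewrite !lt_min => /and3P[t1 t2 t3].
have [kN'|kN'] := leqP `|k| N; first by apply: h1; rewrite ?t0.
have [->|->] : k = N.+1%:Z \/ k = - N.+1%:Z by lia.
  by apply: h2; rewrite t0.
by apply: h3; rewrite t0.
Qed.

Definition second_difference (f : int -> R) (k : int) :=
  f (k + 1) - 2 * f k + f (k - 1).

(** At a first contact of [z] with a strictly increasing barrier the second
    difference is nonpositive, so [z] has to grow slower than the barrier.
    Semigroups come with derivatives from the right in time only, hence the
    contact time is reached by induction on the real line. *)
Lemma parabolic_maximum_principle (T C : R) (N : nat) (lam : int -> R)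
    (z : R -> int -> R) : 0 <= T ->
  (forall k, 0 <= lam k) ->
  (forall k, (`|k| <= N)%N -> z 0 k <= 0) ->
  (forall s k, 0 <= s <= T -> `|k|%N = N -> z s k <= 0) ->
  (forall s r k, 0 <= s -> 0 <= r -> (`|k| <= N)%N ->
     `|z s k - z r k| <= `|s - r| * C) ->
  (forall s k e, 0 <= s < T -> (`|k| < N)%N -> 0 < e ->
     exists2 r, 0 < r & forall t, 0 < t < r ->
       (z (s + t) k - z s k) / t <=
       lam k * second_difference (z s) k + e) ->
  forall s k, 0 <= s <= T -> (`|k| <= N)%N -> z s k <= 0.
Proof.
move=> T0 lam0 z0 zout zlip zder.
have C0 k : (`|k| <= N)%N -> 0 <= C.
  move=> kN; have := zlip 1 0 k ler01 (lexx _) kN.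
  by rewrite subr0 normr1 mul1r => /(le_trans _); apply.
suff H e : 0 < e -> forall s, 0 <= s <= T ->
    forall k, (`|k| <= N)%N -> z s k <= e * (1 + s).
  move=> s k sT kN; apply/ler_addgt0Pr => e e0; rewrite add0r.
  have /andP[s0 _] := sT; have s1 : 0 < 1 + s by rewrite ltr_wpDr.
  have := H (e / (1 + s)) ltac:(by rewrite divr_gt0) s sT k kN.
  by rewrite divfK// gt_eqF.
move=> e0; apply: (@real_induction T) => //.
- by move=> k kN; rewrite addr0 mulr1 (le_trans (z0 _ kN))// ltW.
- move=> s /andP[s0 sT] ih.
  have ihs := ih s ltac:(by rewrite s0 lexx).
  have [|d d0 hd] := @box_uniform
      (fun k t => s + t <= T -> z (s + t) k <= e * (1 + (s + t))) N.
    move=> k kN; have [kN'|kN'] := eqVneq `|k|%N N.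
      exists 1 => // t /andP[t0 _] stT.
      have st0 : 0 <= s + t by rewrite addr_ge0// ltW.
      by rewrite (le_trans (zout _ _ _ kN')) ?st0// mulr_ge0 ?addr_ge0// ltW.
    have kltN : (`|k| < N)%N by rewrite ltn_neqAle kN'.
    have := ihs k kN; rewrite le_eqVlt => /predU1P[zE|zlt].
      have lap0 : second_difference (z s) k <= 0.
        have := ihs (k + 1) ltac:(by lia); have := ihs (k - 1) ltac:(by lia).
        by rewrite /second_difference -zE; lra.
      have [r r0 hr] := zder s k e ltac:(by rewrite s0) kltN e0.
      exists r => // t tr _; have /andP[t0 _] := tr.
      have := hr t tr; rewrite ler_pdivrMr// => h1.
      have l0 : lam k * second_difference (z s) k <= 0 by rewrite mulr_ge0_le0.
      have : (lam k * second_difference (z s) k + e) * t <= e * t.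
        by rewrite ler_wpM2r ?(ltW t0)//; lra.
      rewrite addrA (mulrDr e (1 + s)) -zE; lra.
    have Cp : 0 < C + 1 by rewrite ltr_wpDl// (C0 k).
    exists ((e * (1 + s) - z s k) / (C + 1)).
      by rewrite divr_gt0// subr_gt0.
    move=> t /andP[t0]; rewrite ltr_pdivlMr// => tC _.
    have := zlip (s + t) s k ltac:(by rewrite addr_ge0// ltW) s0 kN.
    rewrite (_ : s + t - s = t) ?(gtr0_norm t0); last by ring.
    move=> /(le_trans (ler_norm _)) => h1.
    have et : 0 < e * t by rewrite mulr_gt0.
    rewrite addrA (mulrDr e (1 + s)); lra.
  exists (Num.min d (T - s)); first by rewrite lt_min d0 subr_gt0.
  move=> r /andP[sr]; rewrite -ltrBlDl lt_min => /andP[rd rT] k kN.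
  have := hd k kN (r - s) ltac:(by rewrite subr_gt0 sr).
  rewrite subrKC; apply; lra.
- move=> s /andP[s0 sT] ih k kN; have Ck := C0 k kN.
  rewrite leNgt; apply/negP => zs.
  have Cp : 0 < C + 1 by rewrite ltr_wpDl.
  pose x := z s k - e * (1 + s).
  have x0 : 0 < x by rewrite subr_gt0.
  pose t := Num.min (s / 2) (x / (C + 1) / 2).
  have t0 : 0 < t by rewrite lt_min !divr_gt0.
  have ts : t <= s / 2 by rewrite ge_min lexx.
  have tx : t <= x / (C + 1) / 2 by rewrite ge_min lexx orbT.
  have := ih (s - t) ltac:(by apply/andP; split; lra) k kN.
  have := zlip s (s - t) k (ltW s0) ltac:(by lra) kN.
  rewrite (_ : s - (s - t) = t) ?(gtr0_norm t0); last by ring.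
  move=> /(le_trans (ler_norm _)) => h1 h2.
  have : t * (C + 1) < x.
    by rewrite -ltr_pdivlMr// (le_lt_trans tx)// ltr_pdivrMr// ltr_pMr ?divr_gt0// ltr1n.
  have : 0 < e * t by rewrite mulr_gt0.
  rewrite /x; move: h2; rewrite !(mulrDr e) mulrN; lra.
Qed.

End maximum_principle.

(** * The Kolmogorov equations of the chain and of the diffusion *)

Section right_derivative.
Context {R : realType}.
Implicit Types (F G : R -> R) (s d c : R).

Definition right_derivative F s d := forall e, 0 < e ->
  exists2 r, 0 < r & forall t, 0 < t < r -> `|(F (s + t) - F s) / t - d| <= e.

Lemma right_derivativeD F G s d c : right_derivative F s d ->
  right_derivative G s c -> right_derivative (F \+ G) s (d + c).
Proof.
move=> dF dG e e0; have e2 : 0 < e / 2 by rewrite divr_gt0.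
have [r1 r10 h1] := dF _ e2; have [r2 r20 h2] := dG _ e2.
exists (Num.min r1 r2); first by rewrite lt_min r10.
move=> t /andP[t0]; rewrite lt_min => /andP[t1 t2].
rewrite /= (_ : _ / t - _ = ((F (s + t) - F s) / t - d) +
  ((G (s + t) - G s) / t - c)); last by ring.
by rewrite (le_trans (ler_normD _ _))// [e]splitr lerD ?h1 ?h2// t0.
Qed.

Lemma right_derivativeZ F s d c : right_derivative F s d ->
  right_derivative (c \*o F) s (c * d).
Proof.
move=> dF e e0; have c1 : 0 < `|c| + 1 by rewrite ltr_wpDl.
have [r r0 h] := dF (e / (`|c| + 1)) ltac:(by rewrite divr_gt0).
exists r => // t tr; rewrite /= (_ : _ / t - _ = c * ((F (s + t) - F s) / t - d)); last by ring.
rewrite normrM (le_trans (ler_wpM2l _ (h t tr)))//.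
by rewrite mulrCA ler_piMr ?(ltW e0)// ler_pdivrMr// mul1r lerDl.
Qed.

Lemma right_derivative_affine a b s : right_derivative (fun s => a + b * s) s b.
Proof.
move=> e e0; exists 1 => // t /andP[t0 _].
rewrite (_ : _ / t - b = 0) ?normr0 ?ltW//.
by rewrite (_ : a + b * (s + t) - (a + b * s) = b * t) ?mulfK ?subrr ?gt_eqF//; ring.
Qed.

End right_derivative.

Section stability.
Context {R : realType}.

(** The chain is compared with an approximate solution [w] of its Kolmogorov
    equation on a bounded box.  The barrier [psi], on which the generator is
    bounded by 2, prices the lack of information on the boundary of the box, at
    the cost [psi / L ^+ 2] of a Chebyshev bound for the exit probability. *)
Lemma kolmogorov_stability (T C a B L rho : R) (N : nat) (lam : int -> R)
    (psi : int -> R) (U w dw : R -> int -> R) :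
  0 <= T -> 0 < L -> 0 <= a -> 0 <= B -> 0 <= rho ->
  (forall k, 0 <= lam k) ->
  (forall k, (`|k| <= N)%N -> 0 <= psi k) ->
  (forall k, (`|k| < N)%N -> lam k * second_difference psi k <= 2) ->
  (forall k, `|k|%N = N -> L ^+ 2 <= psi k) ->
  (forall s r k, 0 <= s -> 0 <= r -> (`|k| <= N)%N ->
     `|U s k - U r k| <= `|s - r| * C) ->
  (forall s r k, 0 <= s -> 0 <= r -> (`|k| <= N)%N ->
     `|w s k - w r k| <= `|s - r| * C) ->
  (forall s k, 0 <= s -> (`|k| < N)%N ->
     right_derivative (U ^~ k) s (lam k * second_difference (U s) k)) ->
  (forall s k, 0 <= s -> (`|k| < N)%N -> right_derivative (w ^~ k) s (dw s k)) ->
  (forall s k, 0 <= s -> (`|k| < N)%N ->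
     `|dw s k - lam k * second_difference (w s) k| <= rho) ->
  (forall k, (`|k| <= N)%N -> `|U 0 k - w 0 k| <= a + B * psi k / L ^+ 2) ->
  (forall s k, 0 <= s -> `|k|%N = N -> `|U s k - w s k| <= B) ->
  forall s k, 0 <= s <= T -> (`|k| <= N)%N ->
    `|U s k - w s k| <= a + rho * s + B * (psi k + 2 * s) / L ^+ 2.
Proof.
move=> T0 L0 a0 B0 rho0 lam0 psi0 lpsi psiN lipU lipw dU dW cons init bdry.
have L2 : 0 < L ^+ 2 by rewrite exprn_gt0.
suff H sg : `|sg| = 1 -> forall s k, 0 <= s <= T -> (`|k| <= N)%N ->
    sg * (U s k - w s k) - (a + rho * s + B * (psi k + 2 * s) / L ^+ 2) <= 0.
  move=> s k sT kN; rewrite ler_norml; apply/andP; split.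
    by have := H (-1) (normrN1 _) s k sT kN; rewrite mulN1r; lra.
  by have := H 1 (normr1 _) s k sT kN; rewrite mul1r; lra.
move=> sg1.
have sgle x : sg * x <= `|x| by rewrite (le_trans (ler_norm _))// normrM sg1 mul1r.
apply: (@parabolic_maximum_principle _ _ (2 * C + rho + B * 2 / L ^+ 2) _ lam) => //.
- move=> k kN; rewrite subr_le0 (le_trans (sgle _))// (le_trans (init k kN))//.
  by rewrite !mulr0 !addr0.
- move=> s k /andP[s0 sT] kN; rewrite subr_le0 (le_trans (sgle _))//.
  rewrite (le_trans (bdry s k s0 kN))// -[leLHS]add0r lerD ?addr_ge0 ?mulr_ge0//.
  rewrite -mulrA ler_peMr// ler_pdivlMr// mul1r (le_trans (psiN k kN))//.
  by rewrite lerDl mulr_ge0.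
- move=> s r k s0 r0 kN.
  rewrite (_ : _ - _ = sg * (U s k - U r k) - sg * (w s k - w r k) -
    (s - r) * (rho + B * 2 / L ^+ 2)); last by ring.
  rewrite (le_trans (ler_normB _ _))// (_ : 2 * C + rho + B * 2 / L ^+ 2 =
    C + C + (rho + B * 2 / L ^+ 2)); last by ring.
  rewrite [leRHS]mulrDr lerD//.
    rewrite (le_trans (ler_normB _ _))// !normrM sg1 !mul1r.
    by rewrite mulrDr lerD ?lipU ?lipw.
  rewrite normrM [X in _ * X]ger0_norm// addr_ge0//.
  by rewrite divr_ge0 ?mulr_ge0// ltW.
- move=> s k e /andP[s0 sT] kN e0.
  have D : right_derivative (fun s => sg * (U s k - w s k) -
      (a + rho * s + B * (psi k + 2 * s) / L ^+ 2)) s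
      (sg * (lam k * second_difference (U s) k - dw s k) -
       (rho + B * 2 / L ^+ 2)).
    have d1 := right_derivativeZ sg (right_derivativeD (dU s k s0 kN)
      (right_derivativeZ (-1) (dW s k s0 kN))).
    have d2 := @right_derivative_affine _ (- (a + B * psi k / L ^+ 2))
      (- (rho + B * 2 / L ^+ 2)) s.
    have := right_derivativeD d1 d2; rewrite mulN1r.
    rewrite (_ : _ \+ _ = fun s => sg * (U s k - w s k) -
      (a + rho * s + B * (psi k + 2 * s) / L ^+ 2))//.
    by apply/funext => x /=; ring.
  have [r r0 h] := D e e0; exists r => // t tr.
  have := le_trans (ler_norm _) (h t tr); rewrite lerBlDl => /le_trans; apply.
  rewrite lerD2r.
  have := sgle (lam k * second_difference (w s) k - dw s k).
  rewrite distrC => /le_trans/(_ (cons s k s0 kN)) c1.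
  have c2 := ler_wpM2l (divr_ge0 B0 (ltW L2)) (lpsi k kN).
  rewrite [X in _ <= _ * X](_ : _ = sg * (second_difference (U s) k - second_difference (w s) k) -
    B / L ^+ 2 * second_difference psi k); last first.
    by rewrite /second_difference; ring.
  move: c1 c2; rewrite mulrBr => c1 c2.
  rewrite (_ : _ * (_ - B / _ * _) = sg * (lam k * second_difference (U s) k) -
    sg * (lam k * second_difference (w s) k) -
    B / L ^+ 2 * (lam k * second_difference psi k)); last by ring.
  by lra.
Qed.

End stability.

Section grid.
Context {R : realType}.
Variable n : nat.
Hypothesis n0 : (0 < n)%N.

Let nR : 0 < n%:R :> R. Proof. by rewrite ltr0n. Qed.

Lemma measurable_grid : measurable (grid n : set R).
Proof.
apply: countable_measurable; [exact: measurable_set1|exact: sub_countable (card_image_le _ _) (countableP _)].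
Qed.

Lemma grid_mem (k : int) : grid n (k%:~R / n%:R : R).
Proof. by exists k. Qed.

Lemma floor_grid (k : int) : Num.floor (n%:R * (k%:~R / n%:R) : R) = k.
Proof. by rewrite mulrC divfK ?gt_eqF// intrKfloor. Qed.

Lemma grid_isolated (x y : R) : grid n x -> grid n y -> `|x - y| < n%:R^-1 -> y = x.
Proof.
move=> [k _ <-] [j _ <-]; rewrite -mulrBl -intrB normrM normfV (gtr0_norm nR).
rewrite -[ltRHS]mul1r ltr_pM2r ?invr_gt0//.
by rewrite -intr_norm ltrz1 => kj; congr (_ / _); congr (_ %:~R); lia.
Qed.

Lemma within_grid_continuous (g : R -> R) : {within grid n, continuous g}.
Proof.
apply/subspace_continuousP => x Gx.
apply: cvg_near_cst.
exists n%:R^-1 => /=; first by rewrite invr_gt0.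
by move=> y /= xy Gy; rewrite (grid_isolated Gx Gy).
Qed.

Definition grid_generator (v : int -> R) (g : R -> R) (x : R) : R :=
  let k := Num.floor (n%:R * x) in
  n%:R ^+ 2 / v k * second_difference (fun j => g (j%:~R / n%:R)) k.

Variable v : int -> R.
Hypothesis v1 : forall k, 1 <= v k.

Lemma grid_rate_bounds k : 0 <= n%:R ^+ 2 / v k <= n%:R ^+ 2.
Proof.
have v0 : 0 < v k by rewrite (lt_le_trans ltr01).
by rewrite divr_ge0 ?sqr_ge0 ?(ltW v0)//= ler_piMr ?sqr_ge0// invf_le1.
Qed.

Lemma grid_generator_small g e k :
  (forall j, (`|j - k| <= 1)%N -> `|g (j%:~R / n%:R)| <= e) ->
  `|grid_generator v g (k%:~R / n%:R)| <= 4 * n%:R ^+ 2 * e.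
Proof.
move=> ge; rewrite /grid_generator floor_grid normrM.
have /andP[l0 l1] := grid_rate_bounds k.
rewrite (ger0_norm l0) [leRHS]mulrAC mulrC ler_pM//.
have := ge (k + 1) ltac:(by lia); have := ge k ltac:(by lia).
have := ge (k - 1) ltac:(by lia); rewrite /second_difference !ler_norml.
move=> /andP[? ?] /andP[? ?] /andP[? ?]; apply/andP; split; lra.
Qed.

Lemma C0_grid_generator g : C0 (grid n) g -> C0 (grid n) (grid_generator v g).
Proof.
move=> [_ g0]; split; first exact: within_grid_continuous.
move=> e e0; have n2 : 0 < 4 * n%:R ^+ 2 :> R by rewrite mulr_gt0// exprn_gt0.
have e1 : 0 < e / 2 / (4 * n%:R ^+ 2) by rewrite !divr_gt0.
have [M gM] := g0 _ e1; exists (M + n%:R^-1) => _ [k _ <-] kM.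
rewrite (@le_lt_trans _ _ (4 * n%:R ^+ 2 * (e / 2 / (4 * n%:R ^+ 2))))//.
  apply: grid_generator_small => j jk; rewrite ltW// gM//; first exact: grid_mem.
  rewrite -(ltrD2r n%:R^-1) (lt_le_trans kM)//.
  rewrite -[_ / _](subrK (j%:~R / n%:R)) addrC (le_trans (ler_normD _ _))// lerD2l.
  rewrite -mulrBl -intrB normrM normfV (gtr0_norm nR) ler_piMl ?invr_ge0//.
  by rewrite -intr_norm lerz1; lia.
by rewrite mulrC divfK ?gt_eqF// ltr_pdivrMr// ltr_pMr// ltr1n.
Qed.

(** All of [C_0] is in the domain of the generator of the chain: its rates are at
    most [n ^+ 2], because traps are at least 1. *)
Lemma btm_operator_grid_generator g : C0 (grid n) g ->
  btm_operator n v g (grid_generator v g).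
Proof.
move=> cg; split; [exact: cg|exact: C0_grid_generator|].
move=> k; rewrite /grid_generator floor_grid /second_difference.
by congr (_ * _); ring.
Qed.

Section chain.
Context {d : measure_display} {W : measurableType d}.
Variables (Q : R -> probability W R) (X : R -> W -> R).
Hypothesis btm : btm_process n v Q X.
Variables (g : R -> R) (M : R).
Hypothesis cg : C0 (grid n) g.
Hypothesis gM : forall x, grid n x -> `|g x| <= M.

Let mk : markov_process (grid n) Q X. Proof. by case: btm. Qed.
Let fel : feller (grid n) Q X. Proof. by case: btm. Qed.
Let gen : infinitesimal_generator (grid n) Q X g (grid_generator v g).
Proof.
by case: btm => _ _ _ H; apply/H; exact: btm_operator_grid_generator.
Qed.
Let genM x : grid n x -> `|grid_generator v g x| <= 4 * n%:R ^+ 2 * M.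
Proof.
by move=> [k _ <-]; apply: grid_generator_small => j _; apply: gM; exact: grid_mem.
Qed.

Let U (s : R) (k : int) := expect Q X (k%:~R / n%:R) s g.

Lemma chain_start k : U 0 k = g (k%:~R / n%:R).
Proof.
apply: (expect_start measurable_grid mk); first exact: grid_mem.
exact: (C0_bounded_measurable measurable_grid cg gM).
Qed.

Lemma chain_lipschitz s r k : 0 <= s -> 0 <= r ->
  `|U s k - U r k| <= `|s - r| * (4 * n%:R ^+ 2 * M).
Proof.
move=> s0 r0.
exact: (generator_lipschitz measurable_grid mk fel gen gM genM (grid_mem k) r0 s0).
Qed.

Lemma chain_kolmogorov s k : 0 <= s ->
  right_derivative (U ^~ k) s (n%:R ^+ 2 / v k * second_difference (U s) k).
Proof.
move=> s0 e e0.
have [r r0 h] := generator_right_derivative measurable_grid mk fel gen gM genM s0 e0.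
exists r => // t tr; have := h t tr _ (grid_mem k).
have := generator_expect measurable_grid mk fel gen gM genM s0.
case: btm => _ _ _ H /H[_ _ /(_ k) ->].
congr (`|_ - _ * _| <= _).
by rewrite /U /second_difference; ring.
Qed.

End chain.

End grid.

Section diffusion.
Context {R : realType} {d : measure_display} {W : measurableType d}.
Variables (m : R) (Q : R -> probability W R) (X : R -> W -> R).
Hypothesis m0 : 0 < m.
Hypothesis dif : diffusion_process m Q X.

Let mk : markov_process setT Q X. Proof. by case: dif. Qed.
Let fel : feller setT Q X. Proof. by case: dif. Qed.

Lemma has_derivative_derive1 (f f' : R -> R) : has_derivative f f' ->
  derive1 f = f'.
Proof. by move=> df; apply/funext => x; rewrite derive1E; case: (df x). Qed.

Section smooth.
Variables (g g1 g2 : R -> R) (M M2 : R).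
Hypothesis dg : has_derivative g g1.
Hypothesis dg1 : has_derivative g1 g2.
Hypothesis cg : C0 setT g.
Hypothesis cg2 : C0 setT g2.
Hypothesis gM : forall x, `|g x| <= M.
Hypothesis gM2 : forall x, `|g2 x| <= M2.

Lemma C0_scale c f : C0 setT f -> C0 setT (c \*o f : R -> R).
Proof.
move=> cf; split.
  apply: continuous_subspaceT => x; apply: cvgM; first exact: cvg_cst.
  exact: C0_continuous cf x.
move=> e e0; have c1 : 0 < `|c| + 1 by rewrite ltr_wpDl.
have [A fA] := cf.2 (e / (`|c| + 1)) ltac:(by rewrite divr_gt0).
exists A => x _ Ax; have := fA x I Ax; rewrite ltr_pdivlMr// => fx.
rewrite /= normrM (le_lt_trans _ fx)// mulrC ler_wpM2l// lerDl//.
Qed.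

Lemma diffusion_generator :
  infinitesimal_generator setT Q X g (m^-1 \*o g2).
Proof.
case: dif => _ _ _ H; apply/H; split=> //; first exact: C0_scale.
  move=> x; rewrite (has_derivative_derive1 dg).
  by split; [case: (dg x)|case: (dg1 x)].
by move=> x; rewrite (has_derivative_derive1 dg) (has_derivative_derive1 dg1).
Qed.

Let TM x : setT x -> `|g x| <= M. Proof. by move=> _; exact: gM. Qed.
Let TM2 x : setT x -> `|(m^-1 \*o g2) x| <= m^-1 * M2.
Proof. by move=> _; rewrite /= normrM (gtr0_norm (_ : 0 < m^-1)) ?ler_wpM2l ?invr_gt0 ?invr_ge0// ltW. Qed.

Let b2 : bounded_measurable setT g2.
Proof. by apply: (C0_bounded_measurable measurableT cg2) => x _; exact: gM2. Qed.

(** The domain of the generator is preserved by the semigroup and consists of C^2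
    functions: this is where the smoothness of the solution comes from. *)
Lemma diffusion_expect_derivatives s : 0 <= s -> exists u1,
  has_derivative (fun x => expect Q X x s g) u1 /\
  has_derivative u1 (fun x => expect Q X x s g2).
Proof.
move=> s0.
have := generator_expect measurableT mk fel diffusion_generator TM TM2 s0.
case: dif => _ _ _ H /H[_ _ D E].
exists (derive1 (fun x => expect Q X x s g)); split => x.
  by apply: DeriveDef; [exact: (D x).1|rewrite derive1E].
apply: DeriveDef; first exact: (D x).2.
rewrite -derive1E; have := E x; rewrite (expectZ measurableT mk _ _ s0 b2).
by move/(mulfI _) => ->//; rewrite invr_neq0// gt_eqF.
Qed.

Lemma diffusion_lipschitz s r x : 0 <= s -> 0 <= r ->
  `|expect Q X x s g - expect Q X x r g| <= `|s - r| * (m^-1 * M2).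
Proof.
move=> s0 r0.
exact: (generator_lipschitz measurableT mk fel diffusion_generator TM TM2 I r0 s0).
Qed.

Lemma diffusion_kolmogorov s x : 0 <= s ->
  right_derivative (fun s => expect Q X x s g) s (m^-1 * expect Q X x s g2).
Proof.
move=> s0 e e0; rewrite -(expectZ measurableT mk _ _ s0 b2).
have [r r0 h] := generator_right_derivative measurableT mk fel diffusion_generator TM TM2 s0 e0.
by exists r => // t tr; exact: h.
Qed.

Lemma diffusion_bound s x : 0 <= s -> `|expect Q X x s g| <= M.
Proof.
move=> s0; apply: (expect_bound measurableT mk) => //.
exact: C0_bounded_measurable TM.
Qed.

Lemma diffusion_start x : expect Q X x 0 g = g x.
Proof.
apply: (expect_start measurableT mk) => //.
exact: C0_bounded_measurable TM.
Qed.

End smooth.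
End diffusion.

(** * Corrector and barrier in a fixed landscape *)

Section corrector.
Context {R : realType}.
Implicit Types (v : int -> R) (m : R).

Definition half_line_sum v m (i : nat) : R :=
  (v 0 - m) / 2 + \sum_(1 <= j < i.+1) (v j%:Z - m).

Definition half_line_potential v m (k : nat) : R :=
  \sum_(i < k) half_line_sum v m i.

(** A solution of [second_difference Phi = v - m].  The value of [v] at the
    origin is shared evenly between the two half-lines, which makes the
    quadratic lower bound [potential_lower] hold without a linear correction. *)
Definition potential v m (k : int) : R :=
  match k with
  | Posz i => half_line_potential v m i
  | Negz i => half_line_potential (v \o -%R) m i.+1
  end.

Lemma potential_nonneg v m (k : nat) : potential v m k%:Z = half_line_potential v m k.
Proof. by []. Qed.

Lemma potential_nonpos v m (k : nat) :
  potential v m (- k%:Z) = half_line_potential (v \o -%R) m k.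
Proof. by case: k => //=; rewrite /half_line_potential !big_ord0. Qed.

Lemma half_line_potentialS v m k :
  half_line_potential v m k.+1 = half_line_potential v m k + half_line_sum v m k.
Proof. by rewrite /half_line_potential big_ord_recr. Qed.

Lemma half_line_sumS v m i :
  half_line_sum v m i.+1 = half_line_sum v m i + (v i.+1%:Z - m).
Proof. by rewrite /half_line_sum [in LHS]big_nat_recr//= addrA. Qed.

Lemma second_difference_potential v m k :
  second_difference (potential v m) k = v k - m.
Proof.
rewrite /second_difference; case: k => [[|k]|k].
- rewrite add0r sub0r (potential_nonneg v m 1) (potential_nonneg v m 0).
  rewrite (potential_nonpos v m 1) !half_line_potentialS /half_line_potential.
  rewrite !big_ord0 /half_line_sum !big_geq//= oppr0; lra.
- rewrite (_ : k.+1%:Z + 1 = k.+2%:Z); last by lia.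
  rewrite (_ : k.+1%:Z - 1 = k%:Z); last by lia.
  rewrite !potential_nonneg !half_line_potentialS half_line_sumS; lra.
- rewrite NegzE (_ : - k.+1%:Z + 1 = - k%:Z); last by lia.
  rewrite (_ : - k.+1%:Z - 1 = - k.+2%:Z); last by lia.
  rewrite !potential_nonpos !half_line_potentialS half_line_sumS /=; lra.
Qed.

Section bounds.
Variables (v : int -> R) (m A : R) (N : nat).
Hypothesis vA : forall i, (i <= N)%N -> `|half_line_sum v m i| <= A.
Hypothesis vA' : forall i, (i <= N)%N -> `|half_line_sum (v \o -%R) m i| <= A.

Lemma potential_gradient k : (`|k| <= N)%N ->
  `|potential v m (k + 1) - potential v m k| <= A.
Proof.
case: k => [k|k] kN.
  rewrite (_ : k%:Z + 1 = k.+1%:Z); last by lia.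
  by rewrite !potential_nonneg half_line_potentialS addrC addKr vA.
rewrite NegzE (_ : - k.+1%:Z + 1 = - k%:Z); last by lia.
rewrite !potential_nonpos half_line_potentialS opprD addNKr normrN.
by apply: vA'; lia.
Qed.

Lemma potential_bound k : (`|k| <= N)%N -> `|potential v m k| <= N%:R * A.
Proof.
have H u : (forall i, (i <= N)%N -> `|half_line_sum u m i| <= A) ->
    forall j, (j <= N)%N -> `|half_line_potential u m j| <= N%:R * A.
  move=> uA j jN; have A0 : 0 <= A by rewrite (le_trans _ (uA 0%N isT)).
  rewrite (le_trans (ler_norm_sum _ _ _))// (@le_trans _ _ (\sum_(i < j) A))//.
    by apply: ler_sum => i _; apply: uA; rewrite (leq_trans (ltnW (ltn_ord i))).
  by rewrite sumr_const card_ord -[_ *+ _]mulr_natl ler_wpM2r// ler_nat.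
by case: k => k kN; apply: H => //; exact: vA'.
Qed.

End bounds.

(** The right-hand side has second difference [2 v], which is at least the second
    difference 2 of [k ^+ 2]; on each half-line the first differences are also
    ordered, by the choice of the value at the origin. *)
Lemma potential_lower v m k : (forall j, 1 <= v j) ->
  k%:~R ^+ 2 <= m * k%:~R ^+ 2 + 2 * potential v m k.
Proof.
have S u (i : nat) : (forall j, 1 <= u j) ->
    2 * i%:R + 1 <= m * (2 * i%:R + 1) + 2 * half_line_sum u m i.
  move=> u1; elim: i => [|i ih].
    by rewrite /half_line_sum big_geq//; have := u1 0; lra.
  rewrite half_line_sumS -natr1; have := u1 i.+1%:Z; lra.
have H u (i : nat) : (forall j, 1 <= u j) ->
    i%:R ^+ 2 <= m * i%:R ^+ 2 + 2 * half_line_potential u m i.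
  move=> u1; elim: i => [|i ih].
    by rewrite /half_line_potential big_ord0 expr0n/= !mulr0 addr0.
  rewrite half_line_potentialS -natr1; have := S u i u1.
  rewrite (_ : (i%:R + 1) ^+ 2 = i%:R ^+ 2 + (2 * i%:R + 1) :> R); last by ring.
  lra.
move=> v1; case: k => k; first exact: H.
rewrite NegzE mulrNz sqrrN potential_nonpos.
by have := H (v \o -%R) k.+1 (fun j => v1 (- j)).
Qed.

End corrector.

Section comparison.
Context {R : realType}.
Variables (n N : nat) (v : int -> R) (m L om : R) (Phi : int -> R).
Hypothesis n0 : (0 < n)%N.
Hypothesis v1 : forall k, 1 <= v k.
Hypothesis m1 : 1 <= m.
Hypothesis L0 : 0 < L.
Hypothesis LN : L * n%:R <= N%:R.
Hypothesis om0 : 0 <= om.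
Hypothesis lapPhi : forall k, second_difference Phi k = v k - m.
Hypothesis gradPhi : forall k, (`|k| <= N)%N -> `|Phi (k + 1) - Phi k| <= om * n%:R.
Hypothesis boundPhi : forall k, (`|k| <= N)%N -> `|Phi k| <= om * n%:R ^+ 2.
Hypothesis lowerPhi : forall k, k%:~R ^+ 2 <= m * k%:~R ^+ 2 + 2 * Phi k.

Let nR : 0 < n%:R :> R. Proof. by rewrite ltr0n. Qed.
Let n2 : 0 < n%:R ^+ 2 :> R. Proof. by rewrite exprn_gt0. Qed.
Let m0 : 0 < m. Proof. exact: lt_le_trans ltr01 m1. Qed.

(** The analogue, in the landscape [v], of the function [m x ^+ 2], whose image by
    the generator of the diffusion is 2. *)
Definition barrier (k : int) : R := (m * k%:~R ^+ 2 + 2 * Phi k) / n%:R ^+ 2.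

Lemma barrier_lower k : (k%:~R / n%:R) ^+ 2 <= barrier k.
Proof. by rewrite exprMn exprVn /barrier ler_pM2r ?invr_gt0. Qed.

Lemma barrier_ge0 k : 0 <= barrier k.
Proof. by rewrite (le_trans (sqr_ge0 _) (barrier_lower k)). Qed.

Lemma barrier_boundary k : `|k|%N = N -> L ^+ 2 <= barrier k.
Proof.
move=> kN; rewrite (le_trans _ (barrier_lower k))//.
rewrite -(real_normK (num_real (_ / _))) normrM normfV (gtr0_norm nR) -intr_norm.
rewrite -abszE kN ler_sqr ?nnegrE ?(ltW L0) ?divr_ge0//.
by rewrite ler_pdivlMr.
Qed.

Lemma barrier_generator k :
  n%:R ^+ 2 / v k * second_difference barrier k = 2.
Proof.
have vk : 0 < v k by rewrite (lt_le_trans ltr01).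
rewrite (_ : second_difference barrier k =
    (2 * m + 2 * second_difference Phi k) / n%:R ^+ 2); last first.
  rewrite /second_difference /barrier !intrD mulrNz; ring.
rewrite lapPhi; field.
by rewrite !gt_eqF.
Qed.

Lemma grid_shift (k : int) :
  ((k + 1)%:~R / n%:R = k%:~R / n%:R + n%:R^-1 :> R) *
  ((k - 1)%:~R / n%:R = k%:~R / n%:R - n%:R^-1 :> R).
Proof. by rewrite !intrD mulrNz mulrDl mulrBl mul1r. Qed.

(** [q Phi / (n ^+ 2 m)] is a corrector: its leading contribution to the second
    difference replaces the rate [1 / v k] by the homogenized rate [1 / m],
    because [second_difference Phi = v - m]. *)
Lemma corrector_consistency (u u1 q q1 r : R -> R) M3 M4 k :
  has_derivative u u1 -> has_derivative u1 q -> has_derivative q q1 ->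
  has_derivative q1 r -> (forall x, `|q1 x| <= M3) -> (forall x, `|r x| <= M4) ->
  (`|k| < N)%N ->
  `|m^-1 * q (k%:~R / n%:R) - n%:R ^+ 2 / v k * second_difference
     (fun j => u (j%:~R / n%:R) + (m * n%:R ^+ 2)^-1 * (q (j%:~R / n%:R) * Phi j)) k|
  <= 2 * M3 * (n%:R^-1 + om) + 2 * M4 * om.
Proof.
move=> du du1 dq dq1 bM3 bM4 kN.
have vk : 0 < v k by rewrite (lt_le_trans ltr01).
pose x : R := k%:~R / n%:R; pose h : R := n%:R^-1.
have h0 : 0 <= h by rewrite invr_ge0.
have hn : h * n%:R = 1 by rewrite mulVf// gt_eqF.
have M30 : 0 <= M3 by rewrite (le_trans _ (bM3 0)).
have M40 : 0 <= M4 by rewrite (le_trans _ (bM4 0)).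
have bu : `|u (x + h) - 2 * u x + u (x - h) - q x * h ^+ 2| <= 2 * (M3 * h) * h ^+ 2.
  apply: (second_difference_close du du1 h0) => y yx.
  by rewrite (le_trans (MVT_lipschitz _ _ dq bM3))// ler_wpM2l.
have bq : `|q (x + h) - 2 * q x + q (x - h)| <= 2 * M4 * h ^+ 2.
  have := @second_difference_close _ q q1 r x h 0 M4 dq dq1 h0.
  by rewrite mul0r subr0; apply => y _; rewrite subr0.
have bq1 : `|q (x + h) - q x| <= M3 * h.
  by rewrite (le_trans (MVT_lipschitz _ _ dq bM3))// addrC addKr (ger0_norm h0).
have bq2 : `|q x - q (x - h)| <= M3 * h.
  by rewrite (le_trans (MVT_lipschitz _ _ dq bM3))// opprB subrKC (ger0_norm h0).
have bP1 := gradPhi (ltnW kN).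
have bP2 : `|Phi k - Phi (k - 1)| <= om * n%:R.
  have k1 : (`|k - 1| <= N)%N by clear -kN; lia.
  have k2 : k - 1 + 1 = k by clear; lia.
  by have := gradPhi k1; rewrite k2.
have bP := boundPhi (ltnW kN).
pose r1 := u (x + h) - 2 * u x + u (x - h) - q x * h ^+ 2.
pose r2 := (q (x + h) - q x) * (Phi (k + 1) - Phi k) +
  (q x - q (x - h)) * (Phi k - Phi (k - 1)) +
  (q (x + h) - 2 * q x + q (x - h)) * Phi k.
rewrite (_ : _ - _ = - (n%:R ^+ 2 / v k * r1) - (v k * m)^-1 * r2); last first.
  have Pk : Phi (k + 1) = v k - m + 2 * Phi k - Phi (k - 1).
    by have := lapPhi k; rewrite /second_difference; lra.
  rewrite /second_difference !grid_shift -/x -/h /r1 /r2 Pk.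
  rewrite (_ : n%:R = h^-1); last by rewrite invrK.
  have h1 : h != 0 by rewrite invr_eq0 gt_eqF.
  field.
  by rewrite h1 !gt_eqF.
have b2 : `|r2| <= 2 * M3 * om + 2 * M4 * om.
  rewrite (_ : 2 * M3 * om + _ = M3 * h * (om * n%:R) + M3 * h * (om * n%:R) +
     2 * M4 * h ^+ 2 * (om * n%:R ^+ 2)); last first.
    rewrite (_ : M3 * h * _ = M3 * om * (h * n%:R)); last by ring.
    rewrite (_ : 2 * M4 * h ^+ 2 * _ = 2 * M4 * om * (h * n%:R) ^+ 2); last by ring.
    by rewrite hn; ring.
  rewrite (le_trans (ler_normD _ _))// lerD//; last by rewrite normrM ler_pM.
  by rewrite (le_trans (ler_normD _ _))// lerD// normrM ler_pM.
have b1 : `|n%:R ^+ 2 / v k * r1| <= 2 * M3 * h.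
  have /andP[l0 l1] := grid_rate_bounds n v1 k.
  rewrite normrM (ger0_norm l0) (@le_trans _ _ (n%:R ^+ 2 * (2 * (M3 * h) * h ^+ 2)))//.
    by rewrite ler_pM.
  rewrite (_ : _ * _ = 2 * M3 * h * (h * n%:R) ^+ 2); last by ring.
  by rewrite hn expr1n mulr1.
have b3 : `|(v k * m)^-1 * r2| <= 2 * M3 * om + 2 * M4 * om.
  rewrite normrM gtr0_norm ?invr_gt0 ?mulr_gt0// (le_trans _ b2)//.
  by rewrite ler_piMl// invf_le1 ?mulr_gt0// mulr_ege1.
rewrite (le_trans (ler_normB _ _))// normrN (le_trans (lerD b1 b3))//.
by rewrite mulrDr addrA.
Qed.

Section processes.
Context {dX : measure_display} {WX : measurableType dX}.
Variables (QX : R -> probability WX R) (X : R -> WX -> R).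
Hypothesis btm : btm_process n v QX X.

(** The constant 1 solves the Kolmogorov equation, and [chi] differs from it by at
    most [x ^+ 2 / L ^+ 2], which the barrier dominates. *)
Lemma chain_tail (chi : R -> R) s k : C0 setT chi ->
  (forall x, 0 <= chi x <= 1) -> (forall x, 1 - chi x <= x ^+ 2 / L ^+ 2) ->
  0 <= s -> (`|k| <= N)%N ->
  1 - expect QX X (k%:~R / n%:R) s chi <= (barrier k + 2 * s) / L ^+ 2.
Proof.
move=> cchi chi01 chiL s0 kN.
have L2 : 0 < L ^+ 2 by rewrite exprn_gt0.
have cg : C0 (grid n) chi.
  split; first exact: within_grid_continuous.
  by move=> e /(cchi.2)[A hA]; exists A => x _; exact: hA.
have gM x : grid n x -> `|chi x| <= 1.
  by move=> _; have /andP[c0 c1] := chi01 x; rewrite ger0_norm.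
have mk : markov_process (grid n) QX X by case: btm.
have bchi : bounded_measurable (grid n) chi.
  exact: (C0_bounded_measurable (@measurable_grid R n) cg gM).
pose U s j := expect QX X (j%:~R / n%:R) s chi.
have U01 r j : 0 <= r -> 0 <= U r j <= 1.
  move=> r0; have E c := @expect_cst R dX WX QX X r (j%:~R / n%:R) c.
  apply/andP; split.
    rewrite -[leLHS](E 0); apply: (expect_le (@measurable_grid R n) mk) => //; first exact: bounded_measurable_cst.
    by move=> x _; have /andP[] := chi01 x.
  rewrite -[leRHS](E 1); apply: (expect_le (@measurable_grid R n) mk) => //; first exact: bounded_measurable_cst.
  by move=> x _; have /andP[] := chi01 x.
have nn : 0 <= n%:R ^+ 2 :> R by rewrite sqr_ge0.
have := @kolmogorov_stability R s (4 * n%:R ^+ 2 * 1) 0 1 L 0 N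
  (fun k => n%:R ^+ 2 / v k) barrier U (fun _ _ => 1) (fun _ _ => 0)
  s0 L0 (lexx _) ler01 (lexx _).
move=> H.
suff : `|U s k - 1| <= 0 + 0 * s + 1 * (barrier k + 2 * s) / L ^+ 2.
  by rewrite mul0r !add0r mul1r distrC => /(le_trans (ler_norm _)).
apply: H => //.
- by move=> j; have /andP[] := grid_rate_bounds n v1 j.
- by move=> j _; exact: barrier_ge0.
- by move=> j _; rewrite barrier_generator.
- exact: barrier_boundary.
- by move=> a b j a0 b0 _; exact: (chain_lipschitz n0 v1 btm cg gM).
- by move=> a b j _ _ _; rewrite subrr normr0 !mulr_ge0.
- by move=> a j a0 _; exact: (chain_kolmogorov n0 v1 btm cg gM).
- move=> a j _ _ e e0; exists 1 => // t _.
  by rewrite subrr mul0r subrr normr0 ltW.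
- move=> a j _ _; rewrite /second_difference (_ : 1 - 2 * 1 + 1 = 0); last by lra.
  by rewrite mulr0 subrr normr0.
- move=> j _; rewrite /U (chain_start btm cg gM).
  have /andP[c0 c1] := chi01 (j%:~R / n%:R).
  rewrite distrC ger0_norm ?subr_ge0// add0r mul1r (le_trans (chiL _))//.
  by rewrite ler_pM2r ?invr_gt0// barrier_lower.
- move=> a j a0 _; have /andP[c0 c1] := U01 a j a0.
  by rewrite ler_norml; apply/andP; split; lra.
- by rewrite s0 lexx.
Qed.

Context {dY : measure_display} {WY : measurableType dY}.
Variables (QY : R -> probability WY R) (Y : R -> WY -> R).
Hypothesis dif : diffusion_process m QY Y.

(** Stability of the chain around the corrected diffusion solution.  The three
    terms are the corrector itself, the consistency error accumulated up to time
    [s], and the exit from the box. *)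
Lemma smooth_comparison (g : nat -> R -> R) (M0 M : R) s k :
  (forall i, (i < 4)%N -> has_derivative (g i) (g i.+1)) ->
  (forall i, (i < 5)%N -> C0 setT (g i)) ->
  (forall x, `|g 0%N x| <= M0) -> (forall x, `|g 2%N x| <= M) ->
  (forall x, `|g 4%N x| <= M) -> 0 <= s -> (`|k| <= N)%N ->
  `|expect QX X (k%:~R / n%:R) s (g 0%N) - expect QY Y (k%:~R / n%:R) s (g 0%N)|
  <= 2 * (M * om) + 9 * M * (n%:R^-1 + om) * s +
     (2 * M0 + M * om) * (barrier k + 2 * s) / L ^+ 2.
Proof.
move=> dg cg b0 b2 b4 s0 kN.
have L2 : 0 < L ^+ 2 by rewrite exprn_gt0.
have M00 : 0 <= M0 by rewrite (le_trans _ (b0 0)).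
have M_0 : 0 <= M by rewrite (le_trans _ (b2 0)).
have dg0 := dg 0%N isT; have dg1 := dg 1%N isT.
have dg2 := dg 2%N isT; have dg3 := dg 3%N isT.
have c0 := cg 0%N isT; have c2 := cg 2%N isT; have c4 := cg 4%N isT.
have cgr : C0 (grid n) (g 0%N).
  split; first exact: within_grid_continuous.
  by move=> e /(c0.2)[A hA]; exists A => x _; exact: hA.
have bgr x : grid n x -> `|g 0%N x| <= M0 by [].
have mi : 0 < m^-1 by rewrite invr_gt0.
have mi1 : m^-1 <= 1 by rewrite invf_le1.
pose U s j := expect QX X (j%:~R / n%:R) s (g 0%N).
pose u i s x := expect QY Y x s (g i).
pose c : R := (m * n%:R ^+ 2)^-1.
have c_0 : 0 <= c by rewrite invr_ge0 mulr_ge0 ?(ltW m0) ?(ltW n2).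
have cPhi j : (`|j| <= N)%N -> `|c * Phi j| <= om.
  move=> jN; rewrite normrM (ger0_norm c_0) mulrC ler_pdivrMr ?mulr_gt0//.
  rewrite (le_trans (boundPhi jN))// ler_wpM2l// ler_peMl// ltW//.
pose w s j := u 0%N s (j%:~R / n%:R) + c * (u 2%N s (j%:~R / n%:R) * Phi j).
pose dw s j := m^-1 * u 2%N s (j%:~R / n%:R) +
  c * (m^-1 * u 4%N s (j%:~R / n%:R) * Phi j).
have ub0 t x : 0 <= t -> `|u 0%N t x| <= M0 by exact: (diffusion_bound dif c0 b0).
have ub2 t x : 0 <= t -> `|u 2%N t x| <= M by exact: (diffusion_bound dif c2 b2).
have ub4 t x : 0 <= t -> `|u 4%N t x| <= M by exact: (diffusion_bound dif c4 b4).
have corr t j : 0 <= t -> (`|j| <= N)%N ->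
    `|c * (u 2%N t (j%:~R / n%:R) * Phi j)| <= M * om.
  by move=> t0 jN; rewrite mulrCA normrM ler_pM ?ub2 ?cPhi.
have wu : `|w s k - u 0%N s (k%:~R / n%:R)| <= M * om.
  by rewrite /w addrC addKr corr.
suff H : `|U s k - w s k| <= M * om + 9 * M * (n%:R^-1 + om) * s +
     (2 * M0 + M * om) * (barrier k + 2 * s) / L ^+ 2.
  rewrite -/(U s k) -/(u 0%N s _) -[U s k](subrK (w s k)) -addrA.
  rewrite (le_trans (ler_normD _ _))//; move: H wu; lra.
have ni0 : 0 <= n%:R^-1 :> R by rewrite invr_ge0.
apply: (@kolmogorov_stability R s (4 * n%:R ^+ 2 * M0 + (m^-1 * M + m^-1 * M * om))
  _ _ _ _ N (fun k => n%:R ^+ 2 / v k) barrier U w dw) => //.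
- by rewrite mulr_ge0.
- by rewrite addr_ge0 ?mulr_ge0.
- by rewrite !mulr_ge0 ?addr_ge0.
- by move=> j; have /andP[] := grid_rate_bounds n v1 j.
- by move=> j _; exact: barrier_ge0.
- by move=> j _; rewrite barrier_generator.
- exact: barrier_boundary.
- move=> a b j a0 b0' jN.
  rewrite (le_trans (chain_lipschitz n0 v1 btm cgr bgr j a0 b0'))// ler_wpM2l//.
  by rewrite lerDl addr_ge0 ?mulr_ge0// ltW.
- move=> a b j a0 b0' jN.
  rewrite (@le_trans _ _ (`|a - b| * (m^-1 * M + m^-1 * M * om)))//; last first.
    by rewrite ler_wpM2l// lerDr !mulr_ge0// ltW.
  rewrite (_ : w a j - w b j = (u 0%N a (j%:~R / n%:R) - u 0%N b (j%:~R / n%:R)) +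
    (u 2%N a (j%:~R / n%:R) - u 2%N b (j%:~R / n%:R)) * (c * Phi j)); last first.
    by rewrite /w; ring.
  rewrite (le_trans (ler_normD _ _))// mulrDr lerD//.
    exact: (diffusion_lipschitz m0 dif dg0 dg1 c0 c2 b0 b2).
  rewrite normrM mulrA ler_pM ?cPhi//.
  exact: (diffusion_lipschitz m0 dif dg2 dg3 c2 c4 b2 b4).
- by move=> a j a0 _; exact: (chain_kolmogorov n0 v1 btm cgr bgr).
- move=> a j a0 _.
  have d1 := diffusion_kolmogorov m0 dif dg0 dg1 c0 c2 b0 b2 (j%:~R / n%:R) a0.
  have d2 := diffusion_kolmogorov m0 dif dg2 dg3 c2 c4 b2 b4 (j%:~R / n%:R) a0.
  have := right_derivativeD d1 (right_derivativeZ (c * Phi j) d2).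
  rewrite (_ : _ \+ _ = w^~ j); last first.
    by apply/funext => x; rewrite /w /u /=; ring.
  rewrite (_ : _ + _ = dw a j)//; rewrite /dw /u; ring.
- move=> a j a0 jN.
  have [u1 [e1 e2]] := diffusion_expect_derivatives m0 dif dg0 dg1 c0 c2 b0 b2 a0.
  have [u3 [e3 e4]] := diffusion_expect_derivatives m0 dif dg2 dg3 c2 c4 b2 b4 a0.
  have b3 x : `|u3 x| <= 3 * M.
    have := landau_kolmogorov x e3 e4 (fun z => ub2 a z a0) (fun z => ub4 a z a0).
    by move=> /le_trans; apply; lra.
  have H := corrector_consistency e1 e2 e3 e4 b3 (fun z => ub4 a z a0) jN.
  rewrite (_ : dw a j - _ = (m^-1 * u 2%N a (j%:~R / n%:R) - n%:R ^+ 2 / v j *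
    second_difference (w a) j) + m^-1 * u 4%N a (j%:~R / n%:R) * (c * Phi j)); last first.
    by rewrite /dw; ring.
  rewrite (le_trans (ler_normD _ _))// (le_trans (lerD H (_ : _ <= M * om)))//.
    rewrite normrM ler_pM ?cPhi 1?ltnW// normrM (gtr0_norm mi).
    by rewrite -[leRHS]mul1r ler_pM ?ub4// ltW.
  have := mulr_ge0 M_0 om0; have := mulr_ge0 M_0 ni0; lra.
- move=> j jN; rewrite /U (chain_start btm cgr bgr) /w.
  rewrite /u (diffusion_start dif c0 b0) opprD addrA subrr sub0r normrN.
  rewrite (le_trans (corr 0 j (lexx _) jN))// lerDl.
  rewrite divr_ge0 ?(ltW L2)// mulr_ge0 ?barrier_ge0// addr_ge0//; exact: mulr_ge0.
- move=> a j a0 jN; have jN' : (`|j| <= N)%N by rewrite jN.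
  rewrite /w opprD addrA (le_trans (ler_normB _ _))// lerD ?corr//.
  rewrite (le_trans (ler_normB _ _))// mulr_natl mulr2n lerD ?ub0//.
  have mk : markov_process (grid n) QX X by case: btm.
  apply: (expect_bound (@measurable_grid R n) mk) => //.
  exact: (C0_bounded_measurable (@measurable_grid R n) cgr bgr).
- by rewrite s0 lexx.
Qed.

End processes.

End comparison.

(** * The rate of convergence in a fixed landscape *)

Section cutoff.
Context {R : realType}.
Variable L : R.
Hypothesis L0 : 0 < L.
Implicit Types x : R.

(** A rational cutoff: it is not compactly supported, but it is in [C_0] and its
    second derivative is a polynomial in it without constant term, hence at most
    [14 / L ^+ 2] times the cutoff itself, and again in [C_0]. *)
Definition cutoff x : R := (1 + (x / L) ^+ 2)^-1.

Definition cutoff1 x : R := - (2 * (x / L) / L) * cutoff x ^+ 2.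

Definition cutoff2 x : R := (6 * cutoff x ^+ 2 - 8 * cutoff x ^+ 3) / L ^+ 2.

Let den x : 0 < 1 + (x / L) ^+ 2.
Proof. by rewrite ltr_pwDl// sqr_ge0. Qed.

Lemma cutoff_gt0 x : 0 < cutoff x.
Proof. by rewrite invr_gt0. Qed.

Lemma cutoff_le1 x : cutoff x <= 1.
Proof. by rewrite invf_le1// lerDl sqr_ge0. Qed.

Lemma cutoff_ge0 x : 0 <= cutoff x <= 1.
Proof. by rewrite cutoff_le1 ltW// cutoff_gt0. Qed.

Let cE x : (1 + (x / L) ^+ 2) * cutoff x = 1.
Proof. by rewrite mulfV// gt_eqF. Qed.

Lemma one_sub_cutoff x : 1 - cutoff x <= x ^+ 2 / L ^+ 2.
Proof.
rewrite -{1}(cE x) -expr_div_n.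
have := cutoff_le1 x; have := sqr_ge0 (x / L) => ? ?.
rewrite mulrDl mul1r addrAC subrr add0r ler_piMr//.
Qed.

Lemma has_derivative_cutoff : has_derivative cutoff cutoff1.
Proof.
move=> x.
have d1 : is_derive x (1 : R) (fun x => 1 + (x / L) ^+ 2) (2 * (x / L) / L).
  rewrite (_ : (fun _ => _) = (fun x : R => 1 + (L ^- 2) * x ^+ 2)); last first.
    by apply/funext => y; rewrite expr_div_n mulrC.
  apply: is_derive_eq; rewrite /GRing.scale/= -!exprVn; ring.
have := @is_deriveV R _ x _ _ (lt0r_neq0 (den x)) d1.
rewrite (_ : cutoff1 x = - (1 + (x / L) ^+ 2) ^- 2 *: (2 * (x / L) / L))//.
by rewrite /cutoff1 /cutoff -!exprVn /GRing.scale/=; ring.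
Qed.

Lemma has_derivative_cutoff1 : has_derivative cutoff1 cutoff2.
Proof.
move=> x; have dc := has_derivative_cutoff x.
rewrite (_ : cutoff1 = (fun x => - (2 / L ^+ 2 * x) * cutoff x ^+ 2)); last first.
  by apply/funext => y; rewrite /cutoff1 -!exprVn; ring.
apply: is_derive_eq; rewrite /GRing.scale/= /cutoff1 /cutoff2 -!exprVn.
have e : (x / L) ^+ 2 * cutoff x - 1 + cutoff x = 0.
  by rewrite -[X in _ - X](cE x); ring.
apply/eqP; rewrite -subr_eq0; apply/eqP.
by rewrite -[RHS](mulr0 (8 * L^-1 ^+ 2 * cutoff x ^+ 2)) -[in RHS]e; ring.
Qed.

Lemma cutoff1_bound x : `|cutoff1 x| <= L^-1.
Proof.
have c0 := cutoff_gt0 x; have c1 := cutoff_le1 x.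
rewrite /cutoff1 normrM normrN normrM [X in _ * X]gtr0_norm ?exprn_gt0//.
rewrite [X in _ * X * _]gtr0_norm ?invr_gt0// -mulrA mulrCA ler_piMr ?invr_ge0 ?(ltW L0)//.
rewrite (@le_trans _ _ ((1 + (x / L) ^+ 2) * cutoff x))//; last by rewrite cE.
rewrite ler_pM ?exprn_ge0 ?(ltW c0)//; last by rewrite expr2 ler_piMr// ltW.
rewrite -[X in _ <= 1 + X](real_normK (num_real _)) normrM (gtr0_norm (ltr0n _ 2))//.
by have := sqr_ge0 (1 - `|x / L|); rewrite sqrrB expr1n mul1r; lra.
Qed.

Lemma cutoff2_bound x : `|cutoff2 x| <= 14 / L ^+ 2 * cutoff x.
Proof.
have c0 := cutoff_gt0 x; have c1 := cutoff_le1 x.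
rewrite /cutoff2 normrM [X in _ * X]gtr0_norm ?invr_gt0 ?exprn_gt0//.
rewrite [leRHS]mulrAC ler_pM2r ?invr_gt0 ?exprn_gt0//.
rewrite (_ : _ - _ = cutoff x * (6 * cutoff x - 8 * cutoff x ^+ 2)); last by ring.
rewrite normrM (gtr0_norm c0) mulrC ler_wpM2r ?(ltW c0)//.
have : 0 <= cutoff x ^+ 2 <= 1 by rewrite exprn_ge0 ?exprn_ile1// ltW.
by move=> /andP[? ?]; rewrite ler_norml; apply/andP; split; lra.
Qed.

Lemma C0_cutoff : C0 setT cutoff.
Proof.
split; first by apply: continuous_subspaceT; exact: has_derivative_continuous has_derivative_cutoff.
move=> e e0; exists (L * (1 + e^-1)) => x _ Lx.
have e1 : 0 < e^-1 by rewrite invr_gt0.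
rewrite gtr0_norm ?cutoff_gt0// -[e]invrK ltf_pV2 ?posrE ?invr_gt0//.
have y1 : 1 + e^-1 < `|x / L|.
  by rewrite normrM normfV (gtr0_norm L0) ltr_pdivlMr// mulrC.
rewrite -(real_normK (num_real (x / L))).
have : (1 + e^-1) ^+ 2 < `|x / L| ^+ 2 by rewrite ltr_sqr ?nnegrE// ltW// addr_gt0.
by rewrite sqrrD expr1n mul1r; have := sqr_ge0 (e^-1); lra.
Qed.

Lemma C0_dominated (f g : R -> R) c : 0 <= c -> continuous f ->
  (forall x, `|f x| <= c * `|g x|) -> C0 setT g -> C0 setT f.
Proof.
move=> c0 cf fg [_ gv]; split; first exact: continuous_subspaceT.
move=> e e0; have c1 : 0 < c + 1 by rewrite ltr_wpDl.
have [A gA] := gv (e / (c + 1)) ltac:(by rewrite divr_gt0).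
exists A => x _ Ax; have := gA x I Ax; rewrite ltr_pdivlMr// => gx.
by rewrite (le_lt_trans (fg x))// (le_lt_trans _ gx)// mulrC ler_wpM2l// lerDl.
Qed.

Lemma continuous_cutoff : continuous cutoff.
Proof. exact: has_derivative_continuous has_derivative_cutoff. Qed.

Lemma C0_cutoff2 : C0 setT cutoff2.
Proof.
apply: (@C0_dominated _ cutoff (14 / L ^+ 2)); last exact: C0_cutoff.
- by rewrite divr_ge0 ?exprn_ge0// ltW.
- move=> x; rewrite /cutoff2; apply: cvgM; last exact: cvg_cst.
  have cc : cutoff y @[y --> x] --> cutoff x by exact: continuous_cutoff.
  have cX k : cutoff y ^+ k @[y --> x] --> cutoff x ^+ k.
    elim: k => [|k ih]; first exact: cvg_cst.
    rewrite exprS (_ : (fun y => _) = (fun y => cutoff y * cutoff y ^+ k)).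
      exact: cvgM.
    by apply/funext => y; rewrite exprS.
  by apply: cvgB; apply: cvgM; [exact: cvg_cst|exact: cX|exact: cvg_cst|exact: cX].
- by move=> x; rewrite (gtr0_norm (cutoff_gt0 x)) cutoff2_bound.
Qed.

(** The second derivative of the cutoff is of order [L ^- 2]: hence
    so is the probability that the diffusion is outside [`[- L, L]] at time [t]. *)
Lemma diffusion_tail (m : R) (d : measure_display) (W : measurableType d)
    (Q : R -> probability W R) (X : R -> W -> R) (t x : R) :
  1 <= m -> diffusion_process m Q X -> 0 <= t ->
  1 - expect Q X x t cutoff <= (x ^+ 2 + 14 * t) / L ^+ 2.
Proof.
move=> m1 dif t0; have m0 := lt_le_trans ltr01 m1.
have b0 y : `|cutoff y| <= 1 by rewrite (gtr0_norm (cutoff_gt0 y)) cutoff_le1.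
have L2 : 0 <= 14 / L ^+ 2 by rewrite divr_ge0 ?exprn_ge0// ltW.
have b2 y : `|cutoff2 y| <= 14 / L ^+ 2.
  by rewrite (le_trans (cutoff2_bound y))// ler_piMr// cutoff_le1.
have := diffusion_lipschitz m0 dif has_derivative_cutoff has_derivative_cutoff1
  C0_cutoff C0_cutoff2 b0 b2 x t0 (lexx 0).
rewrite (diffusion_start dif C0_cutoff b0) subr0 (ger0_norm t0) ler_norml => /andP[+ _].
have := one_sub_cutoff x; rewrite mulrDl.
have : t * (m^-1 * (14 / L ^+ 2)) <= 14 * t / L ^+ 2.
  rewrite (_ : 14 * t / L ^+ 2 = t * (14 / L ^+ 2)); last by ring.
  by rewrite ler_wpM2l// ler_piMl// invf_le1.
lra.
Qed.

End cutoff.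

Section holder.
Context {R : realType}.
Variables (kappa B : R) (f : R -> R).
Hypothesis k0 : 0 < kappa.
Hypothesis k1 : kappa <= 1.
Hypothesis bf : forall x, `|f x| <= B.
Hypothesis hf : forall x y, `|f x - f y| <= B * `|x - y| `^ kappa.

Lemma holder_continuous : continuous f.
Proof.
have B0 : 0 <= B by rewrite (le_trans _ (bf 0)).
move=> x; apply/cvgrPdist_le => e e0.
have B1 : 0 < B + 1 by rewrite ltr_wpDl.
pose r := (e / (B + 1)) `^ kappa^-1.
have r0 : 0 < r by rewrite powR_gt0// divr_gt0.
exists r => //= y /ltW xy; rewrite (le_trans (hf _ _))//.
have : `|x - y| `^ kappa <= r `^ kappa by rewrite ge0_ler_powR// ?nnegrE ltW.
rewrite /r -powRrM mulVf ?gt_eqF// powRr1 ?divr_ge0 ?(ltW e0) ?(ltW B1)// => h.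
rewrite (le_trans (ler_wpM2l B0 h))// mulrCA ler_piMr ?(ltW e0)//.
by rewrite ler_pdivrMr// mul1r lerDl.
Qed.

Lemma holder_cutoff (L x y : R) : 1 <= L -> `|x - y| <= 1 ->
  `|f x * cutoff L x - f y * cutoff L y| <= 2 * B * `|x - y| `^ kappa.
Proof.
move=> L1 xy; have L0 := lt_le_trans ltr01 L1.
have B0 : 0 <= B by rewrite (le_trans _ (bf 0)).
have p0 : 0 <= `|x - y| `^ kappa by exact: powR_ge0.
rewrite (_ : _ - _ = (f x - f y) * cutoff L x + f y * (cutoff L x - cutoff L y)); last by ring.
rewrite (le_trans (ler_normD _ _))// (_ : 2 * B * _ =
  B * `|x - y| `^ kappa * 1 + B * `|x - y| `^ kappa); last by ring.
rewrite lerD// normrM ler_pM//.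
  by rewrite (gtr0_norm (cutoff_gt0 L x)) cutoff_le1.
rewrite (le_trans (MVT_lipschitz _ _ (has_derivative_cutoff L) (cutoff1_bound L0)))//.
rewrite (@le_trans _ _ `|x - y|)//.
  by rewrite ler_piMl// invf_le1.
have [->|xy0] := eqVneq `|x - y| 0; first exact: powR_ge0.
by rewrite -{1}[`|x - y|]powRr1// ger_powR// lt0r xy0 normr_ge0.
Qed.

End holder.

Section truncation.
Context {R : realType} {d : measure_display} {W : measurableType d}.
Variables (S : set R) (Q : R -> probability W R) (X : R -> W -> R).
Hypothesis mS : measurable S.
Hypothesis mk : markov_process S Q X.

Lemma expect_truncation (f c : R -> R) (B t a : R) : 0 <= t ->
  bounded_measurable S f -> bounded_measurable S c ->
  bounded_measurable S (f \* c) -> (forall x, `|f x| <= B) ->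
  (forall x, 0 <= c x <= 1) ->
  `|expect Q X a t f - expect Q X a t (f \* c)| <= B * (1 - expect Q X a t c).
Proof.
move=> t0 bf bc bfc fB c01.
have b1 := @bounded_measurable_cst R _ _ S 1.
have b1c := bounded_measurableB b1 bc.
have bB := bounded_measurableZ B b1c.
have bNB := bounded_measurableN bB.
have bd := bounded_measurableB bf bfc.
have E : expect Q X a t (B \*o (cst 1 \- c)) = B * (1 - expect Q X a t c).
  by rewrite (expectZ mS mk)// (expectB mS mk)// expect_cst.
have EN : expect Q X a t (\- (B \*o (cst 1 \- c))) = - (B * (1 - expect Q X a t c)).
  rewrite -E -[RHS]mulN1r -(expectZ mS mk)//.
  by congr (expect _ _ _ _ _); apply/funext => x /=; rewrite mulN1r.
rewrite -(expectB mS mk)// ler_norml -EN -E.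
have H x : `|f x - f x * c x| <= B * (1 - c x).
  have /andP[c0 c1] := c01 x.
  rewrite -[X in X - _]mulr1 -mulrBr normrM (@ger0_norm _ (1 - c x)) ?subr_ge0//.
  by rewrite ler_wpM2r// subr_ge0.
apply/andP; split; apply: (expect_le mS mk) => // x _ /=.
  by have := H x; rewrite ler_norml => /andP[].
by have := H x; rewrite ler_norml => /andP[].
Qed.

End truncation.

Section scales.
Context {R : realType}.
Variables (n : nat) (kappa b K : R).
Hypothesis n0 : (0 < n)%N.
Hypothesis kappa0 : 0 < kappa.
Hypothesis b0 : 0 < b.
Hypothesis b1 : b * (4 + 2 * kappa) <= 1.
Hypothesis K0 : 0 < K.

(** With the mollification scale [n ^ - b], the errors [h ^ kappa] of the
    mollification and [box_width ^ - 2] of the truncation are both of the order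
    of [error_scale], and [deviation_scale] is the size of the corrector that
    fourth derivatives of order [n ^ (4 b)] turn into [error_scale]. *)
Definition error_scale : R := n%:R `^ (- (kappa * b)).
Definition box_width : R := (K + 2) * n%:R `^ (kappa * b / 2).
Definition deviation_scale : R := n%:R `^ (- (b * (4 + kappa))).
Definition deviation_exponent : R := 1 - b * (4 + 2 * kappa).

Let nR : 0 < n%:R :> R. Proof. by rewrite ltr0n. Qed.
Let n1 : 1 <= n%:R :> R. Proof. by rewrite ler1n. Qed.
Let pD (r s : R) : (n%:R : R) `^ r * n%:R `^ s = n%:R `^ (r + s).
Proof. by rewrite powRD// (gt_eqF nR) implybT. Qed.

Lemma powR_nat_ge1 (r : R) : 0 <= r -> 1 <= (n%:R : R) `^ r.
Proof. by move=> r0; rewrite -[leLHS](powRr0 n%:R) ler_powR. Qed.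

Lemma error_scale_gt0 : 0 < error_scale.
Proof. by rewrite powR_gt0. Qed.

Lemma error_scale_le1 : error_scale <= 1.
Proof. by rewrite -(powRr0 n%:R) ler_powR// oppr_le0 mulr_ge0// ltW. Qed.

Lemma deviation_scale_gt0 : 0 < deviation_scale.
Proof. by rewrite powR_gt0. Qed.

Lemma box_width_ge : K + 2 <= box_width.
Proof.
rewrite ler_peMr ?powR_nat_ge1//; first by rewrite addr_ge0 ?(ltW K0).
by rewrite divr_ge0// mulr_ge0// ltW.
Qed.

Lemma box_width_ge1 : 1 <= box_width.
Proof. by rewrite (le_trans _ box_width_ge)//; move: K0; lra. Qed.

Lemma box_width_sqr : (box_width ^+ 2)^-1 = error_scale / (K + 2) ^+ 2.
Proof.
rewrite exprMn invfM mulrC; congr (_ / _).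
rewrite /error_scale powRN; congr (_^-1).
by rewrite -powR_mulrn ?powR_ge0// -powRrM divfK.
Qed.

Lemma inv_le_deviation_scale : n%:R^-1 <= deviation_scale.
Proof.
rewrite -powR_inv1; last exact: ltW.
rewrite ler_powR// lerN2 (le_trans _ b1)// ler_pM2l// lerD2l ler_peMl//.
  exact: ltW.
by rewrite ler1n.
Qed.

Lemma deviation_scale_smooth : (n%:R `^ b) ^+ 4 * deviation_scale = error_scale.
Proof.
rewrite -powR_mulrn ?powR_ge0// -powRrM pD /error_scale.
by congr (_ `^ _); ring.
Qed.

Lemma deviation_scale_box : box_width ^+ 2 * n%:R `^ deviation_exponent =
  (K + 2) ^+ 2 * deviation_scale * n%:R.
Proof.
rewrite exprMn -[LHS]mulrA -[RHS]mulrA; congr (_ * _).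
rewrite -powR_mulrn ?powR_ge0// -powRrM -[X in _ = _ * X](powRr1 (ltW nR)) !pD.
by congr (_ `^ _); rewrite /deviation_exponent; field.
Qed.

Lemma deviation_exponent01 : 0 <= deviation_exponent <= 1.
Proof.
rewrite subr_ge0 b1/= gerBl mulr_ge0 ?(ltW b0)//.
by rewrite addr_ge0// mulr_ge0// ltW.
Qed.

Lemma rescaled_deviation (i : nat) : 1 + i%:R <= 3 * (box_width * n%:R) ->
  (1 + i%:R) `^ deviation_exponent <= 3 * box_width * n%:R `^ deviation_exponent.
Proof.
have /andP[t0 t1] := deviation_exponent01; rewrite mulrA => h.
have L1 := box_width_ge1.
have L3 : 1 <= 3 * box_width by rewrite mulr_ege1// ler1n.
have L30 : 0 <= 3 * box_width by rewrite (le_trans ler01).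
apply: (@le_trans _ _ ((3 * box_width * n%:R) `^ deviation_exponent)).
  by rewrite ge0_ler_powR// nnegrE; [rewrite addr_ge0|rewrite mulr_ge0].
rewrite powRM// ler_wpM2r ?powR_ge0//.
by rewrite -[leRHS]powRr1// ler_powR.
Qed.

Definition box_size : nat := (Num.truncn (box_width * n%:R)).+1.

Let Ln0 : 0 <= box_width * n%:R.
Proof. by rewrite mulr_ge0 ?(ltW nR)// (le_trans ler01)// box_width_ge1. Qed.

Lemma box_size_gt : box_width * n%:R < box_size%:R.
Proof. by have /andP[] := truncn_itv Ln0. Qed.

Lemma box_size_le : box_size%:R <= 2 * (box_width * n%:R).
Proof.
have /andP[+ _] := truncn_itv Ln0; rewrite /box_size -natr1.
have : 1 <= box_width * n%:R by rewrite mulr_ege1// box_width_ge1.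
by move=> h1 h2; rewrite mulr2n mulrDl mul1r addrC lerD.
Qed.

Variables (v : int -> R) (m A : R).
Hypothesis A1 : 1 <= A.
Hypothesis vA : forall i, `|half_line_sum v m i| <= A * (1 + i%:R) `^ deviation_exponent.
Hypothesis vA' : forall i,
  `|half_line_sum (v \o -%R) m i| <= A * (1 + i%:R) `^ deviation_exponent.

(** The size of the potential over [n ^+ 2], and of its differences over [n], in
    the box: there are at most [2 box_width n] sites on each side, and the sums of
    [v - m] there are at most [3 A box_width n ^ deviation_exponent]. *)
Definition corrector_size : R := 6 * A * (K + 2) ^+ 2 * deviation_scale.

Let A0 : 0 <= A := le_trans ler01 A1.
Let L0 : 0 <= box_width. Proof. exact: le_trans ler01 box_width_ge1. Qed.
Let s0 : 0 <= n%:R `^ deviation_exponent. Proof. exact: powR_ge0. Qed.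

Lemma corrector_size_ge0 : 0 <= corrector_size.
Proof.
by rewrite !mulr_ge0 ?exprn_ge0 ?(ltW deviation_scale_gt0)// addr_ge0 ?(ltW K0).
Qed.

Let corrector_sizeE : corrector_size * n%:R =
  6 * A * (box_width ^+ 2 * n%:R `^ deviation_exponent).
Proof. by rewrite deviation_scale_box /corrector_size; ring. Qed.

Let box_deviation u : (forall i, `|half_line_sum u m i| <= A * (1 + i%:R) `^ deviation_exponent) ->
  forall i, (i <= box_size)%N ->
  `|half_line_sum u m i| <= 3 * A * box_width * n%:R `^ deviation_exponent.
Proof.
move=> uA i iN; rewrite (le_trans (uA i))//.
rewrite (_ : 3 * A * box_width * _ = A * (3 * box_width * n%:R `^ deviation_exponent)); last by ring.
rewrite ler_wpM2l// rescaled_deviation//.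
have h1 : i%:R <= 2 * (box_width * n%:R) by rewrite (le_trans _ box_size_le)// ler_nat.
have h2 : 1 <= box_width * n%:R by rewrite mulr_ege1// box_width_ge1.
by rewrite (_ : 3 = 1 + 2) ?[leRHS]mulrDl ?mul1r ?lerD//; ring.
Qed.

Lemma potential_box_gradient j : (`|j| <= box_size)%N ->
  `|potential v m (j + 1) - potential v m j| <= corrector_size * n%:R.
Proof.
move=> jN.
rewrite (le_trans (potential_gradient (box_deviation vA) (box_deviation vA') jN))//.
rewrite corrector_sizeE (_ : 6 * A * _ =
  (3 * A * box_width * n%:R `^ deviation_exponent) * (2 * box_width)); last by ring.
have L2 : 1 <= 2 * box_width by rewrite mulr_ege1 ?ler1n ?box_width_ge1.
by rewrite ler_peMr// mulr_ge0// mulr_ge0// mulr_ge0.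
Qed.

Lemma potential_box_bound j : (`|j| <= box_size)%N ->
  `|potential v m j| <= corrector_size * n%:R ^+ 2.
Proof.
move=> jN.
rewrite (le_trans (potential_bound (box_deviation vA) (box_deviation vA') jN))//.
rewrite (_ : corrector_size * _ = corrector_size * n%:R * n%:R); last by ring.
rewrite corrector_sizeE (_ : 6 * A * _ * _ = 2 * (box_width * n%:R) *
  (3 * A * box_width * n%:R `^ deviation_exponent)); last by ring.
rewrite ler_wpM2r//; first by rewrite mulr_ge0// mulr_ge0// mulr_ge0.
exact: box_size_le.
Qed.

Hypothesis m1 : 1 <= m.

Lemma barrier_start (k : int) : `|k%:~R| <= n%:R * (K + 1) :> R ->
  barrier n m (potential v m) k <= (m + 2) * A * (K + 2) ^+ 2.
Proof.
move=> kK; have La0 : 0 <= K + 2 by rewrite addr_ge0 ?(ltW K0).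
have m0 := le_trans ler01 m1.
have kabs : `|k%:~R| = `|k|%:R :> R by rewrite -intr_norm -abszE.
have kLa : 1 + `|k%:~R| <= n%:R * (K + 2).
  rewrite (_ : K + 2 = 1 + (K + 1)); last by ring.
  by rewrite [leRHS]mulrDr mulr1 lerD.
have kLa' : `|k%:~R| <= n%:R * (K + 2) by rewrite (le_trans _ kLa)// lerDr.
have H u : (forall i, `|half_line_sum u m i| <= A * (1 + i%:R) `^ deviation_exponent) ->
    forall i, (i <= `|k|)%N -> `|half_line_sum u m i| <= A * (1 + `|k|%:R).
  move=> uA i ik; rewrite (le_trans (uA i))// ler_wpM2l//.
  rewrite (@le_trans _ _ (1 + i%:R))//; last by rewrite lerD2l ler_nat.
  have i1 : 1 <= 1 + i%:R :> R by rewrite lerDl.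
  have /andP[_ th1] := deviation_exponent01.
  by rewrite -[leRHS]powRr1 ?addr_ge0// ler_powR.
have P : potential v m k <= A * ((K + 2) ^+ 2 * n%:R ^+ 2).
  rewrite (le_trans (ler_norm _))//.
  rewrite (le_trans (potential_bound (H _ vA) (H _ vA') (leqnn _)))// -kabs.
  rewrite (_ : A * (_ ^+ 2 * _) = (n%:R * (K + 2)) * (A * (n%:R * (K + 2)))); last by ring.
  by rewrite ler_pM ?mulr_ge0 ?addr_ge0// ler_wpM2l.
have Q : k%:~R ^+ 2 <= (K + 2) ^+ 2 * n%:R ^+ 2 :> R.
  rewrite -(real_normK (num_real k%:~R)) -exprMn ler_sqr ?nnegrE ?mulr_ge0//.
  by rewrite mulrC.
rewrite /barrier ler_pdivrMr ?exprn_gt0//.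
rewrite (_ : _ * n%:R ^+ 2 = m * A * ((K + 2) ^+ 2 * n%:R ^+ 2) +
  2 * (A * ((K + 2) ^+ 2 * n%:R ^+ 2))); last by ring.
rewrite lerD//; last by rewrite ler_wpM2l.
rewrite -mulrA ler_wpM2l// (le_trans Q)// ler_peMl//.
by rewrite mulr_ge0 ?sqr_ge0.
Qed.

End scales.

Section rate.
Context {R : realType}.
Implicit Types (m K t A kappa b B : R).

(** [G] prices the four derivatives of the mollification at scale
    [(4 n ^ b)^-1], [W] the corrector, and [V] the exit of the chain from the box. *)
Definition rate_constant m K t A : R :=
  let G := 8 ^+ 4 in
  let W := 6 * G * (A * (K + 2) ^+ 2) in
  let V := (m + 2) * A + 2 * t in
  (1 + 14 * t) + 2 + 3 * G +
  (2 * W + 63 * G * (A * (K + 2) ^+ 2) * t + (2 + W) * V) + 2 + V.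

(** All errors are of order [error_scale]: the cutoff for each process, the
    mollification for each process, the displacement of the starting point to the
    grid for the diffusion, and the comparison for smooth functions. *)
Lemma deterministic_rate (n : nat) (v : int -> R) m A kappa b K t B (f : R -> R)
    (dX : measure_display) (WX : measurableType dX)
    (QX : R -> probability WX R) (X : R -> WX -> R)
    (dY : measure_display) (WY : measurableType dY)
    (QY : R -> probability WY R) (Y : R -> WY -> R) (x : R) :
  (0 < n)%N -> (forall k, 1 <= v k) -> 1 <= m -> 1 <= A ->
  0 < kappa -> kappa <= 1 -> 0 < b -> b * (4 + 2 * kappa) <= 1 -> 0 < K -> 0 < t ->
  (forall i, `|half_line_sum v m i| <= A * (1 + i%:R) `^ deviation_exponent kappa b) ->
  (forall i, `|half_line_sum (v \o -%R) m i| <=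
     A * (1 + i%:R) `^ deviation_exponent kappa b) ->
  btm_process n v QX X -> diffusion_process m QY Y ->
  (forall x, `|f x| <= B) -> (forall x y, `|f x - f y| <= B * `|x - y| `^ kappa) ->
  `|x| <= K ->
  `|expect QY Y x t f - expect QX X ((Num.floor (n%:R * x))%:~R / n%:R) t f| <=
  rate_constant m K t A * B * error_scale n kappa b.
Proof.
move=> n0 v1 m1 A1 k0 k1 b0 b1 K0 t0 vA vA' btm dif bf hf xK.
have n1 : 1 <= n%:R :> R by rewrite ler1n.
have nR : 0 < n%:R :> R by rewrite ltr0n.
have A0 := le_trans ler01 A1; have B0 : 0 <= B := le_trans (normr_ge0 _) (bf 0).
pose La := K + 2; pose L := box_width n kappa b K.
pose e := error_scale n kappa b; pose eta := deviation_scale n kappa b.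
pose p : R := n%:R `^ b; pose om := corrector_size n kappa b K A.
pose N := box_size n kappa b K.
have e0 : 0 < e by exact: error_scale_gt0.
have e1 : e <= 1 by exact: error_scale_le1.
have eta0 : 0 < eta by exact: deviation_scale_gt0.
have p1 : 1 <= p by apply: powR_nat_ge1 => //; exact: ltW.
have p0 := lt_le_trans ltr01 p1.
have L1 : 1 <= L by exact: box_width_ge1.
have L0 := lt_le_trans ltr01 L1.
have LaL : La <= L by exact: box_width_ge.
have La1 : 1 <= La by rewrite -(lerD2r (-1)) subrr /La -addrA addr_ge0 ?(ltW K0)// subr_ge0 ler1n.
have La0 := le_trans ler01 La1.
have La21 : 1 <= La ^+ 2 by rewrite exprn_ege1.
have La20 := lt_le_trans ltr01 La21.
have L2 : (L ^+ 2)^-1 = e / La ^+ 2 by exact: box_width_sqr.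
have neta : n%:R^-1 <= eta by exact: inv_le_deviation_scale.
have p4eta : p ^+ 4 * eta = e by exact: deviation_scale_smooth.
have omE : om = 6 * A * La ^+ 2 * eta by [].
have om0 : 0 <= om by exact: corrector_size_ge0.
have gradPhi := potential_box_gradient n0 k0 b0 b1 K0 A1 vA vA'.
have boundPhi := potential_box_bound n0 k0 b0 b1 K0 A1 vA vA'.
have N1 := box_size_gt n0 k0 b0 K0.
have lowPhi j := potential_lower m j v1.
have lapPhi := second_difference_potential v m.
pose k := Num.floor (n%:R * x).
have kx : k%:~R <= n%:R * x < k%:~R + 1.
  by rewrite ge_floor/= (_ : 1 = 1%:~R)// -intrD floorD1_gt.
have /andP[kx1 kx2] := kx.
have kK : `|k%:~R| <= n%:R * (K + 1) :> R.
  rewrite mulrDr mulr1 -[k%:~R](subrK (n%:R * x)) (le_trans (ler_normD _ _))// addrC lerD//.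
    by rewrite normrM (gtr0_norm nR) ler_wpM2l// ltW.
  rewrite ler_norml; apply/andP; split; last by rewrite lerBlDr (le_trans kx1)// lerDr (le_trans ler01).
  by rewrite lerNl opprB (le_trans _ n1)// ltW// ltrBlDl.
have kN : (`|k| <= N)%N.
  rewrite -(ler_nat R) (_ : `|k|%:R = `|k%:~R| :> R); last by rewrite -intr_norm -abszE.
  rewrite (le_trans kK)// (le_trans _ (ltW N1))// mulrC ler_wpM2r ?(ltW nR)//.
  by rewrite (le_trans _ LaL)// lerD2l ler1n.
pose V := (m + 2) * A + 2 * t.
have V0 : 0 <= V by rewrite addr_ge0 ?mulr_ge0 ?addr_ge0 ?(ltW t0)// (le_trans ler01).
have barr : (barrier n m (potential v m) k + 2 * t) / L ^+ 2 <= V * e.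
  rewrite L2 mulrCA mulrC ler_pM2r// ler_pdivrMr// [leRHS]mulrDl lerD//.
    exact: (barrier_start n0 k0 b0 b1 K0 A1 vA vA' m1 kK).
  by rewrite ler_peMr// mulr_ge0// ltW.
pose c := cutoff L.
have c01 y : 0 <= c y <= 1 by exact: cutoff_ge0.
have cC0 : C0 setT c by exact: C0_cutoff.
have c_1 y : `|c y| <= 1 by have /andP[? ?] := c01 y; rewrite ger0_norm.
have contf := holder_continuous k0 bf hf.
pose F := f \* c.
have contF : continuous F.
  by move=> y; apply: cvgM; [exact: contf|exact: C0_continuous cC0 _].
have FB y : `|F y| <= B.
  by rewrite normrM -[leRHS]mulr1 ler_pM.
have FC0 : C0 setT F.
  apply: (C0_dominated B0 contF _ cC0) => y.
  by rewrite normrM ler_wpM2r.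
have h0 : 0 < (4 * p)^-1 by rewrite invr_gt0 mulr_gt0.
have modF y z : y <= z <= y + 4 * (4 * p)^-1 -> `|F z - F y| <= 2 * B * e.
  move=> /andP[yz zy].
  have h4 : 4 * (4 * p)^-1 = p^-1 by rewrite invfM mulrA divff// mul1r.
  rewrite h4 in zy.
  have zy' : `|z - y| <= p^-1 by rewrite ger0_norm ?subr_ge0// lerBlDl.
  rewrite (le_trans (holder_cutoff k1 bf hf L1 _))//.
    by rewrite (le_trans zy')// invf_le1.
  rewrite ler_wpM2l ?mulr_ge0//.
  apply: (@le_trans _ _ ((p^-1) `^ kappa)).
    by rewrite ge0_ler_powR// ?nnegrE ?invr_ge0 ltW.
  rewrite /p -powRN -powRrM /e.
  by rewrite (_ : - b * kappa = - (kappa * b))//; ring.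
have [g [dg cg bg gF]] := C0_mollification h0 FC0 FB modF.
have [G GE] : exists G : R, G = 8 ^+ 4 by exists (8 ^+ 4).
have G1 : 1 <= G by rewrite GE exprn_ege1// ler1n.
have G0 := le_trans ler01 G1.
pose M := G * p ^+ 4 * B.
have p40 : 1 <= p ^+ 4 by rewrite exprn_ege1.
have M0 : 0 <= M by rewrite mulr_ge0// mulr_ge0// (le_trans ler01).
have BM : B <= M.
  by rewrite /M ler_peMl// mulr_ege1.
have twoh : 2 / (4 * p)^-1 = 8 * p by rewrite invrK; ring.
have g0 y : `|g 0%N y| <= B by have := bg 0%N y isT; rewrite expr0 mul1r.
have g2 y : `|g 2%N y| <= M.
  rewrite (le_trans (bg 2%N y isT))// twoh /M ler_wpM2r// GE -exprMn.
  by rewrite ler_weXn2l// mulr_ege1// ler1n.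
have g4 y : `|g 4%N y| <= M.
  by rewrite (le_trans (bg 4%N y isT))// twoh /M GE -exprMn.
have t0' := ltW t0.
have H4 := smooth_comparison n0 v1 m1 L0 (ltW N1) om0 lapPhi gradPhi boundPhi lowPhi
  btm dif dg cg g0 g2 g4 t0' kN.
have Hchain := chain_tail n0 v1 L0 (ltW N1) lapPhi lowPhi
  btm cC0 c01 (one_sub_cutoff L) t0' kN.
have Hdiff := diffusion_tail L0 x m1 dif t0'.
set a := k%:~R / n%:R in H4 Hchain *.
have mkX : markov_process (grid n) QX X by case: btm.
have mkY : markov_process setT QY Y by case: dif.
have mG := @measurable_grid R n.
have bm (S : set R) (mS : measurable S) (q : R -> R) D : continuous q -> (forall y, `|q y| <= D) ->
    bounded_measurable S q.
  move=> cq qD; split; last by exists D.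
  by apply: measurable_funTS; exact: continuous_measurable_fun.
have cc : continuous c := C0_continuous cC0.
have cgc : continuous (g 0%N) := C0_continuous (cg 0%N isT).
have T1 := expect_truncation measurableT mkY x t0' (bm _ measurableT _ _ contf bf)
  (bm _ measurableT _ _ cc c_1) (bm _ measurableT _ _ contF FB) bf c01.
have T6 := expect_truncation mG mkX a t0' (bm _ mG _ _ contf bf)
  (bm _ mG _ _ cc c_1) (bm _ mG _ _ contF FB) bf c01.
have T2 : `|expect QY Y x t F - expect QY Y x t (g 0%N)| <= 2 * B * e.
  apply: (expect_close measurableT mkY) => //; [exact: (bm _ measurableT _ _ contF FB)|
    exact: (bm _ measurableT _ _ cgc g0)|].
  by move=> y _; rewrite distrC.
have T5 : `|expect QX X a t (g 0%N) - expect QX X a t F| <= 2 * B * e.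
  apply: (expect_close mG mkX) => //; [exact: (bm _ mG _ _ cgc g0)|
    exact: (bm _ mG _ _ contF FB)].
(* fourth derivatives of order [n ^ (4 b)] against the size of the corrector *)
have Meta : M * eta = G * B * e by rewrite /M -p4eta; ring.
have T3 : `|expect QY Y x t (g 0%N) - expect QY Y a t (g 0%N)| <= 3 * G * B * e.
  have m0 := lt_le_trans ltr01 m1.
  have [u1 [e1' e2']] := diffusion_expect_derivatives m0 dif (dg 0%N isT) (dg 1%N isT)
    (cg 0%N isT) (cg 2%N isT) g0 g2 t0'.
  have ub z : `|u1 z| <= 3 * M.
    have := landau_kolmogorov z e1' e2'
      (fun z => diffusion_bound dif (cg 0%N isT) g0 z t0')
      (fun z => diffusion_bound dif (cg 2%N isT) g2 z t0').
    move=> /le_trans; apply; rewrite (_ : 3 * M = 2 * M + M); last by ring.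
    by rewrite lerD2r ler_wpM2l.
  have := MVT_lipschitz a x e1' ub => /le_trans; apply.
  have xa : `|x - a| <= n%:R^-1.
    rewrite /a (_ : x - _ = (n%:R * x - k%:~R) / n%:R); last first.
      by rewrite mulrBl mulrAC mulfV ?mul1r// gt_eqF.
    rewrite normrM normfV (gtr0_norm nR) ler_piMl ?invr_ge0// ger0_norm ?subr_ge0//.
    by rewrite lerBlDl ltW.
  rewrite (@le_trans _ _ (3 * M * eta))//.
    by rewrite ler_wpM2l//; [rewrite mulr_ge0|exact: le_trans xa neta].
  by rewrite -mulrA Meta !mulrA.
pose W := 6 * G * (A * La ^+ 2).
have W0 : 0 <= W by rewrite !mulr_ge0// sqr_ge0.
have Mom : M * om = W * B * e.
  rewrite (_ : M * om = 6 * A * La ^+ 2 * (M * eta)); last by rewrite omE; ring.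
  by rewrite Meta /W; ring.
have T4 : `|expect QX X a t (g 0%N) - expect QY Y a t (g 0%N)| <=
    (2 * W + 63 * G * (A * La ^+ 2) * t + (2 + W) * V) * B * e.
  apply: (le_trans H4).
  have q1 : 9 * M * (n%:R^-1 + om) * t <= 63 * G * (A * La ^+ 2) * t * B * e.
    have q2 : n%:R^-1 + om <= 7 * (A * La ^+ 2) * eta.
      rewrite (_ : 7 * _ * eta = A * La ^+ 2 * eta + om); last by rewrite omE; ring.
      rewrite lerD2r (le_trans neta)// ler_peMl ?(ltW eta0)//.
      exact: mulr_ege1.
    rewrite (_ : 63 * G * _ * t * B * e = 9 * (7 * (A * La ^+ 2) * (G * B * e)) * t); last by ring.
    rewrite -Meta ler_wpM2r// -mulrA ler_wpM2l//.
    by rewrite (_ : 7 * _ * _ = M * (7 * (A * La ^+ 2) * eta)) ?ler_wpM2l//; ring.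
  have q4 : (2 * B + M * om) * (barrier n m (potential v m) k + 2 * t) / L ^+ 2 <=
      (2 + W) * V * B * e.
    rewrite Mom -mulrA.
    rewrite (_ : (2 + W) * V * B * e = (2 + W) * B * (V * e)); last by ring.
    have q5 : 0 <= 2 * B + W * B * e by rewrite addr_ge0 ?mulr_ge0// ltW.
    rewrite (le_trans (ler_wpM2l q5 barr))// ler_wpM2r ?mulr_ge0 ?(ltW e0)//.
    rewrite [leRHS]mulrDl lerD2l ler_piMr// mulr_ge0//.
  rewrite (_ : (2 * W + _ + _) * B * e = 2 * (W * B * e) +
    63 * G * (A * La ^+ 2) * t * B * e + (2 + W) * V * B * e); last by ring.
  by rewrite -Mom lerD// lerD.
have T1' : B * (1 - expect QY Y x t c) <= (1 + 14 * t) * B * e.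
  rewrite [(1 + _) * B]mulrC -mulrA ler_wpM2l// (le_trans Hdiff)// L2.
  rewrite mulrCA mulrC ler_pM2r// ler_pdivrMr// [leRHS]mulrDl mul1r lerD//.
    by rewrite -(real_normK (num_real x)) ler_sqr ?nnegrE// (le_trans xK)// lerDl.
  by rewrite ler_peMr// mulr_ge0.
have T6' : B * (1 - expect QX X a t c) <= V * B * e.
  by rewrite [V * B]mulrC -mulrA ler_wpM2l// (le_trans Hchain).
rewrite distrC in T6; rewrite distrC in T4.
rewrite (_ : expect QY Y x t f - expect QX X a t f =
  (expect QY Y x t f - expect QY Y x t F) + (expect QY Y x t F - expect QY Y x t (g 0%N)) +
  (expect QY Y x t (g 0%N) - expect QY Y a t (g 0%N)) +
  (expect QY Y a t (g 0%N) - expect QX X a t (g 0%N)) +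
  (expect QX X a t (g 0%N) - expect QX X a t F) +
  (expect QX X a t F - expect QX X a t f)); last by ring.
rewrite /rate_constant -GE -/La -/W -/V -/e.
set D4 := 2 * W + _ + _ in T4 *.
rewrite (_ : _ * B * e = (1 + 14 * t) * B * e + 2 * B * e + 3 * G * B * e +
  D4 * B * e + 2 * B * e + V * B * e); last by ring.
have T1'' := le_trans T1 T1'; have T6'' := le_trans T6 T6'.
by do 5 rewrite (le_trans (ler_normD _ _))// lerD//.
Qed.

End rate.

(** * Dyadic blocks and moments of the traps *)

Section dyadic_chaining.
Context {R : realType}.
Implicit Types z : nat -> R.

Lemma sqr_sum_le (n : nat) (x : nat -> R) :
  (\sum_(i < n) x i) ^+ 2 <= n%:R * \sum_(i < n) x i ^+ 2.
Proof.
elim: n => [|n ih]; first by rewrite !big_ord0 expr0n mulr0.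
rewrite !big_ord_recr /= sqrrD.
have h : (\sum_(i < n) x i) * x n *+ 2 <= \sum_(i < n) x i ^+ 2 + n%:R * x n ^+ 2.
  rewrite (_ : n%:R * x n ^+ 2 = \sum_(i < n) x n ^+ 2); last first.
    by rewrite sumr_const card_ord mulr_natl.
  rewrite -big_split mulr_suml -sumrMnl /=.
  by apply: ler_sum => i _; have := sqr_ge0 (x i - x n); rewrite sqrrB; lra.
rewrite -natr1; move: ih h; lra.
Qed.

Definition block_sum z (i b : nat) : R := \sum_(b * 2 ^ i <= j < b.+1 * 2 ^ i) z j.

Definition block_energy z (J : nat) : R :=
  \sum_(i < J) \sum_(b < 2 ^ (J - i)) block_sum z i b ^+ 2.

(** A partial sum is a sum of at most one dyadic block for each level: this
    replaces a maximal inequality by second moments of the block sums. *)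
Lemma partial_sum_block_energy z (J k : nat) : (k < 2 ^ J)%N ->
  (\sum_(j < k) z j) ^+ 2 <= J%:R * block_energy z J.
Proof.
move=> kJ.
pose F k := \sum_(0 <= j < k) z j.
pose T i := F ((k %/ 2 ^ i) * 2 ^ i)%N.
have T0 : T 0%N = \sum_(j < k) z j by rewrite /T expn0 divn1 muln1 /F big_mkord.
have TJ : T J = 0 by rewrite /T divn_small// mul0n /F big_geq.
have -> : \sum_(j < k) z j = \sum_(i < J) (T i - T i.+1).
  rewrite -T0 -[LHS]subr0 -[X in _ - X]TJ -opprB -telescope_sumr// big_mkord -sumrN.
  by apply: eq_bigr => i _; rewrite opprB.
rewrite (le_trans (sqr_sum_le _ (fun i => T i - T i.+1)))// ler_wpM2l//.
apply: ler_sum => i _.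
have s0 (b : 'I_(2 ^ (J - i))) : 0 <= block_sum z i b ^+ 2 by exact: sqr_ge0.
pose q := (k %/ 2 ^ i)%N.
have qE : (k %/ 2 ^ i.+1 = q./2)%N by rewrite expnSr divnMA divn2.
have qlt : (q < 2 ^ (J - i))%N.
  by rewrite /q ltn_divLR ?expn_gt0// -expnD subnK// ltnW.
have -> : T i - T i.+1 = if odd q then block_sum z i q.-1 else 0.
  rewrite /T qE -/q expnS mulnA muln2.
  have q2 := odd_double_half q; case: ifP => oq; rewrite oq /= in q2.
    rewrite -[in X in X - _]q2 -[in RHS]q2 add1n /=.
    rewrite /F (@big_cat_nat _ _ _ (q./2.*2 * 2 ^ i))//= ?leq_mul//.
    by rewrite [X in X - _]addrC addrK.
  by rewrite add0n in q2; rewrite q2 subrr.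
case: ifP => oq; last by rewrite expr0n/= sumr_ge0.
have q1 : (q.-1 < 2 ^ (J - i))%N by rewrite (leq_ltn_trans (leq_pred _)).
by rewrite (bigD1 (Ordinal q1))//= lerDl sumr_ge0.
Qed.

End dyadic_chaining.

Section geometric.
Context {R : realType}.

Lemma powR_gt1 (x r : R) : 1 < x -> 0 < r -> 1 < x `^ r.
Proof.
move=> x1 r0; have <- : 1 `^ r = 1 :> R by rewrite powR1.
by rewrite gt0_ltr_powR ?nnegrE// ltW// (lt_trans ltr01).
Qed.

Lemma powR_lt1 (x r : R) : 0 <= x < 1 -> 0 < r -> x `^ r < 1.
Proof.
move=> /andP[x0 x1] r0; have <- : 1 `^ r = 1 :> R by rewrite powR1.
by rewrite gt0_ltr_powR ?nnegrE.
Qed.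

Lemma powR_exprn (x r : R) n : 0 <= x -> (x ^+ n) `^ r = x `^ (n%:R * r).
Proof. by move=> x0; rewrite -(powR_mulrn n x0) powRrM. Qed.

Lemma exprn_powR (x r : R) n : (x `^ r) ^+ n = x `^ (r * n%:R).
Proof. by rewrite -(powR_mulrn n (powR_ge0 _ _)) powRrM. Qed.

(** Bernoulli's inequality, which lets an exponential of arbitrarily small rate
    absorb the factors [J]. *)
Lemma nat_le_powR (dl : R) (J : nat) : 0 < dl ->
  J%:R <= (2 `^ dl - 1)^-1 * 2 `^ (dl * J%:R).
Proof.
move=> d0; set c := 2 `^ dl - 1.
have c0 : 0 < c.
  by rewrite subr_gt0 powR_gt1 ?ltr1n.
rewrite mulrC ler_pdivlMr// powRrM powR_mulrn ?powR_ge0// -/(2 `^ dl).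
rewrite (_ : 2 `^ dl = 1 + c); last by rewrite /c addrC subrK.
apply: (@le_trans _ _ (1 + J%:R * c)); first by rewrite lerDr.
elim: J => [|J ih]; first by rewrite mul0r addr0 expr0.
rewrite exprS mulrDl mul1r -natr1 mulrDl mul1r addrA.
have h : 1 <= (1 + c) ^+ J by rewrite exprn_ege1// lerDl ltW.
have := ler_wpM2l (ltW c0) h; move: ih; rewrite mulr1; lra.
Qed.

Lemma nneseries_geometric (C r : R) : 0 <= C -> 0 <= r < 1 ->
  (\sum_(0 <= k <oo) (C * r ^+ k)%:E < +oo)%E.
Proof.
move=> C0 /andP[r0 r1].
have cv := @cvg_geometric_series R C r; rewrite ger0_norm// in cv.
rewrite (_ : (\sum_(0 <= k <oo) (C * r ^+ k)%:E)%E =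
  limn (EFin \o series (geometric C r))).
  rewrite EFin_lim ?ltry//; apply/cvg_ex; eexists; exact: cv.
by congr (limn _); apply/funext => k /=; rewrite -sumEFin.
Qed.

End geometric.

Section pareto_moment.
Context {d : measure_display} {Omega : measurableType d} {R : realType}.
Variables (P : probability Omega R) (alpha : R) (Y : {RV P >-> R}).
Hypothesis alpha1 : 1 < alpha.
Hypothesis pareto : pareto_tail alpha Y.

(** Let [u] decrease to 1 in the tail formula, which holds for [u > 1] only. *)
Lemma pareto_ge1 : P [set w | 1 <= Y w] = 1%E.
Proof.
have mge (u : R) : measurable [set w | u <= Y w].
  rewrite (_ : [set _ | _] = setT `&` Y @^-1` `[u, +oo[); first exact: measurable_funP.
  by apply/seteqP; split => w /=; rewrite in_itv/= andbT; [|case].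
apply/eqP; rewrite eq_le probability_le1//=.
rewrite leNgt; apply/negP.
have fP : P [set w | 1 <= Y w] \is a fin_num by rewrite fin_num_measure.
rewrite -(fineK fP) lte_fin; set q := fine _ => q1.
have q0 : 0 <= q by rewrite fine_ge0.
pose r := (q + 1) / 2; have r0 : 0 < r by rewrite divr_gt0// ltr_wpDl.
have r1 : r < 1 by rewrite ltr_pdivrMr// mul1r; lra.
have a0 : 0 < alpha by rewrite (lt_trans ltr01).
pose u := r `^ (- alpha^-1).
have u1 : 1 < u.
  rewrite /u powRN -[ltLHS]invr1 ltf_pV2 ?posrE ?powR_gt0//.
  by rewrite powR_lt1 ?invr_gt0// ltW.
have := pareto u1; rewrite /u -powRrM mulrNN mulVf ?gt_eqF// powRr1 ?ltW// => Pu.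
have : (P [set w | (u <= Y w)%R] <= P [set w | (1 <= Y w)%R])%E.
  by rewrite le_measure ?inE// => w /=; apply: le_trans; exact: ltW.
rewrite /u Pu -(fineK fP) lee_fin -/q /r => h.
move: q1 h; lra.
Qed.

(** The traps are at least 1 almost surely; this modification is at least 1
    everywhere. *)
Definition at_least_one (x : R) : R := Num.max x 1.

Lemma at_least_one_ge1 x : 1 <= at_least_one x.
Proof. by rewrite /at_least_one le_max lexx orbT. Qed.

Lemma measurable_at_least_one : measurable_fun setT at_least_one.
Proof. by apply: measurable_maxr => //; exact: measurable_cst. Qed.

(** The variable is at most [2 ^ (k + 1)] for the largest [k] such that it exceeds
    [2 ^ k]; the resulting series is geometric of ratio [2 ^ (p - alpha)]. *)
Lemma pareto_moment (p : R) : 0 < p < alpha ->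
  (\int[P]_w ((at_least_one (Y w)) `^ p)%:E < +oo)%E.
Proof.
move=> /andP[p0 pa].
pose B (k : nat) := [set w | 2 ^+ k <= Y w].
have mge (u : R) : measurable [set w | u <= Y w].
  rewrite (_ : [set _ | _] = setT `&` Y @^-1` `[u, +oo[); first exact: measurable_funP.
  by apply/seteqP; split => w /=; rewrite in_itv/= andbT; [|case].
have mB k : measurable (B k) by exact: mge.
pose c (k : nat) : R := (2 ^+ k.+1) `^ p.
have c0 k : 0 <= c k by exact: powR_ge0.
pose S w : \bar R := (\sum_(0 <= k <oo) (c k * \1_(B k) w)%:E)%E.
have mt k : measurable_fun setT (fun w => (c k * \1_(B k) w)%:E).
  apply/measurable_EFinP; apply: measurable_funM; first exact: measurable_cst.
  exact: measurable_indic.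
have t0 k w : (0 <= (c k * \1_(B k) w)%:E)%E by rewrite lee_fin mulr_ge0.
have mS : measurable_fun setT S.
  by apply: ge0_emeasurable_sum => // k w _ _; exact: t0.
have S0 w : (0 <= S w)%E by apply: nneseries_ge0 => k _ _; exact: t0.
have pw w : ((at_least_one (Y w) `^ p)%:E <= 1 + S w)%E.
  have [Y1|Y1] := ltP (Y w) 1.
    by rewrite /at_least_one (max_r (ltW Y1)) powR1; exact: leeDl.
  rewrite /at_least_one max_l//.
  pose k := trunc_log 2 (Num.truncn (Y w)).
  have Y0 := le_trans ler01 Y1.
  have /andP[T1 T2] := truncn_itv Y0.
  have T0 : (0 < Num.truncn (Y w))%N by rewrite truncn_gt0.
  have /andP[K1 K2] := trunc_log_bounds (isT : (1 < 2)%N) T0.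
  have Bk : B k w.
    by rewrite /B /= (le_trans _ T1)// -natrX ler_nat.
  have Yk : Y w <= 2 ^+ k.+1.
    by rewrite ltW// (lt_le_trans T2)// -natrX ler_nat.
  rewrite (@le_trans _ _ (c k * \1_(B k) w)%:E)//.
    rewrite lee_fin indicE mem_set// mulr1 ge0_ler_powR ?nnegrE ?exprn_ge0//.
    exact: ltW.
  apply: (@le_trans _ _ (S w)); last by rewrite leeDr.
  apply: le_trans (nneseries_lim_ge k.+1 _) => [|i _ _]; last exact: t0.
  by rewrite big_nat_recr//= leeDr// sume_ge0.
have my : measurable_fun setT (fun w => (at_least_one (Y w) `^ p)%:E).
  apply/measurable_EFinP.
  apply: (@measurableT_comp _ _ _ _ _ _ (fun x => x `^ p)).
    exact: measurable_powR.
  by apply: measurableT_comp; [exact: measurable_at_least_one|].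
apply: (@le_lt_trans _ _ (\int[P]_w (1 + S w))%E).
  apply: ge0_le_integral => //; first by move=> w _; rewrite lee_fin powR_ge0.
  by apply: emeasurable_funD => //; exact: measurable_cst.
rewrite ge0_integralD// integral_cst// mul1e.
apply: lte_add_pinfty.
  by apply: (le_lt_trans (probability_le1 P measurableT)); exact: ltry.
rewrite integral_nneseries//.
have ik k : (\int[P]_w (c k * \1_(B k) w)%:E = (c k)%:E * P (B k))%E.
  under eq_integral do rewrite EFinM.
  by rewrite ge0_integralZl// ?integral_indic ?setIT//; [apply/measurable_EFinP; exact: measurable_indic|rewrite lee_fin].
pose r : R := 2 `^ (p - alpha).
have r0 : 0 <= r < 1.
  rewrite powR_ge0/= /r -opprB powRN invf_lt1 ?powR_gt0//.
  by rewrite powR_gt1 ?subr_gt0 ?ltr1n.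
apply: (@le_lt_trans _ _ (\sum_(0 <= k <oo) (2 `^ p * r ^+ k)%:E)%E); last first.
  by apply: nneseries_geometric => //; exact: powR_ge0.
apply: lee_nneseries => k _; first by rewrite integral_ge0// => w _; exact: t0.
rewrite ik.
have PB : (P (B k) <= ((2 ^+ k) `^ (- alpha))%:E)%E.
  case: k => [|k]; first by rewrite expr0 powR1 probability_le1.
  by rewrite /B pareto// exprn_egt1// ltr1n.
apply: (@le_trans _ _ ((c k)%:E * ((2 ^+ k) `^ (- alpha))%:E)%E).
  by apply: lee_wpmul2l => //; rewrite lee_fin.
rewrite -EFinM lee_fin /c.
rewrite !powR_exprn// /r exprn_powR.
rewrite -powRD ?pnatr_eq0 ?implybT// -powRD ?pnatr_eq0 ?implybT//.
rewrite (_ : k.+1%:R * p + k%:R * - alpha = p + (p - alpha) * k%:R)//.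
by rewrite -natr1; ring.
Qed.

End pareto_moment.

(** * Expectations of bounded variables and independence *)

Section bounded_expectation.
Context {d : measure_display} {Omega : measurableType d} {R : realType}.
Variable P : probability Omega R.
Implicit Types f g : Omega -> R.

Definition mean f : R := \int[P]_w f w.

Lemma bounded_measurable_integrable f : bounded_measurable setT f ->
  P.-integrable setT (EFin \o f).
Proof.
move=> [mf [M fM]]; apply: measurable_bounded_integrable => //.
  by rewrite (le_lt_trans (probability_le1 P measurableT))// ltry.
exists M; split; first exact: num_real.
by move=> N MN w _ /=; rewrite (le_trans (fM _ _))//; exact: ltW.
Qed.

Lemma mean_integral f : bounded_measurable setT f ->
  (\int[P]_w (f w)%:E = (mean f)%:E)%E.
Proof.
move=> bf; rewrite /mean /Rintegral fineK//.
by apply: integrable_fin_num => //; exact: bounded_measurable_integrable.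
Qed.

Lemma meanD f g : bounded_measurable setT f -> bounded_measurable setT g ->
  mean (f \+ g) = mean f + mean g.
Proof. by move=> bf bg; apply: RintegralD => //; exact: bounded_measurable_integrable. Qed.

Lemma meanB f g : bounded_measurable setT f -> bounded_measurable setT g ->
  mean (f \- g) = mean f - mean g.
Proof. by move=> bf bg; apply: RintegralB => //; exact: bounded_measurable_integrable. Qed.

Lemma meanZ c f : bounded_measurable setT f -> mean (c \*o f) = c * mean f.
Proof. by move=> bf; apply: RintegralZl => //; exact: bounded_measurable_integrable. Qed.

Lemma mean_cst c : mean (cst c) = c.
Proof. by rewrite /mean Rintegral_cst//= probability_setT mulr1. Qed.

Lemma le_mean f g : bounded_measurable setT f -> bounded_measurable setT g ->
  (forall w, f w <= g w) -> mean f <= mean g.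
Proof.
by move=> bf bg fg; apply: le_Rintegral => //; exact: bounded_measurable_integrable.
Qed.

Lemma mean_close f g e : bounded_measurable setT f -> bounded_measurable setT g ->
  (forall w, `|f w - g w| <= e) -> `|mean f - mean g| <= e.
Proof.
move=> bf bg fg; rewrite -meanB//; have bfg := bounded_measurableB bf bg.
have bc c := @bounded_measurable_cst R _ _ (@setT Omega) c.
have b1 : mean (cst (- e)) <= mean (f \- g).
  by apply: le_mean => // w; have := fg w; rewrite ler_norml => /andP[].
have b2 : mean (f \- g) <= mean (cst e).
  by apply: le_mean => // w; have := fg w; rewrite ler_norml => /andP[].
by rewrite ler_norml; rewrite !mean_cst in b1 b2; rewrite b1.
Qed.

Lemma mean_bound f e : bounded_measurable setT f ->
  (forall w, `|f w| <= e) -> `|mean f| <= e.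
Proof.
move=> bf fe; rewrite -[mean f]subr0 -(mean_cst 0).
apply: mean_close => //; first exact: bounded_measurable_cst.
by move=> w; rewrite subr0.
Qed.

Lemma bounded_measurable_sum (I : Type) (s : seq I) (F : I -> Omega -> R) :
  (forall i, bounded_measurable setT (F i)) ->
  bounded_measurable setT (fun w => \sum_(i <- s) F i w).
Proof.
move=> bF; elim: s => [|i s ih].
  under eq_fun do rewrite big_nil; exact: bounded_measurable_cst.
by under eq_fun do rewrite big_cons; exact: bounded_measurableD.
Qed.

Lemma mean_sum (I : Type) (s : seq I) (F : I -> Omega -> R) :
  (forall i, bounded_measurable setT (F i)) ->
  mean (fun w => \sum_(i <- s) F i w) = \sum_(i <- s) mean (F i).
Proof.
move=> bF; elim: s => [|i s ih].
  by rewrite big_nil; under eq_fun do rewrite big_nil; exact: mean_cst.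
rewrite big_cons -ih -meanD//; last exact: bounded_measurable_sum.
by congr mean; apply/funext => w; rewrite big_cons.
Qed.

Lemma mean_indic (A : set Omega) : measurable A -> mean \1_A = fine (P A).
Proof.
by move=> mA; rewrite /mean /Rintegral (eq_integral (fun w => (\1_A w)%:E))//
  integral_indic// setIT.
Qed.

Lemma bounded_measurable_comp (X : {RV P >-> R}) (phi : R -> R) :
  bounded_measurable setT phi -> bounded_measurable setT (fun w => phi (X w)).
Proof.
move=> [mphi [M phiM]]; split; first exact: measurableT_comp.
by exists M => w _; exact: phiM.
Qed.

End bounded_expectation.

Section independence.
Context {d : measure_display} {Omega : measurableType d} {R : realType}.
Variable P : probability Omega R.

Definition independent_pair (U V : {RV P >-> R}) :=
  forall A B : set R, measurable A -> measurable B ->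
    P (U @^-1` A `&` V @^-1` B) = (P (U @^-1` A) * P (V @^-1` B))%E.

(** Applied to each factor in turn, this extends the product formula from
    indicators to bounded functions of two independent variables. *)
Lemma bounded_functionals_eq (J1 J2 : (R -> R) -> R) (C : R) :
  (forall g h, bounded_measurable setT g -> bounded_measurable setT h ->
     J1 (g \+ h) = J1 g + J1 h) ->
  (forall g h, bounded_measurable setT g -> bounded_measurable setT h ->
     J2 (g \+ h) = J2 g + J2 h) ->
  (forall g h e, bounded_measurable setT g -> bounded_measurable setT h ->
     (forall x, `|g x - h x| <= e) -> `|J1 g - J1 h| <= C * e) ->
  (forall g h e, bounded_measurable setT g -> bounded_measurable setT h ->
     (forall x, `|g x - h x| <= e) -> `|J2 g - J2 h| <= C * e) ->
  (forall c B, measurable B -> J1 (c \*o \1_B) = J2 (c \*o \1_B)) ->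
  forall g, bounded_measurable setT g -> J1 g = J2 g.
Proof.
move=> D1 D2 C1 C2 E1 g bg.
have Ec c : J1 (cst c) = J2 (cst c).
  have -> : cst c = c \*o \1_[set: R] :> (R -> R).
    by apply/funext => x /=; rewrite indicT mulr1.
  by apply: E1; exact: measurableT.
apply/eqP; rewrite -subr_eq0 -normr_le0; apply/ler_addgt0Pr => e e0; rewrite add0r.
have C0 : 0 < 2 * `|C| + 1 by rewrite ltr_wpDl// mulr_ge0.
have e1 : 0 < e / (2 * `|C| + 1) by rewrite divr_gt0.
have [h [bh Eh gh]] := bounded_measurable_approx (@measurableT _ _)
  (Pr := fun h => J1 h = J2 h) Ec E1 (fun g h bg bh e1 e2 =>
    etrans (D1 g h bg bh) (etrans (congr2 +%R e1 e2) (esym (D2 g h bg bh)))) bg e1.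
have gh' x : `|g x - h x| <= e / (2 * `|C| + 1) by exact: gh.
rewrite -(subrKA (J1 h)) {2}Eh (le_trans (ler_normD _ _))//.
have a1 := C1 _ _ _ bg bh gh'.
have a2 := C2 _ _ _ bg bh gh'.
rewrite [X in _ + X]distrC (le_trans (lerD a1 a2))//.
rewrite (_ : _ + _ = e / (2 * `|C| + 1) * (2 * C)); last by ring.
rewrite (@le_trans _ _ (e / (2 * `|C| + 1) * (2 * `|C| + 1)))//; last first.
  by rewrite divfK// gt_eqF.
rewrite ler_pM2l// (@le_trans _ _ (2 * `|C|))//; last by rewrite lerDl.
by rewrite ler_wpM2l// ler_norm.
Qed.

Lemma independent_mean (U V : {RV P >-> R}) (phi psi : R -> R) :
  independent_pair U V ->
  bounded_measurable setT phi -> bounded_measurable setT psi ->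
  mean P (fun w => phi (U w) * psi (V w)) =
  mean P (fun w => phi (U w)) * mean P (fun w => psi (V w)).
Proof.
move=> ind bphi bpsi.
have cD (X : {RV P >-> R}) (g h k : R -> R) (Z : {RV P >-> R}) :
    bounded_measurable setT g -> bounded_measurable setT h -> bounded_measurable setT k ->
    mean P (fun w => (g \+ h) (X w) * k (Z w)) =
    mean P (fun w => g (X w) * k (Z w)) + mean P (fun w => h (X w) * k (Z w)).
  move=> bg bh bk; rewrite -meanD; last 2 first.
  - by apply: bounded_measurableM; exact: bounded_measurable_comp.
  - by apply: bounded_measurableM; exact: bounded_measurable_comp.
  by congr mean; apply/funext => w /=; rewrite mulrDl.
have cC (X : {RV P >-> R}) (g h k : R -> R) (Z : {RV P >-> R}) M e :
    bounded_measurable setT g -> bounded_measurable setT h -> bounded_measurable setT k ->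
    (forall x, `|k x| <= M) ->
    (forall x, `|g x - h x| <= e) ->
    `|mean P (fun w => g (X w) * k (Z w)) - mean P (fun w => h (X w) * k (Z w))| <= M * e.
  move=> bg bh bk kM ghe; apply: mean_close.
  - by apply: bounded_measurableM; exact: bounded_measurable_comp.
  - by apply: bounded_measurableM; exact: bounded_measurable_comp.
  by move=> w; rewrite -mulrBl normrM mulrC ler_pM.
have mD (X : {RV P >-> R}) (g h : R -> R) :
    bounded_measurable setT g -> bounded_measurable setT h ->
    mean P (fun w => (g \+ h) (X w)) = mean P (fun w => g (X w)) + mean P (fun w => h (X w)).
  by move=> bg bh; rewrite -meanD//; exact: bounded_measurable_comp.
have mC (X : {RV P >-> R}) (g h : R -> R) e :
    bounded_measurable setT g -> bounded_measurable setT h ->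
    (forall x, `|g x - h x| <= e) ->
    `|mean P (fun w => g (X w)) - mean P (fun w => h (X w))| <= e.
  by move=> bg bh ghe; apply: mean_close => //; exact: bounded_measurable_comp.
have mi (X : {RV P >-> R}) (c : R) (B : set R) : measurable B ->
    mean P (fun w => (c \*o \1_B) (X w)) = c * fine (P (X @^-1` B)).
  move=> mB; have mXB : measurable (X @^-1` B).
    by rewrite -[X in measurable X]setTI; exact: measurable_funP.
  rewrite -(mean_indic P mXB) -meanZ//; exact: bounded_measurable_indic.
have ind2 c (B : set R) c' (B' : set R) : measurable B -> measurable B' ->
    mean P (fun w => (c \*o \1_B) (U w) * (c' \*o \1_B') (V w)) =
    mean P (fun w => (c \*o \1_B) (U w)) * mean P (fun w => (c' \*o \1_B') (V w)).
  move=> mB mB'; rewrite !mi//.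
  have mUB : measurable (U @^-1` B).
    by rewrite -[X in measurable X]setTI; exact: measurable_funP.
  have mVB : measurable (V @^-1` B').
    by rewrite -[X in measurable X]setTI; exact: measurable_funP.
  have mI : measurable (U @^-1` B `&` V @^-1` B') by exact: measurableI.
  rewrite (_ : (fun w => _) = (c * c') \*o \1_(U @^-1` B `&` V @^-1` B')); last first.
    by apply/funext => w /=; rewrite indicI /=; ring.
  rewrite meanZ; last exact: bounded_measurable_indic.
  rewrite mean_indic// ind// fineM ?fin_num_measure//; ring.
have [_ [M1 phiM]] := bphi; have [_ [M2 psiM]] := bpsi.
have phiM' x : `|phi x| <= `|M1| by rewrite (le_trans (phiM x I))// ler_norm.
have psiM' x : `|psi x| <= `|M2| by rewrite (le_trans (psiM x I))// ler_norm.
have bi c (B : set R) : measurable B -> bounded_measurable setT (c \*o \1_B : R -> R).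
  by move=> mB; apply: bounded_measurableZ; exact: bounded_measurable_indic.
have mb k M (X : {RV P >-> R}) : bounded_measurable setT k -> (forall x, `|k x| <= M) ->
    `|mean P (fun w => k (X w))| <= M.
  by move=> bk kM; apply: mean_bound; [exact: bounded_measurable_comp|move=> w; exact: kM].
have step c (B : set R) : measurable B ->
    mean P (fun w => (c \*o \1_B) (U w) * psi (V w)) =
    mean P (fun w => (c \*o \1_B) (U w)) * mean P (fun w => psi (V w)).
  move=> mB.
  have iM x : `|(c \*o \1_B) x| <= `|c|.
    by rewrite /= normrM ler_piMr// indicE; case: (_ \in _); rewrite ?normr1 ?normr0.
  pose sw g := mean P (fun w => g (V w) * (c \*o \1_B) (U w)).
  have swE g : mean P (fun w => (c \*o \1_B) (U w) * g (V w)) = sw g.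
    by congr mean; apply/funext => w; rewrite mulrC.
  rewrite swE.
  apply: (@bounded_functionals_eq sw (fun g => mean P (fun w => (c \*o \1_B) (U w)) *
     mean P (fun w => g (V w))) `|c|) => //.
  - by move=> g h bg bh; apply: cD => //; exact: bi.
  - by move=> g h bg bh; rewrite mD// mulrDr.
  - by move=> g h e bg bh ghe; apply: cC => //; exact: bi.
  - move=> g h e bg bh ghe; rewrite -mulrBr normrM ler_pM//; last exact: mC.
    by apply: mb => //; exact: bi.
  - by move=> c' B' mB'; rewrite -swE ind2.
apply: (@bounded_functionals_eq (fun g => mean P (fun w => g (U w) * psi (V w)))
  (fun g => mean P (fun w => g (U w)) * mean P (fun w => psi (V w))) `|M2|) => //.
- by move=> g h bg bh; exact: cD.
- by move=> g h bg bh; rewrite mD// mulrDl.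
- by move=> g h e bg bh ghe; exact: cC.
- move=> g h e bg bh ghe; rewrite -mulrBl normrM mulrC ler_pM//; last exact: mC.
  exact: mb.
Qed.

(** Pairwise independence makes centred functions of the variables orthogonal. *)
Lemma mean_sqr_sum (X : nat -> {RV P >-> R}) (psi : R -> R) (s : seq nat) :
  (forall i j, i != j -> independent_pair (X i) (X j)) ->
  bounded_measurable setT psi ->
  (forall i, mean P (fun w => psi (X i w)) = 0) -> uniq s ->
  mean P (fun w => (\sum_(j <- s) psi (X j w)) ^+ 2) =
  \sum_(j <- s) mean P (fun w => psi (X j w) ^+ 2).
Proof.
move=> ind bpsi psi0.
have bX i : bounded_measurable setT (fun w => psi (X i w)) by exact: bounded_measurable_comp.
have bXX i j : bounded_measurable setT (fun w => psi (X i w) * psi (X j w)).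
  exact: bounded_measurableM.
have bS t : bounded_measurable setT (fun w => \sum_(j <- t) psi (X j w)).
  exact: bounded_measurable_sum.
elim: s => [_|i s ih /= /andP[si us]].
  rewrite big_nil; under eq_fun do rewrite big_nil expr0n.
  exact: mean_cst.
rewrite big_cons -ih//.
rewrite (_ : (fun w => _) = ((fun w => psi (X i w) ^+ 2) \+
    (2 \*o (fun w => \sum_(j <- s) psi (X i w) * psi (X j w)))) \+
    (fun w => (\sum_(j <- s) psi (X j w)) ^+ 2)); last first.
  by apply/funext => w /=; rewrite big_cons sqrrD -mulr_sumr -mulr_natl; ring.
have bsq f : bounded_measurable setT f -> bounded_measurable setT (fun w : Omega => f w ^+ 2).
  by move=> bf; have := bounded_measurableM bf bf; apply.
have bSS : bounded_measurable setT (fun w => \sum_(j <- s) psi (X i w) * psi (X j w)).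
  exact: bounded_measurable_sum.
rewrite meanD; [|apply: bounded_measurableD; [exact: bsq|exact: bounded_measurableZ]|exact: bsq].
rewrite meanD; [|exact: bsq|exact: bounded_measurableZ].
rewrite meanZ// mean_sum// big_seq big1 ?mulr0 ?addr0// => j js.
rewrite independent_mean ?psi0 ?mul0r//; apply: ind.
by apply: contraNneq si => ->.
Qed.

End independence.

(** * An almost sure rate in the law of large numbers *)

Section truncation_bounds.
Context {R : realType}.
Implicit Types a x p : R.

Definition truncated a x : R := Num.min (at_least_one x) a.
Definition excess a x : R := at_least_one x - truncated a x.

Lemma truncated_bounds a x : 1 <= a -> 1 <= truncated a x <= a.
Proof. by move=> a1; rewrite le_min at_least_one_ge1 a1 ge_min lexx orbT. Qed.

Lemma excess_ge0 a x : 0 <= excess a x.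
Proof. by rewrite subr_ge0 ge_min lexx. Qed.

Lemma truncated_sqr_le p a x : 0 < p <= 2 -> 1 <= a ->
  truncated a x ^+ 2 <= a `^ (2 - p) * at_least_one x `^ p.
Proof.
move=> /andP[p0 p2] a1; have /andP[t1 ta] := truncated_bounds x a1.
have t0 := lt_le_trans ltr01 t1.
have ty : truncated a x <= at_least_one x by rewrite ge_min lexx.
rewrite (_ : truncated a x ^+ 2 = truncated a x `^ (2 - p) * truncated a x `^ p).
  rewrite ler_pM ?powR_ge0//.
    by rewrite ge0_ler_powR ?nnegrE ?subr_ge0 ?(ltW t0)// (le_trans ler01).
  by rewrite ge0_ler_powR ?nnegrE ?(ltW p0) ?(ltW t0)// (le_trans ler01)// at_least_one_ge1.
by rewrite -powRD ?subrK ?powR_mulrn ?(ltW t0)// (gt_eqF t0) implybT.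
Qed.

Lemma excess_le p a x : 1 < p -> 1 <= a ->
  excess a x <= a `^ (1 - p) * at_least_one x `^ p.
Proof.
move=> p1 a1; have y1 := at_least_one_ge1 x; have y0 := lt_le_trans ltr01 y1.
rewrite /excess /truncated; have [ya|ay] := leP (at_least_one x) a.
  by rewrite subrr mulr_ge0// powR_ge0.
have a0 := lt_le_trans ltr01 a1.
apply: (@le_trans _ _ (at_least_one x)); first by rewrite gerBl ltW.
have e : at_least_one x = at_least_one x `^ (1 - p) * at_least_one x `^ p.
  by rewrite -powRD ?subrK ?powRr1 ?(ltW y0)// (gt_eqF y0) implybT.
rewrite [leLHS]e ler_wpM2r ?powR_ge0//.
rewrite -[1 - p]opprB !powRN lef_pV2 ?posrE ?powR_gt0//.
by rewrite ge0_ler_powR ?nnegrE ?subr_ge0 ?(ltW p1) ?(ltW a0) ?(ltW y0)// ltW.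
Qed.

Lemma measurable_truncated a : measurable_fun setT (truncated a).
Proof.
apply: measurable_minr; [exact: measurable_at_least_one|exact: measurable_cst].
Qed.

Lemma measurable_excess a : measurable_fun setT (excess a).
Proof.
by apply: measurable_funB; [exact: measurable_at_least_one|exact: measurable_truncated].
Qed.

Lemma bounded_truncated a : 1 <= a -> bounded_measurable setT (truncated a).
Proof.
move=> a1; split; first exact: measurable_truncated.
exists a => x _; have /andP[t1 t2] := truncated_bounds x a1.
by rewrite ger0_norm// (le_trans ler01).
Qed.

End truncation_bounds.

Section strong_law_rate.
Context {d : measure_display} {Omega : measurableType d} {R : realType}.
Variable P : probability Omega R.
Variables (Y : {RV P >-> R}) (X : nat -> {RV P >-> R}) (p theta : R).
Hypothesis ind : forall i j, i != j -> independent_pair (X i) (X j).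
Hypothesis idd : forall i (B : set R), measurable B ->
  distribution P (X i) B = distribution P Y B.
Hypothesis p1 : 1 < p.
Hypothesis p2 : p <= 2.
Hypothesis ptheta : p^-1 < theta.
Hypothesis theta1 : theta <= 1.
Hypothesis mom : (\int[P]_w (at_least_one (Y w) `^ p)%:E < +oo)%E.

Let M : R := fine (\int[P]_w (at_least_one (Y w) `^ p)%:E)%E.

Let p0 : 0 < p. Proof. exact: lt_trans ltr01 p1. Qed.

Let M0 : 0 <= M.
Proof. by apply: fine_ge0; apply: integral_ge0 => w _; rewrite lee_fin powR_ge0. Qed.

Let ME : (\int[P]_w (at_least_one (Y w) `^ p)%:E = M%:E)%E.
Proof.
rewrite /M fineK// ge0_fin_numE// integral_ge0// => w _.
by rewrite lee_fin powR_ge0.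
Qed.

Let my : measurable_fun setT (fun w => at_least_one (Y w)).
Proof. by apply: measurableT_comp; [exact: measurable_at_least_one|]. Qed.

Let myp : measurable_fun setT (fun w => (at_least_one (Y w) `^ p)%:E).
Proof.
apply/measurable_EFinP.
by apply: (@measurableT_comp _ _ _ _ _ _ (fun x => x `^ p)); first exact: measurable_powR.
Qed.

Lemma moment_bound (phi : R -> R) c : measurable_fun setT phi -> 0 <= c ->
  (forall x, 0 <= phi x <= c * at_least_one x `^ p) ->
  (\int[P]_w (phi (Y w))%:E <= (c * M)%:E)%E.
Proof.
move=> mphi c0 phib.
rewrite EFinM -ME -ge0_integralZl//; last by move=> w _; rewrite lee_fin powR_ge0.
apply: ge0_le_integral => //.
- by move=> w _; rewrite lee_fin; have /andP[] := phib (Y w).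
- by apply/measurable_EFinP; exact: measurableT_comp.
- by apply: emeasurable_funM => //; exact: measurable_cst.
- by move=> w _; rewrite -EFinM lee_fin; have /andP[] := phib (Y w).
Qed.

Lemma same_law (phi : R -> R) i : measurable_fun setT phi -> (forall x, 0 <= phi x) ->
  (\int[P]_w (phi (X i w))%:E = \int[P]_w (phi (Y w))%:E)%E.
Proof.
move=> mphi phi0.
have mE : measurable_fun setT (EFin \o phi) by exact/measurable_EFinP.
have E0 x : (0 <= (EFin \o phi) x)%E by rewrite lee_fin.
have := ge0_integral_distribution (X i) mE E0; rewrite /comp => <-.
have := ge0_integral_distribution Y mE E0; rewrite /comp => <-.
by apply: eq_measure_integral => B mB _; exact: idd.
Qed.

Section level.
Variable a : R.
Hypothesis a1 : 1 <= a.

Definition truncated_mean : R := mean P (fun w => truncated a (Y w)).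

Definition centred (x : R) : R := truncated a x - truncated_mean.

Let bT : bounded_measurable setT (truncated a). Proof. exact: bounded_truncated. Qed.

Let T0 x : 0 <= truncated a x.
Proof. by have /andP[h _] := truncated_bounds x a1; rewrite (le_trans ler01). Qed.

Lemma bounded_centred : bounded_measurable setT centred.
Proof. by apply: bounded_measurableB => //; exact: bounded_measurable_cst. Qed.

Let mean_truncated i : mean P (fun w => truncated a (X i w)) = truncated_mean.
Proof.
by rewrite /truncated_mean /mean /Rintegral same_law//; exact: measurable_truncated.
Qed.

Lemma mean_centred i : mean P (fun w => centred (X i w)) = 0.
Proof.
rewrite (_ : (fun w => _) = (fun w => truncated a (X i w)) \- cst truncated_mean)//.
rewrite meanB ?mean_cst ?mean_truncated ?subrr//.
  exact: bounded_measurable_comp.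
exact: bounded_measurable_cst.
Qed.

Lemma mean_centred_sqr i : mean P (fun w => centred (X i w) ^+ 2) <= a `^ (2 - p) * M.
Proof.
have bTX : bounded_measurable setT (fun w => truncated a (X i w)) by exact: bounded_measurable_comp.
have bTT : bounded_measurable setT (fun w => truncated a (X i w) ^+ 2).
  by have := bounded_measurableM bTX bTX; apply.
have bc c : bounded_measurable setT (cst c : Omega -> R) by exact: bounded_measurable_cst.
rewrite (_ : (fun w => _) = ((fun w => truncated a (X i w) ^+ 2) \-
    ((2 * truncated_mean) \*o (fun w => truncated a (X i w)))) \+ cst (truncated_mean ^+ 2)); last first.
  by apply/funext => w /=; rewrite /centred; ring.
have bZ : bounded_measurable setT ((2 * truncated_mean) \*o (fun w => truncated a (X i w))).
  exact: bounded_measurableZ.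
rewrite meanD//; last exact: bounded_measurableB.
rewrite meanB// meanZ// mean_cst mean_truncated.
rewrite (@le_trans _ _ (mean P (fun w => truncated a (X i w) ^+ 2)))//.
  by have := sqr_ge0 truncated_mean; rewrite expr2; lra.
rewrite -lee_fin -mean_integral//.
have mT2 : measurable_fun setT (fun x : R => truncated a x ^+ 2).
  by apply: measurable_funX; exact: measurable_truncated.
rewrite (@same_law (fun x => truncated a x ^+ 2))//; last by move=> x; rewrite sqr_ge0.
apply: (@moment_bound (fun x => truncated a x ^+ 2)) => //; first exact: powR_ge0.
by move=> x; rewrite sqr_ge0 truncated_sqr_le// p0.
Qed.

Lemma integral_excess i : (\int[P]_w (excess a (X i w))%:E <= (a `^ (1 - p) * M)%:E)%E.
Proof.
rewrite same_law; [|exact: measurable_excess|exact: excess_ge0].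
apply: moment_bound; [exact: measurable_excess|exact: powR_ge0|].
by move=> x; rewrite excess_ge0 excess_le.
Qed.

Definition limit_mean : R := fine (\int[P]_w (at_least_one (Y w))%:E)%E.

Lemma truncated_mean_close : 0 <= limit_mean - truncated_mean <= a `^ (1 - p) * M.
Proof.
have E : (\int[P]_w (at_least_one (Y w))%:E = truncated_mean%:E +
    \int[P]_w (excess a (Y w))%:E)%E.
  rewrite /truncated_mean -mean_integral; last exact: bounded_measurable_comp.
  rewrite -ge0_integralD//.
  - by apply: eq_integral => w _; rewrite -EFinD /excess addrC subrK.
  - by move=> w _; rewrite lee_fin.
  - by apply/measurable_EFinP; apply: measurableT_comp => //; exact: measurable_truncated.
  - by move=> w _; rewrite lee_fin excess_ge0.
  - by apply/measurable_EFinP; apply: measurableT_comp => //; exact: measurable_excess.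
have e0 : (0 <= \int[P]_w (excess a (Y w))%:E)%E.
  by apply: integral_ge0 => w _; rewrite lee_fin excess_ge0.
have e1 : (\int[P]_w (excess a (Y w))%:E <= (a `^ (1 - p) * M)%:E)%E.
  apply: moment_bound; [exact: measurable_excess|exact: powR_ge0|].
  by move=> x; rewrite excess_ge0 excess_le.
have ef : (\int[P]_w (excess a (Y w))%:E \is a fin_num)%E.
  by rewrite ge0_fin_numE// (le_lt_trans e1)// ltry.
rewrite /limit_mean E -(fineK ef) /= [X in X - _]addrC addrK.
by rewrite -!lee_fin fineK// e0.
Qed.

(** By orthogonality each of the [J] levels contributes the [2 ^ J] variances of
    the individual variables. *)
Lemma mean_block_energy J :
  mean P (fun w => block_energy (fun j => centred (X j w)) J) <=
  J%:R * (2 ^+ J * (a `^ (2 - p) * M)).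
Proof.
set s := a `^ (2 - p) * M.
have bsq f : bounded_measurable setT f -> bounded_measurable setT (fun w : Omega => f w ^+ 2).
  by move=> bf; have := bounded_measurableM bf bf; apply.
have bcX j : bounded_measurable setT (fun w => centred (X j w)).
  by apply: bounded_measurable_comp; exact: bounded_centred.
have bb i b : bounded_measurable setT (fun w => block_sum (fun j => centred (X j w)) i b).
  exact: bounded_measurable_sum.
rewrite mean_sum; last first.
  by move=> i; apply: bounded_measurable_sum => b; exact: bsq.
rewrite (@le_trans _ _ (\sum_(i < J) 2 ^+ J * s))//; last first.
  by rewrite sumr_const card_ord mulr_natl.
apply: ler_sum => i _.
rewrite mean_sum; last by move=> b; exact: bsq.
rewrite (@le_trans _ _ (\sum_(b < 2 ^ (J - i)) 2 ^+ i * s))//; last first.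
  rewrite sumr_const card_ord -mulrnAl -[_ *+ _]mulr_natr natrX -exprD subnKC//.
  exact: ltnW.
apply: ler_sum => b _.
rewrite (@mean_sqr_sum _ _ _ _ X centred)//; last 3 first.
- exact: bounded_centred.
- exact: mean_centred.
- exact: iota_uniq.
rewrite (@le_trans _ _ (\sum_(b * 2 ^ i <= j < b.+1 * 2 ^ i) s))//.
  by apply: ler_sum => j _; exact: mean_centred_sqr.
by rewrite sumr_const_nat mulSn addnK -[leLHS]mulr_natl natrX.
Qed.

End level.

Definition level (J : nat) : R := 2 `^ (J%:R / p).
Definition weight (J : nat) : R := 2 `^ (- (theta * J%:R)).

Let level_ge1 J : 1 <= level J.
Proof.
rewrite /level; have : 0 <= J%:R / p by rewrite divr_ge0// ltW.
rewrite le_eqVlt => /predU1P[<-|h]; first by rewrite powRr0.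
by rewrite ltW// powR_gt1 ?ltr1n.
Qed.

Let weight_gt0 J : 0 < weight J. Proof. by rewrite powR_gt0. Qed.

(** The truncated sums and the excesses up to the index [2 ^ J], measured in the
    unit [2 ^ (J theta)] allowed to the deviations. *)
Definition energy J (w : Omega) : R :=
  J%:R * weight J ^+ 2 * block_energy (fun j => centred (level J) (X j w)) J +
  weight J * \sum_(j < 2 ^ J) excess (level J) (X j w).

Let be0 J z : 0 <= block_energy z J :> R.
Proof. by apply: sumr_ge0 => i _; apply: sumr_ge0 => b _; rewrite sqr_ge0. Qed.

Let ex0 J w : 0 <= \sum_(j < 2 ^ J) excess (level J) (X j w).
Proof. by apply: sumr_ge0 => j _; exact: excess_ge0. Qed.

Let energy_l0 J w :
  0 <= J%:R * weight J ^+ 2 * block_energy (fun j => centred (level J) (X j w)) J.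
Proof. by rewrite mulr_ge0// mulr_ge0// sqr_ge0. Qed.

Let energy_r0 J w : 0 <= weight J * \sum_(j < 2 ^ J) excess (level J) (X j w).
Proof. by rewrite mulr_ge0// ltW. Qed.

Lemma energy_ge0 J w : 0 <= energy J w.
Proof. by rewrite addr_ge0. Qed.

Let bounded_be J : bounded_measurable setT
  (fun w => block_energy (fun j => centred (level J) (X j w)) J).
Proof.
apply: bounded_measurable_sum => i; apply: bounded_measurable_sum => b.
have bb : bounded_measurable setT
    (fun w => block_sum (fun j => centred (level J) (X j w)) i b).
  apply: bounded_measurable_sum => j; apply: bounded_measurable_comp.
  exact: bounded_centred.
by have := bounded_measurableM bb bb; apply.
Qed.

Let measurable_ex J j : measurable_fun setT (fun w => excess (level J) (X j w)).
Proof. by apply: measurableT_comp => //; exact: measurable_excess. Qed.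

Let measurable_l J : measurable_fun setT
  (fun w => J%:R * weight J ^+ 2 * block_energy (fun j => centred (level J) (X j w)) J).
Proof.
by apply: measurable_funM; [exact: measurable_cst|case: (bounded_be J)].
Qed.

Let measurable_r J : measurable_fun setT
  (fun w => weight J * \sum_(j < 2 ^ J) excess (level J) (X j w)).
Proof.
apply: measurable_funM; first exact: measurable_cst.
by apply: measurable_sum => j; exact: measurable_ex.
Qed.

Lemma measurable_energy J : measurable_fun setT (energy J).
Proof. exact: measurable_funD. Qed.

Let dl : R := theta - p^-1.
Let dl0 : 0 < dl. Proof. by rewrite subr_gt0. Qed.

(** The expected energy decays like [2 ^ - (2 J dl)] up to the factor [J ^+ 2] for
    the truncated sums, and like [2 ^ - (J dl)] for the excesses, where
    [dl = theta - 1 / p]. *)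
Lemma integral_energy : exists2 C : R, 0 <= C & forall J,
  (\int[P]_w (energy J w)%:E <= (C * (2 `^ (- dl)) ^+ J)%:E)%E.
Proof.
pose c := (2 `^ (dl / 2) - 1)^-1 : R.
exists ((c ^+ 2 + 1) * M); first by rewrite mulr_ge0// addr_ge0// sqr_ge0.
move=> J; rewrite /energy.
under eq_integral do rewrite EFinD.
rewrite ge0_integralD//; last 4 first.
- by move=> w _; rewrite lee_fin.
- exact/measurable_EFinP.
- by move=> w _; rewrite lee_fin.
- exact/measurable_EFinP.
rewrite mulrDl mul1r mulrDl EFinD; apply: leeD.
  rewrite (eq_integral (fun w => ((J%:R * weight J ^+ 2)%:E *
    (block_energy (fun j => centred (level J) (X j w)) J)%:E)%E)); last first.
    by move=> w _; rewrite EFinM.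
  rewrite ge0_integralZl//; last 3 first.
  - by apply/measurable_EFinP; case: (bounded_be J).
  - by move=> w _; rewrite lee_fin.
  - by rewrite lee_fin mulr_ge0// sqr_ge0.
  rewrite mean_integral// -EFinM lee_fin.
  rewrite (le_trans (ler_wpM2l _ (mean_block_energy (level_ge1 J) J)))//.
    by rewrite mulr_ge0// sqr_ge0.
  have E : weight J ^+ 2 * (2 ^+ J * level J `^ (2 - p)) = 2 `^ (- (2 * dl * J%:R)).
    rewrite -(powR_mulrn J (ler0n _ 2)) /weight /level exprn_powR -powRrM.
    rewrite -!powRD ?pnatr_eq0 ?implybT//; congr (_ `^ _).
    by rewrite /dl; field; rewrite gt_eqF.
  rewrite [leLHS](_ : _ = J%:R ^+ 2 * (weight J ^+ 2 * (2 ^+ J * level J `^ (2 - p))) * M); last by ring.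
  rewrite E [leRHS]mulrAC ler_wpM2r//.
  have Jc := @nat_le_powR R (dl / 2) J ltac:(by rewrite divr_gt0).
  have Jc2 : J%:R ^+ 2 <= (c * 2 `^ (dl / 2 * J%:R)) ^+ 2.
    by rewrite ler_sqr ?nnegrE// (le_trans _ Jc).
  rewrite (le_trans (ler_wpM2r (powR_ge0 _ _) Jc2))// exprMn -[leLHS]mulrA ler_wpM2l ?sqr_ge0//.
  rewrite exprn_powR exprn_powR -powRD ?pnatr_eq0 ?implybT//.
  by rewrite le_eqVlt; apply/orP; left; apply/eqP; congr (_ `^ _); field.
rewrite (eq_integral (fun w => ((weight J)%:E *
    \sum_(j < 2 ^ J) (excess (level J) (X j w))%:E)%E)); last first.
  by move=> w _; rewrite EFinM sumEFin.
rewrite ge0_integralZl//; last 3 first.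
- by apply: emeasurable_sum => j; apply/measurable_EFinP.
- by move=> w _; apply: sume_ge0 => j _; rewrite lee_fin excess_ge0.
- by rewrite lee_fin ltW.
rewrite ge0_integral_sum//; last 2 first.
- by move=> j; apply/measurable_EFinP.
- by move=> j w _; rewrite lee_fin excess_ge0.
apply: (@le_trans _ _ ((weight J)%:E * \sum_(j < 2 ^ J) ((level J) `^ (1 - p) * M)%:E)%E).
  apply: lee_wpmul2l; first by rewrite lee_fin ltW.
  by apply: lee_sum => j _; exact: integral_excess.
rewrite sumEFin -EFinM lee_fin sumr_const card_ord -[_ *+ _]mulr_natl natrX.
rewrite [leLHS](_ : _ = weight J * (2 ^+ J * level J `^ (1 - p)) * M); last by ring.
rewrite [leRHS]mulrC ler_wpM2r// -(powR_mulrn J (ler0n _ 2)) /weight /level exprn_powR -powRrM.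
rewrite -!powRD ?pnatr_eq0 ?implybT//.
by rewrite le_eqVlt; apply/orP; left; apply/eqP; congr (_ `^ _); rewrite /dl; field; rewrite gt_eqF.
Qed.

Definition total_energy (w : Omega) : \bar R := (\sum_(0 <= J <oo) (energy J w)%:E)%E.

Let te0 w : (0 <= total_energy w)%E.
Proof. by apply: nneseries_ge0 => J _ _; rewrite lee_fin energy_ge0. Qed.

Lemma measurable_total_energy : measurable_fun setT total_energy.
Proof.
apply: ge0_emeasurable_sum => [J w _ _|J _]; first by rewrite lee_fin energy_ge0.
by apply/measurable_EFinP; exact: measurable_energy.
Qed.

Lemma total_energy_finite : {ae P, forall w, total_energy w \is a fin_num}.
Proof.
have [C C0 CJ] := integral_energy.
have fin : (\int[P]_w total_energy w < +oo)%E.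
  rewrite integral_nneseries//; last 2 first.
  - by move=> J; apply/measurable_EFinP; exact: measurable_energy.
  - by move=> J w _; rewrite lee_fin energy_ge0.
  apply: (@le_lt_trans _ _ (\sum_(0 <= J <oo) (C * (2 `^ (- dl)) ^+ J)%:E)%E).
    apply: lee_nneseries => J _; last exact: CJ.
    by move=> _; apply: integral_ge0 => w _; rewrite lee_fin energy_ge0.
  apply: nneseries_geometric => //.
  by rewrite powR_ge0/= powRN invf_lt1 ?powR_gt0// powR_gt1 ?ltr1n.
have int : P.-integrable setT total_energy.
  apply/integrableP; split; first exact: measurable_total_energy.
  by rewrite (eq_integral total_energy)// => w _; rewrite gee0_abs.
by have := integrable_ae measurableT int; apply: filterS => w; apply.
Qed.

(** For [k] between [2 ^ (J - 1)] and [2 ^ J], the sum splits into centred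
    truncated variables, excesses, and the bias of the truncated mean; the first
    two are bounded by the energy of level [J], hence by the total energy. *)
Lemma deviation_rate : exists A : Omega -> R,
  [/\ measurable_fun setT A, (forall w, 0 <= A w) &
   {ae P, forall w, forall k : nat,
     `|\sum_(j < k) (at_least_one (X j w) - limit_mean)| <= A w * k%:R `^ theta}].
Proof.
exists (fun w => 2 * (2 * fine (total_energy w) + 1 + M)); split.
- apply: measurable_funM; first exact: measurable_cst.
  apply: measurable_funD; last exact: measurable_cst.
  apply: measurable_funD; last exact: measurable_cst.
  apply: measurable_funM; first exact: measurable_cst.
  exact: measurableT_comp measurable_total_energy.
- by move=> w; rewrite mulr_ge0// addr_ge0// addr_ge0// mulr_ge0// fine_ge0.
have := total_energy_finite; apply: filterS => w tf k.
set V := fine (total_energy w); have V0 : 0 <= V by rewrite fine_ge0.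
have theta0 : 0 < theta by rewrite (lt_trans _ ptheta)// invr_gt0.
have VM : 0 <= 2 * V + 1 + M by rewrite addr_ge0// addr_ge0// mulr_ge0.
case: k => [|k].
  by rewrite big_ord0 normr0 mulr_ge0 ?powR_ge0// mulr_ge0.
pose J := (trunc_log 2 k.+1).+1.
have /andP[kJ1 kJ] := trunc_log_bounds (isT : (1 < 2)%N) (isT : (0 < k.+1)%N).
rewrite -/J in kJ.
have eV : energy J w <= V.
  rewrite -lee_fin fineK//.
  apply: le_trans (nneseries_lim_ge J.+1 _) => [|i _ _]; last by rewrite lee_fin energy_ge0.
  rewrite big_nat_recr//= leeDr// sume_ge0// => i _.
  by rewrite lee_fin energy_ge0.
have w0 := weight_gt0 J; have l1 := level_ge1 J.
pose wi := (weight J)^-1; have wi0 : 0 < wi by rewrite invr_gt0.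
pose S1 := \sum_(j < k.+1) centred (level J) (X j w).
pose S2 := \sum_(j < k.+1) excess (level J) (X j w).
have -> : \sum_(j < k.+1) (at_least_one (X j w) - limit_mean) =
    S1 + S2 - k.+1%:R * (limit_mean - truncated_mean (level J)).
  rewrite /S1 /S2 -big_split /= -[in k.+1%:R](card_ord k.+1) mulr_natl -sumr_const -sumrB.
  by apply: eq_bigr => j _; rewrite /centred /excess; ring.
have b1 : `|S1| <= wi * (V + 1).
  have h : S1 ^+ 2 <= (wi * (V + 1)) ^+ 2.
    rewrite (le_trans (partial_sum_block_energy (fun j => centred (level J) (X j w)) kJ))//.
    rewrite exprMn /wi exprVn [leRHS]mulrC ler_pdivlMr ?exprn_gt0//.
    have := le_trans (_ : _ <= energy J w) eV.
    move=> /(_ (J%:R * weight J ^+ 2 * block_energy (fun j => centred (level J) (X j w)) J)).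
    rewrite lerDl energy_r0 => /(_ isT) h2.
    rewrite mulrAC (le_trans h2)// sqrrD expr1n mulr1.
    by have := sqr_ge0 V; lra.
  by rewrite -ler_sqr ?nnegrE ?real_normK ?num_real// mulr_ge0 ?addr_ge0// ltW.
have b2 : `|S2| <= wi * V.
  rewrite ger0_norm; last by apply: sumr_ge0 => j _; exact: excess_ge0.
  rewrite mulrC ler_pdivlMr//.
  apply: le_trans eV; rewrite mulrC /energy.
  apply: (@le_trans _ _ (weight J * \sum_(j < 2 ^ J) excess (level J) (X j w))); last by rewrite lerDr.
  rewrite ler_pM2l// /S2 -(big_mkord xpredT (fun j => excess (level J) (X j w))).
  rewrite -(big_mkord xpredT (fun j => excess (level J) (X j w))).
  rewrite [leRHS](@big_cat_nat _ _ _ k.+1)//=; last exact: ltnW.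
  by rewrite lerDl sumr_ge0// => j _; exact: excess_ge0.
have b3 : `|k.+1%:R * (limit_mean - truncated_mean (level J))| <= wi * M.
  have /andP[m0 m1] := truncated_mean_close l1.
  rewrite ger0_norm ?mulr_ge0// (@le_trans _ _ (2 ^+ J * (level J `^ (1 - p) * M)))//.
    by rewrite ler_pM// -natrX ler_nat ltnW.
  rewrite mulrA ler_wpM2r// /wi /weight -powRN opprK.
  rewrite -(powR_mulrn J (ler0n _ 2)) /level -powRrM -powRD ?pnatr_eq0 ?implybT//.
  rewrite (_ : _ + _ = p^-1 * J%:R); last by field; rewrite gt_eqF.
  by rewrite ler_powR ?ler1n// ler_wpM2r// ltW.
have bw : wi <= 2 * k.+1%:R `^ theta.
  rewrite /wi /weight -powRN opprK mulrC -powR_exprn// -natrX.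
  rewrite (@le_trans _ _ ((2 * k.+1%:R) `^ theta))//.
    by rewrite ge0_ler_powR ?nnegrE ?(ltW theta0)// -natrM ler_nat expnS leq_mul2l.
  rewrite powRM// ler_wpM2r ?powR_ge0//.
  by rewrite -[leRHS]powRr1// ler_powR// ler1n.
rewrite (le_trans (ler_normB _ _))// (le_trans (lerD (ler_normD _ _) (lexx _)))//.
rewrite (le_trans (lerD (lerD b1 b2) b3))//.
rewrite (_ : _ + _ = wi * (2 * V + 1 + M)); last by ring.
rewrite [leRHS](_ : _ = 2 * k.+1%:R `^ theta * (2 * V + 1 + M)); last by ring.
by rewrite ler_wpM2r.
Qed.

End strong_law_rate.

(** * The random landscape *)

Section environment_facts.
Context {d : measure_display} {Omega : measurableType d} {R : realType}.
Variables (P : probability Omega R) (alpha : R) (tau : int -> {RV P >-> R}).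
Hypothesis alpha1 : 1 < alpha.
Hypothesis env : bouchaud_environment alpha tau.

Lemma independent_traps x y : x != y -> independent_pair (tau x) (tau y).
Proof.
case: env => ind _ _ xy A B mA mB.
pose C z := if z == x then A else B.
have mC z : measurable (C z) by rewrite /C; case: ifP.
have u : uniq [:: x; y] by rewrite /= inE xy.
have := ind _ _ u mC.
by rewrite !big_cons !big_nil setIT mule1 /C eqxx eq_sym (negbTE xy).
Qed.

Lemma trap_ge1 x : {ae P, forall w, 1 <= tau x w}.
Proof.
case: env => _ idd par.
have mge : measurable [set w | 1 <= tau x w].
  rewrite (_ : [set _ | _] = setT `&` tau x @^-1` `[1, +oo[); first exact: measurable_funP.
  by apply/seteqP; split => w /=; rewrite in_itv/= andbT; [|case].
have P1 : P [set w | 1 <= tau x w] = 1%E.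
  have <- := pareto_ge1 alpha1 par.
  have := idd x _ (measurable_itv `[1, +oo[); rewrite /distribution /pushforward.
  have e y : tau y @^-1` `[1, +oo[ = [set w | 1 <= tau y w].
    by apply/seteqP; split => w /=; rewrite in_itv/= andbT.
  by rewrite !e.
exists (~` [set w | 1 <= tau x w]); split => //; first exact: measurableC.
by rewrite probability_setC// P1 subee.
Qed.

Lemma traps_ge1 : {ae P, forall w, forall x, 1 <= tau x w}.
Proof.
have h1 : {ae P, forall w, forall n : nat, 1 <= tau (Posz n) w}.
  by apply/ae_foralln => n; exact: trap_ge1.
have h2 : {ae P, forall w, forall n : nat, 1 <= tau (Negz n) w}.
  by apply/ae_foralln => n; exact: trap_ge1.
by apply: filterS2 h1 h2 => w a b [n|n].
Qed.

Lemma expected_trap : limit_mean (tau 0) = fine 'E_P[tau 0]%E.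
Proof.
rewrite /limit_mean expectation_def; congr fine; apply: ae_eq_integral => //.
- apply/measurable_EFinP; apply: measurableT_comp => //.
  exact: measurable_at_least_one.
- exact/measurable_EFinP.
by apply: filterS (trap_ge1 0) => w h _; rewrite /at_least_one max_l.
Qed.

Variable theta : R.
Hypothesis theta_alpha : alpha^-1 < theta.
Hypothesis theta_half : 2^-1 < theta.
Hypothesis theta1 : theta <= 1.

Let theta0 : 0 < theta. Proof. by rewrite (lt_trans _ theta_half). Qed.
Let alpha0 : 0 < alpha. Proof. exact: lt_trans ltr01 alpha1. Qed.

(** This is where both [1 / alpha] and [1 / 2] limit the rate: second moments are
    the best that orthogonality can use, even if higher ones are finite. *)
Lemma moment_exponent : exists p : R, [/\ 1 < p, p <= 2, p < alpha & p^-1 < theta].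
Proof.
pose M := Num.max alpha^-1 2^-1.
have M1 : M < theta by rewrite /M gt_max theta_alpha.
have Mlt : M < 1 by rewrite (lt_le_trans M1).
have Ma : alpha^-1 <= M by rewrite le_max lexx.
have Mh : 2^-1 <= M by rewrite le_max lexx orbT.
pose r := (M + theta) / 2.
have r1 : M < r by rewrite midf_lt.
have r2 : r < theta by rewrite midf_lt.
have r0 : 0 < r by rewrite (lt_trans _ r1)// (lt_le_trans _ Mh).
exists r^-1; split; rewrite ?invrK//.
- by rewrite -[ltLHS]invr1 ltf_pV2 ?posrE// (lt_le_trans r2).
- by rewrite -[leRHS]invrK lef_pV2 ?posrE// ltW// (le_lt_trans Mh).
- by rewrite -[ltRHS]invrK ltf_pV2 ?posrE ?invr_gt0// (le_lt_trans Ma).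
Qed.

Lemma expected_trap_ge1 : 1 <= fine 'E_P[tau 0]%E.
Proof.
have [p [p1 p2 pa pt]] := moment_exponent.
have par : pareto_tail alpha (tau 0) by case: env.
have p0a : 0 < p < alpha by rewrite (lt_trans ltr01 p1).
have mom := pareto_moment par p0a.
rewrite -expected_trap.
have := @truncated_mean_close _ _ _ P (tau 0) p p1 mom 1 (lexx 1).
move=> /andP[+ _]; rewrite subr_ge0; apply: le_trans.
rewrite /truncated_mean (_ : (fun w => _) = cst 1) ?mean_cst//.
by apply/funext => w; rewrite /truncated min_r// at_least_one_ge1.
Qed.

Lemma one_sided_deviation (X : nat -> int) : injective X -> exists A : Omega -> R,
  [/\ measurable_fun setT A, (forall w, 0 <= A w) &
   {ae P, forall w, forall k : nat,
     `|\sum_(j < k) (tau (X j) w - fine 'E_P[tau 0]%E)| <= A w * k%:R `^ theta}].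
Proof.
move=> iX.
have [p [p1 p2 pa pt]] := moment_exponent.
have [_ idd par] := env.
have p0a : 0 < p < alpha by rewrite (lt_trans ltr01 p1).
have mom := pareto_moment par p0a.
have ind i j : i != j -> independent_pair (tau (X i)) (tau (X j)).
  by move=> ij; apply: independent_traps; apply: contraNneq ij => /iX ->.
have [A [mA A0 hA]] := deviation_rate ind (fun i => idd (X i)) p1 p2 pt theta1 mom.
exists A; split => //; apply: filterS2 traps_ge1 hA => w t1 h k.
rewrite -expected_trap; have := h k; under eq_bigr do rewrite /at_least_one max_l//.
by [].
Qed.

Lemma half_line_sum_bound (v : int -> R) m A (i : nat) :
  0 <= m -> 1 <= v 0 -> 0 <= A ->
  `|\sum_(j < i) (v j.+1%:Z - m)| <= A * i%:R `^ theta ->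
  `|half_line_sum v m i| <= (v 0 + m + A) * (1 + i%:R) `^ theta.
Proof.
move=> m0 v0 A0 h; rewrite /half_line_sum.
have p1 : 1 <= (1 + i%:R) `^ theta.
  have e : 1 `^ theta = 1 :> R by rewrite powR1.
  rewrite -[leLHS]e.
  by rewrite ge0_ler_powR ?nnegrE ?(ltW theta0)// ?addr_ge0// lerDl.
rewrite big_add1 /= big_mkord [leRHS]mulrDl (le_trans (ler_normD _ _))// lerD//.
  rewrite (@le_trans _ _ (v 0 + m))//.
    by rewrite ler_norml; apply/andP; split; move: m0 v0; lra.
  by rewrite ler_peMr// addr_ge0// (le_trans _ v0).
rewrite (le_trans h)// ler_wpM2l// ge0_ler_powR ?nnegrE ?(ltW theta0)// ?addr_ge0//.
by rewrite lerDr.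
Qed.

(** A single random constant serves both half-lines; it includes the contribution
    of the trap at the origin. *)
Lemma environment_deviation : exists A : Omega -> R,
  [/\ measurable_fun setT A, (forall w, 1 <= A w) &
   {ae P, forall w, forall i : nat,
     `|half_line_sum (fun x => tau x w) (fine 'E_P[tau 0]%E) i| <=
       A w * (1 + i%:R) `^ theta /\
     `|half_line_sum ((fun x => tau x w) \o -%R) (fine 'E_P[tau 0]%E) i| <=
       A w * (1 + i%:R) `^ theta}].
Proof.
set m := fine _; have m1 : 1 <= m by exact: expected_trap_ge1.
have m0 := le_trans ler01 m1.
have i1 : injective (fun j : nat => j.+1%:Z) by move=> a b [].
have i2 : injective (fun j : nat => - j.+1%:Z) by move=> a b /oppr_inj [].
have [A1 [mA1 A10 h1]] := one_sided_deviation i1.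
have [A2 [mA2 A20 h2]] := one_sided_deviation i2.
exists (fun w => `|tau 0 w| + m + (A1 w + A2 w)); split.
- apply: measurable_funD; last exact: measurable_funD.
  apply: measurable_funD; last exact: measurable_cst.
  by apply: measurableT_comp; [exact: normr_measurable|].
- move=> w; have := normr_ge0 (tau 0 w); have := A10 w; have := A20 w.
  by move: m1; lra.
apply: filterS3 traps_ge1 h1 h2 => w t1 a1 a2 i.
have n0 : 0 <= tau 0 w by rewrite (le_trans _ (t1 0)).
rewrite (ger0_norm n0).
have p0 : 0 <= (1 + i%:R) `^ theta by exact: powR_ge0.
split.
  have h := @half_line_sum_bound (fun x => tau x w) m (A1 w) i m0 (t1 0) (A10 w) (a1 i).
  rewrite (le_trans h)// ler_wpM2r//; have := A20 w; lra.
have h := @half_line_sum_bound ((fun x => tau x w) \o -%R) m (A2 w) i m0.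
rewrite /= oppr0 in h; rewrite (le_trans (h (t1 0) (A20 w) (a2 i)))// ler_wpM2r//.
have := A10 w; lra.
Qed.

End environment_facts.

(** * The norm of BL^kappa and the random constant *)

Section bounded_lipschitz.
Context {R : realType}.
Variables (kappa : R) (f : R -> R).

Lemma BLnorm_bounds : (BLnorm kappa f < +oo)%E -> exists2 B : R,
  BLnorm kappa f = B%:E &
  (forall x, `|f x| <= B) /\ (forall x y, `|f x - f y| <= B * `|x - y| `^ kappa).
Proof.
rewrite /BLnorm; set s1 := ereal_sup _; set s2 := ereal_sup _ => fin.
have u1 x : (`|f x|%:E <= s1)%E by apply: ereal_sup_ubound; exists x.
have u2 x y : x != y -> ((`|f x - f y| / `|x - y| `^ kappa)%:E <= s2)%E.
  by move=> xy; apply: ereal_sup_ubound; exists (x, y).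
have s10 : (0 <= s1)%E by rewrite (le_trans _ (u1 0))// lee_fin.
have s20 : (0 <= s2)%E.
  have h : (0 : R) != 1 by rewrite eq_sym oner_eq0.
  by rewrite (le_trans _ (u2 _ _ h))// lee_fin divr_ge0// powR_ge0.
have f1 : s1 \is a fin_num.
  by rewrite ge0_fin_numE// (le_lt_trans _ fin)// leeDl.
have f2 : s2 \is a fin_num.
  by rewrite ge0_fin_numE// (le_lt_trans _ fin)// leeDr.
have b1 : 0 <= fine s1 by exact: fine_ge0.
have b2 : 0 <= fine s2 by exact: fine_ge0.
exists (fine s1 + fine s2); first by rewrite EFinD !fineK.
split=> [x|x y].
  have := u1 x; rewrite -(fineK f1) lee_fin => h.
  by rewrite (le_trans h)// lerDl.
have [->|xy] := eqVneq x y; first by rewrite subrr normr0 mulr_ge0 ?powR_ge0// addr_ge0.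
have n0 : 0 < `|x - y| `^ kappa by rewrite powR_gt0// normr_gt0 subr_eq0.
have := u2 x y xy; rewrite -(fineK f2) lee_fin ler_pdivrMr// => h.
by rewrite (le_trans h)// ler_wpM2r ?(ltW n0)// lerDr.
Qed.

End bounded_lipschitz.

Lemma rate_constant_ge0 (R : realType) (m K t A : R) :
  0 <= m -> 0 <= K -> 0 <= t -> 0 <= A -> 0 <= rate_constant m K t A.
Proof.
move=> m0 K0 t0 A0; rewrite /rate_constant.
set G := 8 ^+ 4; set S := A * _; set V := (m + 2) * A + 2 * t.
have G0 : 0 <= G by exact: exprn_ge0.
have S0 : 0 <= S by rewrite mulr_ge0// sqr_ge0.
have V0 : 0 <= V by rewrite addr_ge0 ?mulr_ge0 ?addr_ge0.
have W0 : 0 <= 6 * G * S by rewrite mulr_ge0// mulr_ge0.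
set W := 6 * G * S in W0 *; have GS0 : 0 <= 63 * G * S * t.
  by rewrite mulr_ge0// mulr_ge0// mulr_ge0.
have WV0 : 0 <= (2 + W) * V by rewrite mulr_ge0// addr_ge0.
by move: G0 V0 W0 GS0 WV0 t0; lra.
Qed.

Lemma measurable_rate_constant (R : realType) d (Omega : measurableType d)
    (m K t : R) (A : Omega -> R) : measurable_fun setT A ->
  measurable_fun setT (fun w => rate_constant m K t (A w)).
Proof.
move=> mA; rewrite /rate_constant.
by repeat first [exact: measurable_cst | exact: mA | apply: measurable_funD
                | apply: measurable_funM].
Qed.

Theorem theorem8p15 (R : realType)
    (d : measure_display) (Omega : measurableType d) (P : probability Omega R)
    (alpha : R) (tau : int -> {RV P >-> R})
    (dY : measure_display) (WY : measurableType dY)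
    (QY : R -> probability WY R) (Y : R -> WY -> R)
    (kappa t K E : R) :
  1 < alpha ->
  bouchaud_environment alpha tau ->
  diffusion_process (fine 'E_P[tau (0 : int)]%E) QY Y ->
  2^-1 < kappa -> kappa <= 1 ->
  0 < t -> 0 < K ->
  E < kappa / (3 * kappa + 4) * Num.min (1 - alpha^-1) 2^-1 ->
  exists C : {RV P >-> R},
    {ae P, forall omega,
      forall n : nat, (0 < n)%N ->
      forall (dX : measure_display) (WX : measurableType dX)
        (QX : R -> probability WX R) (X : R -> WX -> R),
      btm_process n (fun x : int => tau x omega) QX X ->
      forall f : R -> R, (BLnorm kappa f < +oo)%E ->
      (ereal_sup [set `| expect QY Y x t f
                       - expect QX X ((Num.floor (n%:R * x))%:~R / n%:R) t f |%:E
                  | x in [set x : R | (`|x| <= K)%R]]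
       <= (C omega)%:E * BLnorm kappa f * (n%:R `^ (- E))%:E)%E}.
Proof.
move=> alpha1 env dif kappa_half kappa1 t0 K0 hE.
set m := fine 'E_P[tau (0 : int)]%E in dif.
pose beta := Num.min (1 - alpha^-1) 2^-1 : R.
have alpha0 : 0 < alpha by rewrite (lt_trans ltr01).
have ia1 : alpha^-1 < 1 by rewrite invf_lt1.
have ia0 : 0 < alpha^-1 by rewrite invr_gt0.
have beta0 : 0 < beta by rewrite lt_min subr_gt0 ia1 invr_gt0 /=.
have ba : beta <= 1 - alpha^-1 by rewrite ge_min lexx.
have bh : beta <= 2^-1 by rewrite ge_min lexx orbT.
have kappa0 : 0 < kappa by rewrite (lt_trans _ kappa_half)// invr_gt0.
have den0 : 0 < 3 * kappa + 4 by rewrite addr_gt0// mulr_gt0.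
(* the mollification scale is [n ^ - b]; the limit exponent is [kappa b] *)
pose b := beta / (3 * kappa + 4).
have b0 : 0 < b by rewrite divr_gt0.
have bk : b * (3 * kappa + 4) = beta by rewrite /b divfK// gt_eqF.
have bk' : b * (4 + 2 * kappa) < beta.
  by rewrite -bk ltr_pM2l//; move: kappa0; lra.
have Eb : E < kappa * b.
  by rewrite (lt_le_trans hE)// /b -/beta mulrA mulrAC.
pose theta := deviation_exponent kappa b.
have t1 : alpha^-1 < theta.
  by rewrite /theta /deviation_exponent; move: bk' ba; lra.
have t2 : 2^-1 < theta.
  by rewrite /theta /deviation_exponent; move: bk' bh; lra.
have t3 : theta <= 1.
  rewrite /theta /deviation_exponent gerBl mulr_ge0 ?(ltW b0)//.
  by rewrite addr_ge0// mulr_ge0// ltW.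
have b1 : b * (4 + 2 * kappa) <= 1 by move: bk' bh; lra.
have m1 : 1 <= m := expected_trap_ge1 alpha1 env t1 t2 t3.
have [A [mA A1 hA]] := environment_deviation alpha1 env t1 t2 t3.
pose C0 w := rate_constant m K t (A w).
have mC0 : measurable_fun setT C0 by exact: measurable_rate_constant.
exists (mfun_Sub (mem_set mC0)).
apply: filterS2 (traps_ge1 alpha1 env) hA => w v1 hw n n0 dX WX QX X btm f fin.
have [B BE [fB fH]] := BLnorm_bounds fin.
rewrite BE -!EFinM; apply: ub_ereal_sup => _ [x /= xK <-]; rewrite lee_fin.
rewrite (le_trans (deterministic_rate n0 v1 m1 (A1 w) kappa0 kappa1 b0 b1 K0 t0
  (fun i => (hw i).1) (fun i => (hw i).2) btm dif fB fH xK))//.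
have B0 : 0 <= B := le_trans (normr_ge0 _) (fB 0).
have C00 : 0 <= C0 w.
  by apply: rate_constant_ge0; rewrite ?(ltW t0) ?(ltW K0) ?(le_trans ler01).
rewrite ler_wpM2l ?mulr_ge0//= /error_scale ler_powR ?ler1n//.
by rewrite lerN2 ltW.
Qed.
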